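(* Let $T>0$, let $s\ge1$ be an integer, let $b_1,\dots,b_s$ be nonzero real numbers, and let $\alpha\ge1$ be an integer. Let $u$, the solution of the periodic initial-value problem for the KdV equation $$u_t+uu_x+u_{xxx}=0,\quad x\in[-\pi,\pi],\ 0\le t\le T,\qquad u(x,0)=u_0(x),$$ belong to $H^\mu$ for $t\in[0,T]$, where $\mu$ is sufficiently large. For integers $N\ge1$, $M\ge1$ put $k=T/M$, $t^n=nk$. Consider the fully discrete scheme: seek real-valued $Y^{n,i}\in S_N$, $0\le i\le s$, $0\le n\le M-1$, and $U^n\in S_N$, $0\le n\le M$, such that $U^0=P_Nu_0$ and, for $0\le n\le M-1$, $$Y^{n,0}=U^n,\qquad Y^{n,i}=Y^{n,i-1}+kb_iF\left(\frac{Y^{n,i}+Y^{n,i-1}}{2}\right),\ 1\le i\le s,\qquad U^{n+1}=Y^{n,s}.$$ Suppose that the local temporal errors $\theta^n$ of the scheme (defined in the context) satisfy $$\max_{0\le n\le M-1}\|\theta^n\|\le Ck^{\alpha+1}$$ with a constant $C$ independent of $k$ and $N$, and suppose that $kN$ is sufficiently small. Then the fully discrete scheme has for all $n$, $0\le n\le M$, a unique solution $U^n$, and $$\max_{0\le n\le M}\|U^n-u(t^n)\|\le C\left(k^{\alpha}+N^{1-\mu}\right),$$ where $C$ is a constant independent of $k$ and $N$.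
   Context: All functions of $x$ are $2\pi$-periodic; $u_0$ is real-valued. $L^2=L^2(-\pi,\pi)$ has inner product $(v,w)=\int_{-\pi}^{\pi}v\overline{w}\,dx$ and norm $\|\cdot\|$. For real $\mu\ge 0$, $H^{\mu}$ is the $L^2$-based Sobolev space of periodic functions on $(-\pi,\pi)$ with norm $\|g\|_{\mu}=\left(\sum_{k\in\mathbb{Z}}(1+k^2)^{\mu}|\widehat g(k)|^2\right)^{1/2}$, where $\widehat g(k)=\frac1{2\pi}\int_{-\pi}^{\pi}e^{-ikx}g(x)\,dx$. ''The solution $u$ belongs to $H^\mu$ for $t\in[0,T]$'' means that $u_0\in H^\mu$ and $u\in C([0,T];H^{\mu})$ is the (unique, real-valued) solution of the initial-value problem. For an integer $N\ge1$, $S_N=\mathrm{span}\{e^{ikx}: k\in\mathbb{Z},\ -N\le k\le N\}$, and $P_N$ is the $L^2$-projection onto $S_N$, $P_Nv=\sum_{|k|\le N}\widehat v(k)e^{ikx}$. For real-valued $v\in S_N$, $F(v)=-v_{xxx}-P_N\left(f(v)_x\right)$ with $f(v)=v^2/2$. The semidiscrete Fourier-Galerkin approximation is the real-valued map $u^N:[0,T]\to S_N$ satisfying $u^N_t=F(u^N)$ for $0\le t\le T$ and $u^N(0)=P_Nu_0$; it exists uniquely on $[0,T]$. Local temporal error: let $V^n=u^N(t^n)$ for $0\le n\le M$, and for $0\le n\le M-1$ let real-valued $V^{n,i}\in S_N$ satisfy $V^{n,0}=V^n$ and $V^{n,i}=V^{n,i-1}+kb_iF\left(\frac{V^{n,i}+V^{n,i-1}}{2}\right)$,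 $1\le i\le s$ (such $V^{n,i}$ exist). Then $\theta^n=u^N(t^{n+1})-V^{n,s}\in S_N$. Meaning of the quantifiers: there is $\mu_0$ such that if $\mu\ge\mu_0$ and the local error bound holds, with one constant, for all pairs $(N,k)$ in some set $\mathcal{D}$ of discretization parameters ($N\ge1$ integer, $k=T/M$, $M\ge1$ integer), then there exist $c>0$ and $C$, independent of $(N,k)$, such that the conclusions hold for all $(N,k)\in\mathcal{D}$ with $kN\le c$. *)

(* Defs.v *)
From HB Require Import structures.
From mathcomp Require Import all_boot all_order all_algebra.
From mathcomp Require Import all_classical all_reals all_analysis.
From mathcomp Require Import complex.
From mathcomp Require Import zify.
Set Implicit Arguments.
Unset Strict Implicit.
Unset Printing Implicit Defensive.
Import Order.TTheory GRing.Theory Num.Theory.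
Import numFieldNormedType.Exports.

Local Open Scope classical_set_scope.
Local Open Scope ring_scope.
Local Open Scope complex_scope.

Section Defs.
Context {R : realType}.

(** Functions on the circle are functions [R -> R] that are 2pi-periodic.
    Norms are extended-real valued; [fourier_coef] is meaningful on
    integrable functions only, hence the [L2norm] clause in [in_H]. *)

Definition circle : set R := `[- pi, pi].

Definition L2norm (g : R -> R) : \bar R :=
  sqrte (\int[lebesgue_measure]_(x in circle) ((g x) ^+ 2)%:E)%E.

(** [cis y] is [e^(iy)]. *)
Definition cis (y : R) : R[i] := cos y +i* sin y.

(** [1/(2pi) * int e^(-ikx) g(x) dx] for a real-valued [g], with
    [e^(-ikx) = cos (kx) - i sin (kx)]. *)
Definition fourier_coef (g : R -> R) (k : int) : R[i] :=
  ((2 * pi)^-1 *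
     Rintegral lebesgue_measure circle (fun x => cos (k%:~R * x) * g x)) -i*
  ((2 * pi)^-1 *
     Rintegral lebesgue_measure circle (fun x => sin (k%:~R * x) * g x)).

Definition sqmod (z : R[i]) : R := complex.Re z ^+ 2 + complex.Im z ^+ 2.

Definition Hnorm (mu : R) (g : R -> R) : \bar R :=
  sqrte (\esum_(k in [set: int])
    ((1 + k%:~R ^+ 2) `^ mu * sqmod (fourier_coef g k))%:E).

Definition in_H (mu : R) (g : R -> R) : Prop :=
  [/\ periodic g (2 * pi), measurable_fun circle g,
      (L2norm g < +oo)%E & (Hnorm mu g < +oo)%E].

(** [-N, ..., N] *)
Definition freqs (N : nat) : seq int :=
  [seq j%:Z - N%:Z | j <- iota 0 (N.*2).+1].

Definition trig_span (N : nat) : set (R -> R[i]) :=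
  [set v | exists c : int -> R[i],
     forall x, v x = \sum_(k <- freqs N) c k * cis (k%:~R * x)].

(** The real-valued elements of [S_N]. *)
Definition in_S (N : nat) (v : R -> R) : Prop :=
  trig_span N (fun x => (v x)%:C).

Definition fourier_sum (N : nat) (v : R -> R) (x : R) : R[i] :=
  \sum_(k <- freqs N) fourier_coef v k * cis (k%:~R * x).

(** [P_N v] as a real-valued function; see [fourier_sum_real]. *)
Definition proj (N : nat) (v : R -> R) (x : R) : R :=
  complex.Re (fourier_sum N v x).

Definition kdvF (N : nat) (v : R -> R) : R -> R :=
  fun x => - derive1n 3 v x - proj N (derive1 (fun y => v y ^+ 2 / 2)) x.

(** Derivative relative to the set [D]: one-sided at the endpoints of an
    interval. *)
Definition is_derive_on (D : set R) (f : R -> R) (t l : R) : Prop :=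
  h^-1 * (f (t + h) - f t) @[h --> within [set h | D (t + h)] 0^'] --> l.

Definition kdv_solution (T mu : R) (u0 : R -> R) (u : R -> R -> R) : Prop :=
  [/\ in_H mu u0 /\ (forall t, t \in `[0, T] -> in_H mu (u t)),
      forall t, t \in `[0, T] ->
        Hnorm mu (u r \- u t) @[r --> within `[0, T] (nbhs t)] --> 0%E,
      forall x, u 0 x = u0 x
    & forall t x, t \in `[0, T] ->
        (forall j, (j < 3)%N -> derivable (derive1n j (u t)) x 1) /\
        is_derive_on `[0, T] (u^~ x) t
          (- (u t x * derive1 (u t) x) - derive1n 3 (u t) x)].

Definition semidiscrete (T : R) (N : nat) (u0 : R -> R) (v : R -> R -> R) :
    Prop :=
  [/\ forall t, t \in `[0, T] -> in_S N (v t),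
      forall t x, t \in `[0, T] ->
        is_derive_on `[0, T] (v^~ x) t (kdvF N (v t) x)
    & forall x, v 0 x = proj N u0 x].

(** One time step of length [k] started at [y]; the weights are
    [b 1, ..., b s]. *)
Definition time_step (N s : nat) (b : nat -> R) (k : R) (y : R -> R)
    (Y : nat -> R -> R) : Prop :=
  [/\ forall i, (i <= s)%N -> in_S N (Y i),
      forall x, Y 0%N x = y x
    & forall i x, (1 <= i <= s)%N ->
        Y i x = Y i.-1 x
                + k * b i * kdvF N (fun z => (Y i z + Y i.-1 z) / 2) x].

(** The fully discrete scheme over its first [m] steps. *)
Definition fully_discrete (N s : nat) (b : nat -> R) (k : R) (u0 : R -> R)
    (m : nat) (U : nat -> R -> R) (Y : nat -> nat -> R -> R) : Prop :=
  [/\ forall n, (n <= m)%N -> in_S N (U n),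
      forall x, U 0%N x = proj N u0 x
    & forall n, (n < m)%N ->
        time_step N s b k (U n) (Y n) /\ forall x, U n.+1 x = Y n s x].

Let RintegralN (f : R -> R) :
  Rintegral lebesgue_measure circle (fun x => - f x) =
  - Rintegral lebesgue_measure circle f.
Proof.
rewrite /Rintegral [in LHS]integralE [in RHS]integralE.
rewrite (_ : (fun x => (- f x)%:E)^\+%E = (fun x => (f x)%:E)^\-%E); last first.
  by rewrite -funeposN.
rewrite (_ : (fun x => (- f x)%:E)^\-%E = (fun x => (f x)%:E)^\+%E); last first.
  by rewrite -funenegN.
by move: (integral _ _ _) (integral _ _ _) => [x| |] [y| |] //=;
  rewrite ?oppr0 // opprB.
Qed.

Lemma fourier_coefN (g : R -> R) (k : int) :
  fourier_coef g (- k) = complex.Re (fourier_coef g k) -i*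
                         complex.Im (fourier_coef g k).
Proof.
rewrite /fourier_coef /= mulrNz; congr (_ +i* _).
  by under eq_fun do rewrite mulNr cosN.
by under eq_fun do rewrite mulNr sinN mulNr; rewrite RintegralN mulrN.
Qed.

Lemma fourier_sum_real (N : nat) (v : R -> R) (x : R) :
  fourier_sum N v x = (proj N v x)%:C.
Proof.
suff im0 : complex.Im (fourier_sum N v x) = 0.
  by rewrite /proj; move: im0; case: (fourier_sum N v x) => a b /= ->.
pose F (k : int) := complex.Im (fourier_coef v k * cis (k%:~R * x)).
have FN k : F (- k) = - F k.
  rewrite /F fourier_coefN mulrNz mulNr /cis cosN sinN /=.
  by case: (fourier_coef v k) => a b /=; rewrite mulrN mulNr -opprD.
have FE : complex.Im (fourier_sum N v x) = \sum_(k <- freqs N) F k.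
  by rewrite /fourier_sum raddf_sum.
have revE : perm_eq (freqs N) [seq - k | k <- freqs N].
  apply: uniq_perm.
  - by rewrite map_inj_uniq ?iota_uniq // => i j /addIr [].
  - rewrite map_inj_uniq; last exact: oppr_inj.
    by rewrite map_inj_uniq ?iota_uniq // => i j /addIr [].
  - have memE (k : int) : (k \in freqs N) = (`|k| <= N%:Z)%R.
      apply/mapP/idP => [[j] |].
        rewrite mem_iota add0n ltnS => /andP[_ jN] ->.
        rewrite ler_norml; apply/andP; split; lia.
      rewrite ler_norml => /andP[k1 k2].
      exists (absz (k + N%:Z)); last lia.
      by rewrite mem_iota; apply/andP; split => //; lia.
    move=> k; rewrite memE -[k in RHS]opprK mem_map; last exact: oppr_inj.
    by rewrite memE normrN.
have : \sum_(k <- freqs N) F k = - \sum_(k <- freqs N) F k.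
  rewrite [LHS](perm_big _ revE) [LHS]big_map -sumrN.
  by apply: eq_bigr => k _; exact: FN.
rewrite FE => /eqP; rewrite -addr_eq0 -mulr2n mulrn_eq0 /= => /eqP //.
Qed.

End Defs.

(* Main.v *)
Require Import Defs.
From HB Require Import structures.
From mathcomp Require Import all_boot all_order all_algebra.
From mathcomp Require Import all_classical all_reals all_analysis.
From mathcomp Require Import complex.
From mathcomp Require Import zify ring lra.
Import Order.TTheory GRing.Theory Num.Theory.
Import numFieldNormedType.Exports.
Set Implicit Arguments.
Unset Strict Implicit.
Unset Printing Implicit Defensive.
Local Open Scope classical_set_scope.
Local Open Scope ring_scope.

(** Why the theorem is true.

    The scheme is conservative.  Tested with [m], the difference
    [F(z + m) - F(z)] keeps nothing of the third derivative and nothing cubic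
    in [m]: what remains is [-1/2] times the integral of [z_x m^2]
    ([kdvF_energy]).  Hence in comparing two solutions only one of them has to
    have a bounded derivative.  For one implicit midpoint stage this gives
    stability in [L^2] with a factor [exp (|tau| sup |z_x|)]
    ([stage_stable]), and uniqueness of the stage is the case of equal data.

    Existence of a stage comes from a contraction on Fourier coefficients
    ([stage_map_fixpoint], [midpoint_solvable]).  The dispersive term is treated
    implicitly: dividing by [1 - i tau j^3], of modulus at least 1, costs
    nothing.  The quadratic term is a convolution, so it is bounded by a product
    in any norm [sum_j w(j) |v^(j)|] with submultiplicative [w], and its
    derivative costs a factor [N]; the map contracts because [k N] is small.
    The weight 1 is controlled by the [L^2] norm at the price of [sqrt (3N)]
    and serves for existence; the weight [1 + |j|] controls [sup |z_x|] and
    serves for stability.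

    In time the error is propagated from the local solutions [V^n], which
    start on the semidiscrete solution.  Stability with respect to [V^n], whose
    derivative is bounded, gives
    [e(n+1) <= exp (gamma k) e(n) + C k^(alpha+1)], so [e(n) = O(k^alpha)].
    Then [sqrt (3N) k^alpha <= 2 k N T^(alpha-1)] keeps the fully discrete
    solution in a fixed ball for the weight 1, where the next step is uniquely
    solvable ([discrete_error]).

    The semidiscrete solution [u^N] is compared with [P_N u] by the same energy
    identity.  The consistency error is the [L^2] distance from [u] to [P_N u]
    multiplied by [N], that is [O(N^(1-mu))], and Gronwall's inequality concludes
    ([energy_rate], [gronwall], [galerkin_error]).  Multiplied by
    [N sqrt (3N)] this error is still bounded, so [u^N] is bounded in the norm
    with weight [1 + |j|] ([galerkin_wiener]).

    The equation for [u] holds pointwise, with derivatives of which neither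
    continuity nor boundedness is given.  Both are recovered from the decay of
    the Fourier coefficients, which is uniform in time by compactness of [[0, T]]
    ([sobolev_sum_bounded_in_time]).  The Fourier series of a differentiable
    periodic function converges to it ([fourier_pointwise]); the derivatives of
    its partial sums are bounded, hence converge to the derivatives of the
    function ([cvg_derives]).  Therefore [u_xxx] and [u_t] are bounded, and the
    Fourier coefficients of [u] may be differentiated in time under the integral
    ([proj_time_derive]).  The square of the [L^2] norm of the error is
    differentiated in time as a finite sum over equispaced nodes, by a quadrature
    that is exact on [S_2N] ([node_sqnorm]). *)

Local Notation proj := Defs.proj.
Local Notation nc := ComplexField.Normc.normc.

(** * Integrals of continuous functions over the circle *)

(** Locked, since comparing two integrals up to conversion unfolds the Lebesgue
    measure. *)
HB.lock Definition integ {R : realType} (f : R -> R) : R :=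
  Rintegral lebesgue_measure circle f.

Section Circle.
Context {R : realType}.
Implicit Types (f g h : R -> R).


Lemma integrable_circle f : continuous f ->
  lebesgue_measure.-integrable circle (EFin \o f).
Proof.
move=> cf; apply: continuous_compact_integrable; first exact: segment_compact.
exact: continuous_subspaceT.
Qed.

Lemma measurable_circle : measurable (circle : set R).
Proof. exact: measurable_itv. Qed.

Lemma integD f g : continuous f -> continuous g ->
  integ (fun x => f x + g x) = integ f + integ g.
Proof.
by move=> cf cg; rewrite integ.unlock; apply: RintegralD;
  [exact: measurable_circle | exact: integrable_circle..].
Qed.

Lemma integB f g : continuous f -> continuous g ->
  integ (fun x => f x - g x) = integ f - integ g.
Proof.
by move=> cf cg; rewrite integ.unlock; apply: RintegralB;
  [exact: measurable_circle | exact: integrable_circle..].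
Qed.

Lemma integZ a f : continuous f -> integ (fun x => a * f x) = a * integ f.
Proof.
by move=> cf; rewrite integ.unlock; apply: RintegralZl;
  [exact: measurable_circle | exact: integrable_circle..].
Qed.

Lemma integN f : continuous f -> integ (fun x => - f x) = - integ f.
Proof.
move=> cf; rewrite -mulN1r -integZ//; congr integ.
by apply/funext => x; rewrite mulN1r.
Qed.

Lemma integ_cst (a : R) : integ (fun=> a) = a * (2 * pi).
Proof.
rewrite integ.unlock Rintegral_cst//; last exact: measurable_circle.
congr (_ * _).
transitivity (fine ((pi - - pi)%:E : \bar R)); last first.
  by rewrite /= opprK -mulr2n mulr_natl.
congr fine; rewrite /circle.
have := @lebesgue_measure_itv R `[- pi, pi]; rewrite /= lte_fin gtrN ?pi_gt0//.
Qed.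

Lemma le_integ f g : continuous f -> continuous g ->
  (forall x, f x <= g x) -> integ f <= integ g.
Proof.
move=> cf cg fg; rewrite integ.unlock; apply: le_Rintegral => //; first exact: measurable_circle.
  exact: integrable_circle.
exact: integrable_circle.
Qed.

Lemma integ_ge0 f : (forall x, 0 <= f x) -> 0 <= integ f.
Proof. by move=> f0; rewrite integ.unlock; apply: Rintegral_ge0 => x _. Qed.

Lemma eq_integ f g : (forall x, f x = g x) -> integ f = integ g.
Proof. by move=> fg; congr integ; apply/funext. Qed.

Lemma le_norm_integ f : continuous f -> `|integ f| <= integ (fun x => `|f x|).
Proof.
move=> cf; rewrite integ.unlock; apply: le_normr_Rintegral; first exact: measurable_circle.
exact: integrable_circle.
Qed.

Lemma continuous_norm f : continuous f -> continuous (fun x => `|f x|).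
Proof. by move=> cf x; apply: cvg_norm; exact: cf. Qed.

Definition derives f g := forall x : R, is_derive x 1 f (g x).

Lemma derives_continuous f g : derives f g -> continuous f.
Proof.
move=> df x; apply: differentiable_continuous.
by apply/derivable1_diffP; have [] := df x.
Qed.

Lemma derivesE f g : derives f g -> derive1 f = g.
Proof. by move=> df; apply/funext => x; rewrite derive1E; have [_ ->] := df x. Qed.

Lemma derivesP f : (forall x, derivable f x 1) -> derives f (derive1 f).
Proof.
by move=> df x; apply: DeriveDef; [exact: df | rewrite derive1E].
Qed.

Lemma derivesD f f' g g' : derives f f' -> derives g g' ->
  derives (fun x => f x + g x) (fun x => f' x + g' x).
Proof. by move=> df dg x; have := df x; have := dg x => *; exact: is_deriveD. Qed.

Lemma derivesB f f' g g' : derives f f' -> derives g g' ->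
  derives (fun x => f x - g x) (fun x => f' x - g' x).
Proof. by move=> df dg x; have := df x; have := dg x => *; exact: is_deriveB. Qed.

Lemma derivesZ a f f' : derives f f' ->
  derives (fun x => a * f x) (fun x => a * f' x).
Proof. by move=> df x; have := df x => ?; exact: is_deriveZ. Qed.

Lemma derivesM f f' g g' : derives f f' -> derives g g' ->
  derives (fun x => f x * g x) (fun x => f' x * g x + f x * g' x).
Proof.
move=> df dg x; have := df x; have := dg x => *.
have -> : f' x * g x + f x * g' x = f x *: g' x + g x *: f' x.
  by rewrite /GRing.scale /= addrC [f' x * _]mulrC.
exact: is_deriveM.
Qed.

Lemma derives_cst a : derives (fun=> a) (fun=> 0).
Proof. by move=> x; exact: is_derive_cst. Qed.

Lemma derives_ext f g f' g' : (forall x, f x = g x) ->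
  (forall x, f' x = g' x) -> derives f f' -> derives g g'.
Proof. by move=> /funext -> /funext ->. Qed.

Lemma is_derive_sum_seq (I : Type) (s : seq I) (F : I -> R -> R) (dF : I -> R) (t : R) :
  (forall i, is_derive t 1 (F i) (dF i)) ->
  is_derive t 1 (fun r => \sum_(i <- s) F i r) (\sum_(i <- s) dF i).
Proof.
move=> H; elim: s => [|i s ih].
  rewrite big_nil (_ : (fun r => _) = fun=> 0); last by apply/funext => r; rewrite big_nil.
  exact: is_derive_cst.
rewrite big_cons (_ : (fun r => \sum_(j <- i :: s) F j r) =
   fun r => F i r + \sum_(j <- s) F j r); last by apply/funext => r; rewrite big_cons.
by have := H i => Hi; exact: is_deriveD.
Qed.

Lemma derives_sum (I : Type) (r : seq I) (F F' : I -> R -> R) :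
  (forall i, derives (F i) (F' i)) ->
  derives (fun x => \sum_(i <- r) F i x) (fun x => \sum_(i <- r) F' i x).
Proof. by move=> dF x; apply: is_derive_sum_seq => i; exact: dF. Qed.

Lemma derives_lin k : derives (fun y => k * y) (fun=> k).
Proof.
apply: (@derives_ext (fun y => k * y) _ (fun=> k * 1)) => //; first by move=> x; rewrite mulr1.
by apply: derivesZ => x; exact: is_derive_id.
Qed.

Lemma derives_cos k : derives (fun x => cos (k * x)) (fun x => - k * sin (k * x)).
Proof.
move=> x; have dk := derives_lin k x.
have -> : - k * sin (k * x) = - sin (k * x) * k by ring.
exact: (is_derive1_comp (f := cos) (g := fun y => k * y)).
Qed.

Lemma derives_sin k : derives (fun x => sin (k * x)) (fun x => k * cos (k * x)).
Proof.
move=> x; have dk := derives_lin k x.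
rewrite mulrC; exact: (is_derive1_comp (f := sin) (g := fun y => k * y)).
Qed.

(** The source of every cancellation below: orthogonality of the exponentials
    and all integrations by parts on the circle are instances. *)
Lemma integ_derives f g : derives f g -> continuous g -> f (- pi) = f pi ->
  integ g = 0.
Proof.
move=> df cg fpi.
rewrite integ.unlock /Rintegral (@continuous_FTC2 _ g f) //.
- by rewrite fpi /= subrr.
- by rewrite gtrN ?pi_gt0.
- exact: continuous_subspaceT.
- have cf := derives_continuous df.
  split => [x _||]; first by have [] := df x.
    by apply: cvg_at_right_filter; exact: cf.
  by apply: cvg_at_left_filter; exact: cf.
- by move=> x _; rewrite (derivesE df).
Qed.

Lemma continuous_cos_k k : continuous (fun x : R => cos (k * x)).
Proof. exact: derives_continuous (derives_cos k). Qed.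
Lemma continuous_sin_k k : continuous (fun x : R => sin (k * x)).
Proof. exact: derives_continuous (derives_sin k). Qed.

Lemma continuous_add f g : continuous f -> continuous g -> continuous (fun x => f x + g x).
Proof. by move=> cf cg x; apply: cvgD; [exact: cf|exact: cg]. Qed.
Lemma continuous_sub f g : continuous f -> continuous g -> continuous (fun x => f x - g x).
Proof. by move=> cf cg x; apply: cvgB; [exact: cf|exact: cg]. Qed.
Lemma continuous_opp f : continuous f -> continuous (fun x => - f x).
Proof. by move=> cf x; apply: cvgN; exact: cf. Qed.
Lemma continuous_mul f g : continuous f -> continuous g -> continuous (fun x => f x * g x).
Proof. by move=> cf cg x; apply: cvgM; [exact: cf|exact: cg]. Qed.
Lemma continuous_pow f n : continuous f -> continuous (fun x => f x ^+ n).
Proof.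
move=> cf; elim: n => [|n ih].
  by under eq_fun do rewrite expr0; exact: cst_continuous.
by under eq_fun do rewrite exprS; exact: continuous_mul.
Qed.
Lemma continuous_const (a : R) : continuous (fun _ : R => a).
Proof. exact: cst_continuous. Qed.
Lemma continuous_scale a f : continuous f -> continuous (fun x => a * f x).
Proof. by move=> cf; apply: continuous_mul => //; exact: continuous_const. Qed.

End Circle.

(** Continuity of an expression in [x] by structural recursion; a variable
    function is closed by a hypothesis about it. *)
Ltac cont :=
  lazymatch goal with
  | |- forall x, continuous_at x ?F => lazymatch F with
    | (fun x => cos (?k * x)) => exact: continuous_cos_k
    | (fun x => sin (?k * x)) => exact: continuous_sin_k
    | (fun x => (@?f x) ^+ ?n) => apply: (@continuous_pow _ f n); cont
    | (fun x => `| @?f x |) => apply: (@continuous_norm _ f); cont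
    | (fun x => - @?f x) => apply: (@continuous_opp _ f); cont
    | (fun x => @?f x - @?g x) => apply: (@continuous_sub _ f g); cont
    | (fun x => @?f x + @?g x) => apply: (@continuous_add _ f g); cont
    | (fun x => @?f x * @?g x) => apply: (@continuous_mul _ f g); cont
    | _ => first [
        match goal with H : forall x, continuous_at x ?G |- _ =>
          first [constr_eq F G | constr_eq F (fun x => G x)]; exact: H end |
        exact: continuous_const | assumption]
    end
  end.

Section InnerProduct.
Context {R : realType}.
Implicit Types (f g h : R -> R).


Lemma continuous_sum (I : Type) (r : seq I) (P : pred I) (F : I -> R -> R) :
  (forall i, continuous (F i)) -> continuous (fun x => \sum_(i <- r | P i) F i x).
Proof.
move=> cF; elim: r => [|j r ih].
  have -> : (fun x => \sum_(i <- [::] | P i) F i x) = fun=> 0.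
    by apply/funext => x; rewrite big_nil.
  exact: continuous_const.
have -> : (fun x => \sum_(i <- j :: r | P i) F i x) = fun x =>
    (if P j then F j x else 0) + \sum_(i <- r | P i) F i x.
  by apply/funext => x; rewrite big_cons; case: ifP => // _; rewrite add0r.
by apply: continuous_add => //; case: (P j) => //; exact: continuous_const.
Qed.

Lemma integ_sum (I : Type) (r : seq I) (P : pred I) (F : I -> R -> R) :
  (forall i, continuous (F i)) ->
  integ (fun x => \sum_(i <- r | P i) F i x) = \sum_(i <- r | P i) integ (F i).
Proof.
move=> cF; elim: r => [|j r ih].
  rewrite (@eq_integ _ _ (fun=> 0)) ?integ_cst ?mul0r ?big_nil// => x.
  by rewrite big_nil.
rewrite big_cons -ih (@eq_integ _ _ (fun x => (if P j then F j x else 0) +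
    \sum_(i <- r | P i) F i x)); last first.
  by move=> x; rewrite big_cons; case: ifP => // _; rewrite add0r.
rewrite integD; [|by case: (P j) => //; exact: continuous_const|exact: continuous_sum].
by case: ifP => // _; rewrite integ_cst mul0r add0r.
Qed.

Lemma cauchy_schwarz f g : continuous f -> continuous g ->
  integ (fun x => f x * g x) ^+ 2 <=
  integ (fun x => f x ^+ 2) * integ (fun x => g x ^+ 2).
Proof.
move=> cf cg.
set a := integ (fun x => f x ^+ 2); set b := integ (fun x => g x ^+ 2).
set c := integ _.
have a0 : 0 <= a by apply: integ_ge0 => x; exact: sqr_ge0.
have b0 : 0 <= b by apply: integ_ge0 => x; exact: sqr_ge0.
have key s t : 0 <= s ^+ 2 * a + 2 * (s * t) * c + t ^+ 2 * b.
  have -> : s ^+ 2 * a + 2 * (s * t) * c + t ^+ 2 * b =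
     integ (fun x => (s * f x + t * g x) ^+ 2).
    rewrite /a /b /c -!integZ; do ?by cont.
    by rewrite -!integD; do ?(by cont); apply: eq_integ => x; ring.
  by apply: integ_ge0 => x; exact: sqr_ge0.
have [b00|bN0] := eqVneq b 0.
  have [c0|cN0] := eqVneq c 0; first by rewrite c0 expr0n mulr_ge0.
  (* With [b = 0] the quadratic form is affine in [t]; this [t] makes it -1. *)
  have := key 1 (- (a + 1) / (2 * c)); rewrite b00 mulr0 addr0 expr1n !mul1r.
  have -> : 2 * (- (a + 1) / (2 * c)) * c = - (a + 1) by field.
  by lra.
have bpos : 0 < b by rewrite lt_neqAle eq_sym bN0.
have := key b (- c).
have -> : b ^+ 2 * a + 2 * (b * - c) * c + (- c) ^+ 2 * b = b * (a * b - c ^+ 2).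
  by ring.
by rewrite pmulr_rge0// subr_ge0.
Qed.

(** Real-valued, unlike [L2norm]; the two agree on continuous functions by
    [L2norm_nrm]. *)
Definition nrm f : R := Num.sqrt (integ (fun x => f x ^+ 2)).

Lemma nrm_ge0 f : 0 <= nrm f. Proof. exact: sqrtr_ge0. Qed.

Lemma nrm_sqr f : nrm f ^+ 2 = integ (fun x => f x ^+ 2).
Proof. by rewrite sqr_sqrtr//; apply: integ_ge0 => x; exact: sqr_ge0. Qed.

Lemma le_integ_nrm f g : continuous f -> continuous g ->
  `|integ (fun x => f x * g x)| <= nrm f * nrm g.
Proof.
move=> cf cg; rewrite -ler_sqr ?nnegrE ?mulr_ge0 ?nrm_ge0//.
by rewrite real_normK ?num_real// exprMn !nrm_sqr; exact: cauchy_schwarz.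
Qed.

Lemma ler_nrmD f g : continuous f -> continuous g ->
  nrm (fun x => f x + g x) <= nrm f + nrm g.
Proof.
move=> cf cg; rewrite -ler_sqr ?nnegrE ?addr_ge0 ?nrm_ge0// nrm_sqr.
have -> : integ (fun x => (f x + g x) ^+ 2) =
    nrm f ^+ 2 + 2 * integ (fun x => f x * g x) + nrm g ^+ 2.
  rewrite !nrm_sqr -integZ; last by cont.
  by rewrite -!integD; do ?(by cont); apply: eq_integ => x; ring.
have := le_trans (ler_norm _) (le_integ_nrm cf cg); nra.
Qed.

Lemma nrmN f : nrm (fun x => - f x) = nrm f.
Proof. by congr Num.sqrt; apply: eq_integ => x; rewrite sqrrN. Qed.

Lemma eq_nrm f g : (forall x, f x = g x) -> nrm f = nrm g.
Proof. by move=> fg; congr nrm; apply/funext. Qed.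

Lemma L2norm_nrm f : continuous f -> L2norm f = (nrm f)%:E.
Proof.
move=> cf; rewrite /L2norm /nrm integ.unlock /Rintegral.
have fin : (\int[lebesgue_measure]_(x in circle) (f x ^+ 2)%:E)%E \is a fin_num.
  apply: integrable_fin_num; first exact: measurable_circle.
  by apply: integrable_circle; cont.
by rewrite -[in LHS](fineK fin).
Qed.

End InnerProduct.

(** * Real trigonometric polynomials *)

Lemma mem_freqs (N : nat) (k : int) : (k \in freqs N) = (`|k| <= N%:Z).
Proof.
apply/mapP/idP => [[j] |].
  rewrite mem_iota add0n ltnS => /andP[_ jN] ->.
  by rewrite ler_norml; apply/andP; split; lia.
rewrite ler_norml => /andP[k1 k2].
exists (absz (k + N%:Z)); last lia.
by rewrite mem_iota; apply/andP; split => //; lia.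
Qed.

Lemma freqs_uniq (N : nat) : uniq (freqs N).
Proof. by rewrite map_inj_uniq ?iota_uniq // => i j /addIr []. Qed.

Lemma mem_freqsN (N : nat) (k : int) : (- k \in freqs N) = (k \in freqs N).
Proof. by rewrite !mem_freqs normrN. Qed.

Lemma freqs_perm_opp (N : nat) : perm_eq (freqs N) [seq - k | k <- freqs N].
Proof.
apply: uniq_perm; first exact: freqs_uniq.
  by rewrite map_inj_uniq ?freqs_uniq//; exact: oppr_inj.
by move=> k; rewrite -[k in RHS]opprK mem_map ?mem_freqsN//; exact: oppr_inj.
Qed.

Section Freqs.
Variable (V : nmodType).

Lemma sum_freqsN (N : nat) (F : int -> V) :
  \sum_(k <- freqs N) F (- k) = \sum_(k <- freqs N) F k.
Proof. by rewrite [RHS](perm_big _ (freqs_perm_opp N)) [RHS]big_map. Qed.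

Lemma sum_freqs1 (N : nat) (k : int) (F : int -> V) :
  \sum_(j <- freqs N) (if j == k then F j else 0) =
  if k \in freqs N then F k else 0.
Proof.
have [kN|kN] := boolP (k \in freqs N).
  rewrite (bigD1_seq k kN (freqs_uniq N)) /= eqxx big1 ?addr0// => j.
  by case: eqP.
rewrite big_seq big1// => j jN; case: eqP => // jk.
by move: kN; rewrite -jk jN.
Qed.
End Freqs.

Section Trig.
Context {R : realType}.
Implicit Types (f g v : R -> R) (k j : int) (N : nat).

Local Notation fc k := (fun x : R => cos (k%:~R * x)).
Local Notation fs k := (fun x : R => sin (k%:~R * x)).

Lemma in_S_ext N v w : (forall x, v x = w x) -> in_S N v -> in_S N w.
Proof. by move=> /funext ->. Qed.

Lemma in_SD N v w : in_S N v -> in_S N w -> in_S N (fun x => v x + w x).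
Proof.
move=> [c hc] [d hd]; exists (fun k => c k + d k) => x.
rewrite rmorphD /= hc hd -big_split /=; apply: eq_bigr => k _.
by rewrite mulrDl.
Qed.

Lemma in_SZ N a v : in_S N v -> in_S N (fun x => a * v x).
Proof.
move=> [c hc]; exists (fun k => a%:C%C * c k) => x.
by rewrite rmorphM /= hc mulr_sumr; apply: eq_bigr => k _; rewrite mulrA.
Qed.

Lemma in_S0 N : in_S N (fun _ : R => 0).
Proof.
exists (fun=> 0) => x; rewrite big1// => k _; exact: mul0r.
Qed.

Lemma in_SN N v : in_S N v -> in_S N (fun x => - v x).
Proof.
by move=> /(in_SZ (-1)); apply: in_S_ext => x; rewrite mulN1r.
Qed.

Lemma in_SB N v w : in_S N v -> in_S N w -> in_S N (fun x => v x - w x).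
Proof. by move=> hv hw; apply: in_SD => //; exact: in_SN. Qed.

(** A real part needs both frequencies: [Re (z e^(ikx))] is the half sum of
    [z e^(ikx)] and its conjugate, of frequency [-k]. *)
Lemma in_S_combo N k (z : R[i]) : k \in freqs N ->
  in_S N (fun x => complex.Re (z * cis (k%:~R * x))).
Proof.
move=> kN; exists (fun j => (if j == k then z / 2 else 0) +
                   (if j == - k then (complex.Re z / 2 -i* (complex.Im z / 2))%C else 0)) => x.
under eq_bigr do rewrite mulrDl.
rewrite big_split /=.
have E (w : R[i]) l : \sum_(i <- freqs N) (if i == l then w else 0) * cis (i%:~R * x) =
   if l \in freqs N then w * cis (l%:~R * x) else 0.
  rewrite -(sum_freqs1 N l (fun i => w * cis (i%:~R * x))).
  by apply: eq_bigr => i _; case: ifP => // _; rewrite mul0r.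
rewrite !E mem_freqsN kN mulrNz mulNr /cis cosN sinN.
have -> : z / 2 = (complex.Re z / 2 +i* (complex.Im z / 2))%C.
  have -> : (2 : R[i]) = (2%:R)%:C%C by rewrite -(rmorph_nat (real_complex R)).
  rewrite -fmorphV /=; case: z => a b /=.
  by apply/eqP; rewrite eq_complex /= !mulr0 !subr0 add0r !eqxx.
case: z => a b /=; apply/eqP; rewrite eq_complex /=; by apply/andP; split; apply/eqP; field.
Qed.

Lemma in_S_cos N k : k \in freqs N -> in_S N (fc k).
Proof.
by move=> /(in_S_combo 1); apply: in_S_ext => x; rewrite mul1r.
Qed.

Lemma in_S_sin N k : k \in freqs N -> in_S N (fs k).
Proof.
move=> /(in_S_combo (- 'i)%C); apply: in_S_ext => x /=.
by rewrite mulN1r oppr0 mul0r opprK add0r.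
Qed.

Lemma in_SE N v : in_S N v -> exists z : int -> R[i],
  v = fun x => \sum_(k <- freqs N) complex.Re (z k * cis (k%:~R * x)).
Proof.
move=> [c hc]; exists c; apply/funext => x.
by have /(congr1 (@complex.Re R)) := hc x; rewrite /= raddf_sum.
Qed.

(** Linear statements about [S_N] reduce to cosines and sines: the real part of
    [z e^(ikx)] is [Re z cos kx - Im z sin kx]. *)
Lemma in_S_ind N (P : (R -> R) -> Prop) :
  P (fun=> 0) -> (forall f g, P f -> P g -> P (fun x => f x + g x)) ->
  (forall a f, P f -> P (fun x => a * f x)) ->
  (forall k, k \in freqs N -> P (fc k)) ->
  (forall k, k \in freqs N -> P (fs k)) ->
  forall v, in_S N v -> P v.
Proof.
move=> P0 PD PZ Pc Ps v /in_SE[z ->].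
have : {subset freqs N <= freqs N} by [].
elim: {1 3}(freqs N) => [|k r ih] sub.
  by move: P0; congr P; apply/funext => x; rewrite big_nil.
have kN : k \in freqs N by apply: sub; rewrite mem_head.
have {}ih : P (fun x => \sum_(k <- r) complex.Re (z k * cis (k%:~R * x))).
  by apply: ih => j jr; apply: sub; rewrite in_cons jr orbT.
have := PD _ _ (PD _ _ (PZ (complex.Re (z k)) _ (Pc k kN))
                       (PZ (- complex.Im (z k)) _ (Ps k kN))) ih.
congr P; apply/funext => x; rewrite big_cons; congr (_ + _).
by case: (z k) => a b /=; rewrite mulNr.
Qed.

Lemma in_S_continuous N v : in_S N v -> continuous v.
Proof.
move: v; apply: (@in_S_ind N (fun v => continuous v)).
- exact: continuous_const. - exact: continuous_add. - by move=> a f; exact: continuous_scale.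
- by move=> k _; exact: continuous_cos_k.
- by move=> k _; exact: continuous_sin_k.
Qed.

Lemma in_S_derives N v : in_S N v -> exists2 w, in_S N w & derives v w.
Proof.
move: v; apply: (@in_S_ind N (fun v => exists2 w, in_S N w & derives v w))
  => [|f g [f' hf df] [g' hg dg]|a f [f' hf df]|k kN|k kN].
- by exists (fun=> 0); [exact: in_S0|exact: derives_cst].
- by exists (fun x => f' x + g' x); [exact: in_SD|exact: derivesD].
- by exists (fun x => a * f' x); [exact: in_SZ|exact: derivesZ].
- eexists; last exact: derives_cos.
  by apply: in_SZ; exact: in_S_sin.
- eexists; last exact: derives_sin.
  by apply: in_SZ; exact: in_S_cos.
Qed.

Lemma derives_in_S N v : in_S N v -> derives v (derive1 v).
Proof. by move=> /in_S_derives[w _ dw]; rewrite (derivesE dw). Qed.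

Lemma in_S_derive1 N v : in_S N v -> in_S N (derive1 v).
Proof. by move=> /in_S_derives[w hw dw]; rewrite (derivesE dw). Qed.

Lemma in_S_derive1n N n v : in_S N v -> in_S N (derive1n n v).
Proof. by move=> hv; elim: n => //= n ih; exact: in_S_derive1. Qed.

Lemma in_SW N M v : (N <= M)%N -> in_S N v -> in_S M v.
Proof.
move=> NM; move: v.
apply: (@in_S_ind N (fun v => in_S M v)) => [|f g|a f|k|k].
- exact: in_S0. - exact: in_SD. - exact: in_SZ.
- by rewrite mem_freqs => kN; apply: in_S_cos; rewrite mem_freqs; lia.
- by rewrite mem_freqs => kN; apply: in_S_sin; rewrite mem_freqs; lia.
Qed.

Lemma cosM (a b : R) : cos a * cos b = 2^-1 * (cos (a - b) + cos (a + b)).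
Proof. by rewrite cosB cosD; field. Qed.
Lemma sinM (a b : R) : sin a * sin b = 2^-1 * (cos (a - b) - cos (a + b)).
Proof. by rewrite cosB cosD; field. Qed.
Lemma sincosM (a b : R) : sin a * cos b = 2^-1 * (sin (a + b) + sin (a - b)).
Proof. by rewrite sinB sinD; field. Qed.

(** The square of an element of [S_N] leaves [S_N] but stays in [S_2N]; integrals
    and quadratures of products only need the product to be a trigonometric
    polynomial. *)
Lemma in_SM N M v w : in_S N v -> in_S M w -> in_S (N + M) (fun x => v x * w x).
Proof.
move=> hv hw; move: v hv.
have fD (j k : int) (x : R) : j%:~R * x + k%:~R * x = (j + k)%:~R * x.
  by rewrite intrD mulrDl.
have fB (j k : int) (x : R) : j%:~R * x - k%:~R * x = (j - k)%:~R * x.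
  by rewrite intrB mulrBl.
have bnd (j k : int) : j \in freqs N -> k \in freqs M ->
   (j + k \in freqs (N + M)) /\ (j - k \in freqs (N + M)).
  by rewrite !mem_freqs => *; split; lia.
apply: (@in_S_ind N (fun v => in_S (N + M) (fun x => v x * w x)))
  => [|f g hf hg|a f hf|j jN|j jN].
- by apply: in_S_ext (in_S0 _) => x; rewrite mul0r.
- by apply: in_S_ext (in_SD hf hg) => x; rewrite mulrDl.
- by apply: in_S_ext (in_SZ a hf) => x; rewrite mulrA.
- move: w hw; apply: (@in_S_ind M (fun w => in_S (N + M) (fun x => cos (j%:~R * x) * w x)))
  => [|f g hf hg|a f hf|k kN|k kN].
  + by apply: in_S_ext (in_S0 _) => x; rewrite mulr0.
  + by apply: in_S_ext (in_SD hf hg) => x; rewrite mulrDr.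
  + by apply: in_S_ext (in_SZ a hf) => x; rewrite mulrCA.
  + have [h1 h2] := bnd _ _ jN kN.
    apply: in_S_ext (in_SZ 2^-1 (in_SD (in_S_cos h2) (in_S_cos h1))) => x.
    by rewrite cosM fD fB.
  + have [h1 h2] := bnd _ _ jN kN.
    apply: in_S_ext (in_SZ 2^-1 (in_SB (in_S_sin h1) (in_S_sin h2))) => x.
    by rewrite [RHS]mulrC sincosM fD fB -[k - j]opprB mulrNz mulNr sinN [k + j]addrC.
- move: w hw; apply: (@in_S_ind M (fun w => in_S (N + M) (fun x => sin (j%:~R * x) * w x)))
  => [|f g hf hg|a f hf|k kN|k kN].
  + by apply: in_S_ext (in_S0 _) => x; rewrite mulr0.
  + by apply: in_S_ext (in_SD hf hg) => x; rewrite mulrDr.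
  + by apply: in_S_ext (in_SZ a hf) => x; rewrite mulrCA.
  + have [h1 h2] := bnd _ _ jN kN.
    apply: in_S_ext (in_SZ 2^-1 (in_SD (in_S_sin h1) (in_S_sin h2))) => x.
    by rewrite sincosM fD fB.
  + have [h1 h2] := bnd _ _ jN kN.
    apply: in_S_ext (in_SZ 2^-1 (in_SB (in_S_cos h2) (in_S_cos h1))) => x.
    by rewrite sinM fD fB.
Qed.

End Trig.

(** * Fourier coefficients, projection and Wiener norms *)


Section Fourier.
Context {R : realType}.
Implicit Types (f g v : R -> R) (k j : int) (N : nat).

Local Notation fc k := (fun x : R => cos (k%:~R * x)).
Local Notation fs k := (fun x : R => sin (k%:~R * x)).

Definition fcos f k : R := (2 * pi)^-1 * integ (fun x => cos (k%:~R * x) * f x).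
Definition fsin f k : R := (2 * pi)^-1 * integ (fun x => sin (k%:~R * x) * f x).

Lemma fourier_coefE f k : fourier_coef f k = (fcos f k -i* fsin f k)%C.
Proof. by rewrite /fourier_coef /fcos /fsin integ.unlock. Qed.

Lemma pi_neq0 : pi != 0 :> R.
Proof. by rewrite gt_eqF// pi_gt0. Qed.

Lemma pi2_neq0 : 2 * pi != 0 :> R.
Proof. by rewrite mulf_neq0// ?pnatr_eq0// gt_eqF// pi_gt0. Qed.

Lemma sin_intpi k : sin (k%:~R * pi) = 0 :> R.
Proof.
have nat_case n : sin (n%:R * pi) = 0 :> R.
  elim: n => [|n ih]; first by rewrite mul0r sin0.
  by rewrite -addn1 natrD mulrDl mul1r sinDpi ih oppr0.
case: k => n; first exact: nat_case.
by rewrite NegzE mulrNz mulNr sinN nat_case oppr0.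
Qed.

Lemma integ_cos k : integ (fc k) = (2 * pi) * (k == 0)%:R.
Proof.
have [->|k0] := eqVneq k 0.
  rewrite (@eq_integ _ _ (fun=> 1)) ?integ_cst ?mul1r ?mulr1// => x.
  by rewrite mul0r cos0.
have kr : k%:~R != 0 :> R by rewrite intr_eq0.
rewrite mulr0; apply: (@integ_derives _ (fun x => k%:~R^-1 * sin (k%:~R * x))).
- apply: derives_ext (derivesZ k%:~R^-1 (derives_sin k%:~R)) => // x.
  by rewrite mulKf.
- exact: continuous_cos_k.
- by rewrite mulrN sinN sin_intpi oppr0.
Qed.

Lemma integ_sin k : integ (fs k) = 0.
Proof.
have [->|k0] := eqVneq k 0.
  by rewrite (@eq_integ _ _ (fun=> 0)) ?integ_cst ?mul0r// => x; rewrite mul0r sin0.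
have kr : k%:~R != 0 :> R by rewrite intr_eq0.
apply: (@integ_derives _ (fun x => - k%:~R^-1 * cos (k%:~R * x))).
- apply: derives_ext (derivesZ (- k%:~R^-1) (derives_cos k%:~R)) => // x.
  by rewrite mulrA mulNr mulrN opprK mulVf// mul1r.
- exact: continuous_sin_k.
- by rewrite mulrN cosN.
Qed.

Lemma freqD (j k : int) (x : R) : j%:~R * x + k%:~R * x = (j + k)%:~R * x.
Proof. by rewrite intrD mulrDl. Qed.
Lemma freqB (j k : int) (x : R) : j%:~R * x - k%:~R * x = (j - k)%:~R * x.
Proof. by rewrite intrB mulrBl. Qed.

Lemma integ_coscos j k : integ (fun x : R => cos (j%:~R * x) * cos (k%:~R * x)) =
  pi * ((j == k)%:R + (j == - k)%:R).
Proof.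
rewrite (@eq_integ _ _ (fun x => 2^-1 * (cos ((j - k)%:~R * x) + cos ((j + k)%:~R * x))));
  last by move=> x; rewrite cosM freqD freqB.
rewrite integZ ?integD; do ?by cont.
by rewrite !integ_cos subr_eq0 addr_eq0; field.
Qed.

Lemma integ_sinsin j k : integ (fun x : R => sin (j%:~R * x) * sin (k%:~R * x)) =
  pi * ((j == k)%:R - (j == - k)%:R).
Proof.
rewrite (@eq_integ _ _ (fun x => 2^-1 * (cos ((j - k)%:~R * x) - cos ((j + k)%:~R * x))));
  last by move=> x; rewrite sinM freqD freqB.
rewrite integZ ?integB; do ?by cont.
by rewrite !integ_cos subr_eq0 addr_eq0; field.
Qed.

Lemma integ_sincos j k : integ (fun x : R => sin (j%:~R * x) * cos (k%:~R * x)) = 0.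
Proof.
rewrite (@eq_integ _ _ (fun x => 2^-1 * (sin ((j + k)%:~R * x) + sin ((j - k)%:~R * x))));
  last by move=> x; rewrite sincosM freqD freqB.
rewrite integZ ?integD; do ?by cont.
by rewrite !integ_sin addr0 mulr0.
Qed.

Lemma fcosD f g k : continuous f -> continuous g ->
  fcos (fun x => f x + g x) k = fcos f k + fcos g k.
Proof.
move=> cf cg; rewrite /fcos -mulrDr -integD; do ?by cont.
by congr (_ * _); apply: eq_integ => x; rewrite mulrDr.
Qed.

Lemma fsinD f g k : continuous f -> continuous g ->
  fsin (fun x => f x + g x) k = fsin f k + fsin g k.
Proof.
move=> cf cg; rewrite /fsin -mulrDr -integD; do ?by cont.
by congr (_ * _); apply: eq_integ => x; rewrite mulrDr.
Qed.

Lemma fcosZ a f k : continuous f -> fcos (fun x => a * f x) k = a * fcos f k.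
Proof.
move=> cf; rewrite /fcos mulrCA -(integZ a); do ?by cont.
by congr (_ * _); apply: eq_integ => x; rewrite mulrCA.
Qed.

Lemma fsinZ a f k : continuous f -> fsin (fun x => a * f x) k = a * fsin f k.
Proof.
move=> cf; rewrite /fsin mulrCA -(integZ a); do ?by cont.
by congr (_ * _); apply: eq_integ => x; rewrite mulrCA.
Qed.

Lemma fourier_coefD f g k : continuous f -> continuous g ->
  fourier_coef (fun x => f x + g x) k = fourier_coef f k + fourier_coef g k.
Proof.
move=> cf cg; rewrite !fourier_coefE fcosD// fsinD//.
by apply/eqP; rewrite eq_complex /= opprD !eqxx.
Qed.

Lemma fourier_coefZ a f k : continuous f ->
  fourier_coef (fun x => a * f x) k = a%:C%C * fourier_coef f k.
Proof.
move=> cf; rewrite !fourier_coefE fcosZ// fsinZ//.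
by apply/eqP; rewrite eq_complex /= !mul0r subr0 addr0 mulrN !eqxx.
Qed.

Lemma projE N v x : proj N v x =
  \sum_(k <- freqs N) (fcos v k * cos (k%:~R * x) + fsin v k * sin (k%:~R * x)).
Proof.
rewrite /Defs.proj /fourier_sum raddf_sum; apply: eq_bigr => k _.
by rewrite fourier_coefE /= mulNr opprK.
Qed.

Lemma proj_in_S N v : in_S N (proj N v).
Proof. by exists (fourier_coef v) => x; rewrite -fourier_sum_real. Qed.

Lemma projD N f g x : continuous f -> continuous g ->
  proj N (fun y => f y + g y) x = proj N f x + proj N g x.
Proof.
move=> cf cg; rewrite !projE -big_split /=; apply: eq_bigr => k _.
by rewrite fcosD// fsinD//; ring.
Qed.

Lemma projZ N a f x : continuous f -> proj N (fun y => a * f y) x = a * proj N f x.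
Proof.
move=> cf; rewrite !projE mulr_sumr; apply: eq_bigr => k _.
by rewrite fcosZ// fsinZ//; ring.
Qed.

Lemma projB N f g x : continuous f -> continuous g ->
  proj N (fun y => f y - g y) x = proj N f x - proj N g x.
Proof.
move=> cf cg; rewrite -[- proj N g x]mulN1r -projZ// -projD//; last by cont.
by congr proj; apply/funext => y; rewrite mulN1r.
Qed.

Lemma proj_sum N (I : Type) (r : seq I) (F : I -> R -> R) x :
  (forall i, continuous (F i)) ->
  proj N (fun y => \sum_(i <- r) F i y) x = \sum_(i <- r) proj N (F i) x.
Proof.
move=> cF; elim: r => [|i r ih].
  rewrite big_nil (_ : (fun y => _) = fun y => 0 * 0 : R).
    by rewrite projZ ?mul0r//; exact: continuous_const.
  by apply/funext => y; rewrite big_nil mul0r.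
rewrite big_cons -ih -projD//; last exact: continuous_sum.
by congr proj; apply/funext => y; rewrite big_cons.
Qed.

Lemma fcos_cos k j : fcos (fc k) j = 2^-1 * ((j == k)%:R + (j == - k)%:R).
Proof. by rewrite /fcos integ_coscos; move: pi pi_neq0 => p p0; field. Qed.
Lemma fsin_sin k j : fsin (fs k) j = 2^-1 * ((j == k)%:R - (j == - k)%:R).
Proof. by rewrite /fsin integ_sinsin; move: pi pi_neq0 => p p0; field. Qed.
Lemma fsin_cos k j : fsin (fc k) j = 0.
Proof. by rewrite /fsin integ_sincos mulr0. Qed.
Lemma fcos_sin k j : fcos (fs k) j = 0.
Proof.
rewrite /fcos (@eq_integ _ _ (fun x => sin (k%:~R * x) * cos (j%:~R * x)));
  first by rewrite integ_sincos mulr0.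
by move=> x; rewrite mulrC.
Qed.

Lemma proj_cos N k x : proj N (fc k) x = if k \in freqs N then cos (k%:~R * x) else 0.
Proof.
rewrite projE (eq_bigr (fun j => 2^-1 *
   ((if j == k then cos (j%:~R * x) else 0) + (if j == - k then cos (j%:~R * x) else 0)))).
  rewrite -mulr_sumr big_split /= !sum_freqs1 mem_freqsN; case: ifP => _; last by rewrite addr0 mulr0.
  by rewrite mulrNz mulNr cosN; field.
move=> j _; rewrite fcos_cos fsin_cos mul0r addr0.
by case: eqP => _; case: eqP => _; rewrite ?(addr0, add0r, mulr1, mulr0, mul0r)// -mulrA mulrDl !mul1r.
Qed.

Lemma proj_sin N k x : proj N (fs k) x = if k \in freqs N then sin (k%:~R * x) else 0.
Proof.
rewrite projE (eq_bigr (fun j => 2^-1 *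
   ((if j == k then sin (j%:~R * x) else 0) - (if j == - k then sin (j%:~R * x) else 0)))).
  rewrite -mulr_sumr big_split /= sumrN !sum_freqs1 mem_freqsN; case: ifP => _; last by rewrite subr0 mulr0.
  by rewrite mulrNz mulNr sinN; field.
move=> j _; rewrite fsin_sin fcos_sin mul0r add0r.
by case: eqP => _; case: eqP => _; rewrite ?(subr0, sub0r, mulr1, mulr0, mul0r, mulrN, mulNr)// -mulrA mulrBl !mul1r.
Qed.

Lemma proj_id N v : in_S N v -> proj N v = v.
Proof.
move=> hv; suff [] : continuous v /\ forall x, proj N v x = v x by move=> _ /funext.
move: v hv; apply: (@in_S_ind _ N (fun v => continuous v /\ forall x, proj N v x = v x))
  => [|f g [cf hf] [cg hg]|a f [cf hf]|k kN|k kN].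
- split; first exact: continuous_const.
  move=> x; rewrite (_ : (fun=> 0) = fun y => 0 * 0 : R); last by apply/funext => y; rewrite mul0r.
  by rewrite projZ ?mul0r//; exact: continuous_const.
- by split => [|x]; [cont | rewrite projD// hf hg].
- by split => [|x]; [cont | rewrite projZ// hf].
- by split => [|x]; [cont | rewrite proj_cos kN].
- by split => [|x]; [cont | rewrite proj_sin kN].
Qed.

Lemma integ_proj N f g : continuous f -> continuous g ->
  integ (fun x => proj N f x * g x) =
  2 * pi * \sum_(k <- freqs N) (fcos f k * fcos g k + fsin f k * fsin g k).
Proof.
move=> cf cg.
rewrite (@eq_integ _ _ (fun x => \sum_(k <- freqs N)
   (fcos f k * (cos (k%:~R * x) * g x) + fsin f k * (sin (k%:~R * x) * g x)))).
  rewrite integ_sum; last by move=> k; cont.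
  rewrite mulr_sumr; apply: eq_bigr => k _.
  rewrite integD ?integZ; do ?by cont.
  by rewrite [fcos g k]/fcos [fsin g k]/fsin mulrDr (mulrCA _ (fcos f k)) (mulrCA _ (fsin f k)) !(mulVKf pi2_neq0).
move=> x; rewrite projE mulr_suml; apply: eq_bigr => k _; ring.
Qed.

Lemma integ_projC N f g : continuous f -> continuous g ->
  integ (fun x => proj N f x * g x) = integ (fun x => f x * proj N g x).
Proof.
move=> cf cg; rewrite integ_proj// (@eq_integ _ _ (fun x => proj N g x * f x)).
  rewrite integ_proj//; congr (_ * _); apply: eq_bigr => k _; ring.
by move=> x; rewrite mulrC.
Qed.

(** Removes the projection from the nonlinear term whenever the equation is
    tested with an element of [S_N]. *)
Lemma proj_adj N f v : continuous f -> in_S N v ->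
  integ (fun x => proj N f x * v x) = integ (fun x => f x * v x).
Proof.
by move=> cf hv; rewrite integ_projC ?proj_id//; exact: in_S_continuous hv.
Qed.

(** The modulus of [fourier_coef f k]. *)
Definition fourier_mod f k : R := Num.sqrt (fcos f k ^+ 2 + fsin f k ^+ 2).

Lemma fourier_mod_sqr f k : fourier_mod f k ^+ 2 = fcos f k ^+ 2 + fsin f k ^+ 2.
Proof. by rewrite sqr_sqrtr// addr_ge0// sqr_ge0. Qed.

Lemma fourier_mod_ge0 f k : 0 <= fourier_mod f k. Proof. exact: sqrtr_ge0. Qed.

Lemma fcos_le_fourier_mod f k : `|fcos f k| <= fourier_mod f k.
Proof.
by rewrite -ler_sqr ?nnegrE ?fourier_mod_ge0// fourier_mod_sqr real_normK ?num_real// lerDl sqr_ge0.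
Qed.

Lemma fsin_le_fourier_mod f k : `|fsin f k| <= fourier_mod f k.
Proof.
by rewrite -ler_sqr ?nnegrE ?fourier_mod_ge0// fourier_mod_sqr real_normK ?num_real// lerDr sqr_ge0.
Qed.

Lemma fourier_mod_normc f k : fourier_mod f k = ComplexField.Normc.normc (fourier_coef f k).
Proof. by rewrite /fourier_mod fourier_coefE /ComplexField.Normc.normc /= sqrrN. Qed.

Lemma sqmod_fourier_mod f k : sqmod (fourier_coef f k) = fourier_mod f k ^+ 2.
Proof. by rewrite fourier_mod_sqr fourier_coefE /sqmod /= sqrrN. Qed.

Lemma parseval N v : in_S N v ->
  nrm v ^+ 2 = 2 * pi * \sum_(k <- freqs N) fourier_mod v k ^+ 2.
Proof.
move=> hv; have cv := in_S_continuous hv; rewrite nrm_sqr.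
rewrite (eq_bigr (fun k => fcos v k * fcos v k + fsin v k * fsin v k)).
  by rewrite -integ_proj// proj_id//; apply: eq_integ => x; rewrite expr2.
by move=> k _; rewrite fourier_mod_sqr !expr2.
Qed.

(** The left side is the square of [nrm (proj N f)], and also the inner product
    of [proj N f] with [f], which Cauchy-Schwarz bounds. *)
Lemma bessel N f : continuous f ->
  2 * pi * \sum_(k <- freqs N) fourier_mod f k ^+ 2 <= nrm f ^+ 2.
Proof.
move=> cf; have pS := proj_in_S N f; have cp := in_S_continuous pS.
have -> : 2 * pi * \sum_(k <- freqs N) fourier_mod f k ^+ 2 = integ (fun x => proj N f x * f x).
  rewrite integ_proj//; congr (_ * _); apply: eq_bigr => k _.
  by rewrite fourier_mod_sqr !expr2.
have h : integ (fun x => proj N f x * f x) = nrm (proj N f) ^+ 2.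
  rewrite nrm_sqr (@eq_integ _ _ (fun x => f x * proj N f x)); last by move=> x; rewrite mulrC.
  by rewrite -(proj_adj cf pS); apply: eq_integ => x; rewrite expr2.
rewrite h ler_sqr ?nnegrE ?nrm_ge0//.
have := le_trans (ler_norm _) (le_integ_nrm cp cf); rewrite h expr2.
have := nrm_ge0 (proj N f); have := nrm_ge0 f.
set a := nrm f; set b := nrm _ => a0 b0 h1.
by have [->//|bp] := eqVneq b 0; rewrite -(@ler_pM2l _ b)// lt_neqAle eq_sym bp.
Qed.

Lemma fourier_modD f g k : continuous f -> continuous g ->
  fourier_mod (fun x => f x + g x) k <= fourier_mod f k + fourier_mod g k.
Proof.
by move=> cf cg; rewrite !fourier_mod_normc fourier_coefD//; exact: le_normcD.
Qed.

Lemma fourier_modZ a f k : continuous f -> fourier_mod (fun x => a * f x) k = `|a| * fourier_mod f k.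
Proof.
move=> cf; rewrite !fourier_mod_normc fourier_coefZ// ComplexField.Normc.normcM.
by congr (_ * _); rewrite /ComplexField.Normc.normc /= expr0n /= addr0 sqrtr_sqr.
Qed.

Lemma fcos_derive f g k : derives f g -> continuous g -> f (- pi) = f pi ->
  fcos g k = k%:~R * fsin f k.
Proof.
move=> df cg fpi; have cf := derives_continuous df.
have := @integ_derives _ _ _ (derivesM (derives_cos k%:~R) df).
rewrite !mulrN cosN fpi => /(_ _ erefl) h.
have : integ (fun x => (- k%:~R) * (sin (k%:~R * x) * f x) + cos (k%:~R * x) * g x) = 0.
  rewrite -h; last by cont.
  by apply: eq_integ => x; ring.
rewrite integD ?integZ; do ?by cont.
rewrite /fcos /fsin; set a := integ _; set b := integ _ => hab.
have -> : b = k%:~R * a by lra.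
by rewrite mulrCA.
Qed.

Lemma fsin_derive f g k : derives f g -> continuous g -> f (- pi) = f pi ->
  fsin g k = - k%:~R * fcos f k.
Proof.
move=> df cg fpi; have cf := derives_continuous df.
have := @integ_derives _ _ _ (derivesM (derives_sin k%:~R) df).
rewrite !mulrN sinN fpi sin_intpi oppr0 => /(_ _ erefl) h.
have : integ (fun x => k%:~R * (cos (k%:~R * x) * f x) + sin (k%:~R * x) * g x) = 0.
  rewrite -h; last by cont.
  by apply: eq_integ => x; ring.
rewrite integD ?integZ; do ?by cont.
rewrite /fcos /fsin; set a := integ _; set b := integ _ => hab.
have -> : b = - k%:~R * a by lra.
by rewrite mulrCA.
Qed.

Lemma in_S_endpoints N v : in_S N v -> v (- pi) = v pi.
Proof.
move: v; apply: (@in_S_ind _ N (fun v => v (- pi) = v pi))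
  => [|f g hf hg|a f hf|k kN|k kN] //=.
- by rewrite hf hg. - by rewrite hf.
- by rewrite mulrN cosN.
- by rewrite mulrN sinN sin_intpi oppr0.
Qed.

Lemma fourier_mod_derive f g k : derives f g -> continuous g -> f (- pi) = f pi ->
  fourier_mod g k = `|k%:~R| * fourier_mod f k.
Proof.
move=> df cg fpi; rewrite /fourier_mod (fcos_derive k df cg fpi) (fsin_derive k df cg fpi).
rewrite -sqrtr_sqr -sqrtrM ?sqr_ge0//; congr Num.sqrt; ring.
Qed.

Lemma fourier_mod_derive1 N v k : in_S N v -> fourier_mod (derive1 v) k = `|k%:~R| * fourier_mod v k.
Proof.
move=> hv; apply: fourier_mod_derive; first exact: derives_in_S hv.
  exact: in_S_continuous (in_S_derive1 hv).
exact: in_S_endpoints hv.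
Qed.

Lemma freqs_normr k N : k \in freqs N -> `|k%:~R| <= N%:R :> R.
Proof.
rewrite mem_freqs => h; rewrite -intr_norm -[N%:R]/((N%:Z)%:~R) ler_int//.
Qed.

Lemma bernstein N v : in_S N v -> nrm (derive1 v) <= N%:R * nrm v.
Proof.
move=> hv; rewrite -ler_sqr ?nnegrE ?mulr_ge0 ?nrm_ge0 ?ler0n// exprMn.
rewrite (parseval (in_S_derive1 hv)) (parseval hv) mulrCA ler_pM2l ?mulr_gt0 ?pi_gt0//.
rewrite mulr_sumr big_seq [leRHS]big_seq; apply: ler_sum => k kN.
rewrite (fourier_mod_derive1 k hv) exprMn ler_wpM2r ?sqr_ge0//.
by rewrite ler_sqr ?nnegrE ?ler0n//; exact: freqs_normr.
Qed.

(** The truncated Wiener algebra norm with weight [w]: an absolutely convergent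
    Fourier series controls the supremum, and the norm of a product is at most
    the product of the norms when [w] is submultiplicative. *)
Definition wiener (w : int -> R) N f := \sum_(k <- freqs N) w k * fourier_mod f k.

Lemma fourier_term_le (p q c s : R) : c ^+ 2 + s ^+ 2 = 1 ->
  `|p * c + q * s| <= Num.sqrt (p ^+ 2 + q ^+ 2).
Proof.
move=> cs; rewrite -ler_sqr ?nnegrE ?sqrtr_ge0// real_normK ?num_real//.
rewrite sqr_sqrtr ?addr_ge0 ?sqr_ge0//.
have -> : p ^+ 2 + q ^+ 2 = (p * c + q * s) ^+ 2 + (p * s - q * c) ^+ 2.
  by rewrite -[LHS]mulr1 -cs; ring.
by rewrite lerDl sqr_ge0.
Qed.

Lemma sup_wiener N v x : in_S N v -> `|v x| <= wiener (fun=> 1) N v.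
Proof.
move=> hv; rewrite -{1}(proj_id hv) projE.
apply: le_trans (ler_norm_sum _ _ _) _; apply: ler_sum => k _.
by rewrite mul1r; apply: fourier_term_le; exact: cos2Dsin2.
Qed.

Lemma sup_derive_wiener N v x : in_S N v ->
  `|derive1 v x| <= wiener (fun k => `|k%:~R|) N v.
Proof.
move=> hv; apply: le_trans (sup_wiener x (in_S_derive1 hv)) _.
by apply: ler_sum => k _; rewrite (fourier_mod_derive1 k hv) mul1r.
Qed.

Lemma le_wiener (w w' : int -> R) N f : (forall k, k \in freqs N -> w k <= w' k) ->
  wiener w N f <= wiener w' N f.
Proof.
move=> ww; rewrite /wiener big_seq [leRHS]big_seq; apply: ler_sum => k kN.
by rewrite ler_wpM2r ?fourier_mod_ge0// ww.
Qed.

Lemma wienerZl a (w : int -> R) N f :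
  wiener (fun k => a * w k) N f = a * wiener w N f.
Proof. by rewrite /wiener mulr_sumr; apply: eq_bigr => k _; rewrite mulrA. Qed.

Lemma wienerD (w : int -> R) N f g : (forall k, 0 <= w k) ->
  continuous f -> continuous g ->
  wiener w N (fun x => f x + g x) <= wiener w N f + wiener w N g.
Proof.
move=> w0 cf cg; rewrite /wiener -big_split /=; apply: ler_sum => k _.
by rewrite -mulrDr ler_wpM2l// fourier_modD.
Qed.

Lemma wienerZ (w : int -> R) N a f : continuous f ->
  wiener w N (fun x => a * f x) = `|a| * wiener w N f.
Proof.
move=> cf; rewrite /wiener mulr_sumr; apply: eq_bigr => k _.
by rewrite fourier_modZ// mulrCA.
Qed.

Lemma sqr_sum_le (I : Type) (r : seq I) (F : I -> R) :
  (\sum_(i <- r) F i) ^+ 2 <= (size r)%:R * \sum_(i <- r) F i ^+ 2.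
Proof.
elim: r => [|i r ih]; first by rewrite !big_nil expr0n mul0r.
rewrite !big_cons /= -natr1.
set S := \sum_(i <- r) F i in ih *; set Q := \sum_(i <- r) F i ^+ 2 in ih *.
have h : 2 * F i * S <= (size r)%:R * F i ^+ 2 + Q.
  rewrite /S /Q mulr_sumr -[(size r)%:R * _]/(_ : R).
  have -> : (size r)%:R * F i ^+ 2 = \sum_(j <- r) F i ^+ 2.
    by rewrite big_const_seq count_predT iter_addr_0 mulr_natl.
  rewrite -big_split /=; apply: ler_sum => j _.
  by have := sqr_ge0 (F i - F j); nra.
nra.
Qed.

(** Used where a spare factor [N] makes the loss of [sqrt N] harmless. *)
Lemma sqrt_3N_le N : (0 < N)%N -> Num.sqrt (3 * N%:R) <= 2 * N%:R :> R.
Proof.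
move=> N0; rewrite -ler_sqr ?nnegrE ?sqrtr_ge0 ?mulr_ge0// sqr_sqrtr ?mulr_ge0//.
have : 1 <= N%:R :> R by rewrite ler1n.
by move: (N%:R : R) => X; nra.
Qed.

(** Inverse inequality: Cauchy-Schwarz over the [2N + 1 <= 3N] frequencies. *)
Lemma wiener1_nrm N v : (0 < N)%N -> in_S N v ->
  wiener (fun=> 1) N v <= Num.sqrt (3 * N%:R) * nrm v.
Proof.
move=> N0 hv; rewrite -ler_sqr ?nnegrE ?mulr_ge0 ?sqrtr_ge0 ?nrm_ge0//; last first.
  by apply: sumr_ge0 => k _; rewrite mul1r fourier_mod_ge0.
rewrite exprMn sqr_sqrtr ?mulr_ge0// (parseval hv).
rewrite /wiener; under eq_bigr do rewrite mul1r.
apply: le_trans (sqr_sum_le _ _) _; rewrite mulrA ler_wpM2r//.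
  by apply: sumr_ge0 => k _; exact: sqr_ge0.
rewrite size_map size_iota.
have h1 : 1 <= 2 * pi :> R by have := @pi_ge2 R; lra.
have h2 : (N.*2.+1)%:R <= 3 * N%:R :> R by rewrite -natrM ler_nat; lia.
apply: le_trans h2 _; rewrite -[leLHS]mulr1 ler_wpM2l// mulr_ge0//.
Qed.

End Fourier.

(** * Energy identity and stability of a midpoint stage *)


Section Energy.
Context {R : realType}.
Implicit Types (f g v w z m : R -> R) (x : R) (N : nat).

Lemma integ_by_parts f f' g g' : derives f f' -> derives g g' ->
  continuous f' -> continuous g' -> f (- pi) = f pi -> g (- pi) = g pi ->
  integ (fun x => f' x * g x) = - integ (fun x => f x * g' x).
Proof.
move=> df dg cf' cg' fpi gpi.
have cf := derives_continuous df; have cg := derives_continuous dg.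
have := integ_derives (derivesM df dg).
rewrite integD; do ?by cont.
by rewrite fpi gpi => h; apply/eqP; rewrite -addr_eq0 h//; cont.
Qed.

Lemma in_S_by_parts N M v w : in_S N v -> in_S M w ->
  integ (fun x => derive1 v x * w x) = - integ (fun x => v x * derive1 w x).
Proof.
move=> hv hw; apply: integ_by_parts.
- exact: derives_in_S hv.
- exact: derives_in_S hw.
- exact: in_S_continuous (in_S_derive1 hv).
- exact: in_S_continuous (in_S_derive1 hw).
- exact: in_S_endpoints hv.
- exact: in_S_endpoints hw.
Qed.

Lemma in_S_half_sqr N v : in_S N v -> in_S (N + N) (fun y => v y ^+ 2 / 2).
Proof.
move=> hv; apply: in_S_ext (in_SZ 2^-1 (in_SM hv hv)) => x.
by rewrite expr2 mulrC.
Qed.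

Lemma kdvF_in_S N v : in_S N v -> in_S N (kdvF N v).
Proof.
move=> hv; apply: in_SB; last exact: proj_in_S.
by apply: in_SN; exact: in_S_derive1n.
Qed.

Lemma derive1D N M v w : in_S N v -> in_S M w ->
  derive1 (fun x => v x + w x) = fun x => derive1 v x + derive1 w x.
Proof.
by move=> hv hw; apply: derivesE; apply: derivesD; [exact: derives_in_S hv|exact: derives_in_S hw].
Qed.

Lemma derive1n3D N v w : in_S N v -> in_S N w ->
  derive1n 3 (fun x => v x + w x) = fun x => derive1n 3 v x + derive1n 3 w x.
Proof.
move=> hv hw; rewrite /derive1n /=.
rewrite (derive1D hv hw) (derive1D (in_S_derive1 hv) (in_S_derive1 hw)).
by rewrite (derive1D (in_S_derive1 (in_S_derive1 hv)) (in_S_derive1 (in_S_derive1 hw))).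
Qed.

Lemma derive1_sqr N v : in_S N v ->
  derive1 (fun x => v x ^+ 2) = fun x => 2 * (v x * derive1 v x).
Proof.
move=> hv; apply: derivesE.
apply: derives_ext (derivesM (derives_in_S hv) (derives_in_S hv)) => x.
  by rewrite expr2.
ring.
Qed.

Lemma integ_third N M v w : in_S N v -> in_S M w ->
  integ (fun x => derive1n 3 v x * w x) = - integ (fun x => v x * derive1n 3 w x).
Proof.
move=> hv hw; rewrite /derive1n /=.
have hv1 := in_S_derive1 hv; have hw1 := in_S_derive1 hw.
have hv2 := in_S_derive1 hv1; have hw2 := in_S_derive1 hw1.
have e1 := in_S_by_parts hv2 hw; have e2 := in_S_by_parts hv1 hw1.
have e3 := in_S_by_parts hv hw2.
exact: (etrans e1 (etrans (congr1 -%R e2) (etrans (opprK _) e3))).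
Qed.

(** The third derivative is antisymmetric, so dispersion does no work. *)
Lemma integ_third0 N v : in_S N v -> integ (fun x => derive1n 3 v x * v x) = 0.
Proof.
move=> hv; have := integ_third hv hv.
rewrite [in RHS](@eq_integ _ _ (fun x => derive1n 3 v x * v x));
  last by move=> x; rewrite mulrC.
by move: (integ _) => I; lra.
Qed.

Lemma kdvF_diff N z m x : in_S N z -> in_S N m ->
  kdvF N (fun y => z y + m y) x - kdvF N z x =
  - derive1n 3 m x - proj N (derive1 (fun y => z y * m y + 2^-1 * (m y * m y))) x.
Proof.
move=> hz hm; rewrite /kdvF (derive1n3D hz hm).
have hsq := in_S_half_sqr hz.
have hg : in_S (N + N) (fun y => z y * m y + 2^-1 * (m y * m y)).
  by apply: in_SD; [exact: in_SM|apply: in_SZ; exact: in_SM].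
have -> : (fun y => (z y + m y) ^+ 2 / 2) =
   fun y => z y ^+ 2 / 2 + (z y * m y + 2^-1 * (m y * m y)).
  by apply/funext => y; field.
rewrite (derive1D hsq hg) projD; last 2 first.
- exact: in_S_continuous (in_S_derive1 hsq).
- exact: in_S_continuous (in_S_derive1 hg).
move: (derive1n 3 z x) (derive1n 3 m x) (proj N (derive1 (fun y => z y ^+ 2 / 2)) x).
by move: (proj N _ x) => A B C D; ring.
Qed.

(** Integrating by parts, [z m m_x] gives [-1/2 z_x m^2], while the third
    derivative is antisymmetric and [m^2 m_x] is an exact derivative: neither
    contributes.  No derivative of [m] is left, and nothing is cubic in [m]. *)
Lemma kdvF_energy N z m : in_S N z -> in_S N m ->
  integ (fun x => (kdvF N (fun y => z y + m y) x - kdvF N z x) * m x) =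
  - 2^-1 * integ (fun x => derive1 z x * m x ^+ 2).
Proof.
move=> hz hm; have hm3 := in_S_derive1n 3 hm.
set g := fun y => z y * m y + 2^-1 * (m y * m y).
have hg : in_S (N + N) g.
  by apply: in_SD; [exact: in_SM|apply: in_SZ; exact: in_SM].
have cm := in_S_continuous hm; have cm3 := in_S_continuous hm3.
have cz := in_S_continuous hz.
have hm1 := in_S_derive1 hm; have cm1 := in_S_continuous hm1.
have hz1 := in_S_derive1 hz; have cz1 := in_S_continuous hz1.
have cg := in_S_continuous hg; have cg1 := in_S_continuous (in_S_derive1 hg).
have cp := in_S_continuous (proj_in_S N (derive1 g)).
rewrite (@eq_integ _ _ (fun x => (- (derive1n 3 m x * m x)) - proj N (derive1 g) x * m x));
  last by move=> x; rewrite kdvF_diff// -/g mulrBl mulNr.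
rewrite integB ?integN; do ?by cont.
rewrite (integ_third0 hm) oppr0 sub0r proj_adj// (in_S_by_parts hg hm) opprK.
have hmm : in_S (N + N) (fun x => m x * m x) by exact: in_SM.
have h1 : integ (fun x => derive1 z x * m x ^+ 2) =
          - integ (fun x => z x * derive1 (fun y => m y ^+ 2) x).
  have := in_S_by_parts hz hmm; rewrite (_ : (fun x => m x * m x) = fun x => m x ^+ 2);
    last by apply/funext => y; rewrite expr2.
  by move=> <-; apply: eq_integ => x; rewrite expr2.
have h2 : integ (fun x => m x ^+ 2 * derive1 m x) = 0.
  have := in_S_by_parts hmm hm; rewrite (_ : (fun x => m x * m x) = fun x => m x ^+ 2);
    last by apply/funext => y; rewrite expr2.
  rewrite (derive1_sqr hm) => h.
  have h3 : integ (fun x => 2 * (m x * derive1 m x) * m x) =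
     2 * integ (fun x => m x ^+ 2 * derive1 m x).
    rewrite -integZ; last by cont.
    by apply: eq_integ => x; ring.
  have h4 : integ (fun x => m x * m x * derive1 m x) = integ (fun x => m x ^+ 2 * derive1 m x).
    by apply: eq_integ => x; rewrite expr2.
  by move: h; rewrite h3 h4; move: (integ _) => I; lra.
rewrite h1 (derive1_sqr hm) mulrNN.
rewrite (@eq_integ _ (fun x => g x * derive1 m x)
   (fun x => z x * m x * derive1 m x + 2^-1 * (m x ^+ 2 * derive1 m x)));
  last by move=> x; rewrite /g; ring.
rewrite integD ?(integZ 2^-1); do ?by cont.
rewrite h2 mulr0 addr0.
rewrite (@eq_integ _ (fun x => z x * (2 * (m x * derive1 m x)))
   (fun x => 2 * (z x * m x * derive1 m x))); last by move=> x; ring.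
by rewrite integZ ?mulKf//; cont.
Qed.

Lemma nrm_eq0 N v : in_S N v -> nrm v = 0 -> forall x, v x = 0.
Proof.
move=> hv v0 x; have hv' : in_S N.+1 v by exact: in_SW hv.
apply/eqP; rewrite -normr_le0; apply: le_trans (sup_wiener x hv') _.
by apply: le_trans (wiener1_nrm _ hv') _; rewrite // v0 mulr0.
Qed.

(** With [d] the difference of the two solutions of the stage and [m] its
    average over the stage, testing with [m] turns [d1 - d0] into
    [(|d1|^2 - |d0|^2) / 2], and [kdvF_energy] bounds the right side by
    [|tau| K |m|^2 / 2].  Only the solution [v] needs a bounded derivative. *)
Lemma stage_stable N (tau K : R) (y0 y1 v0 v1 : R -> R) :
  in_S N y0 -> in_S N y1 -> in_S N v0 -> in_S N v1 ->
  (forall x, y1 x = y0 x + tau * kdvF N (fun t => (y1 t + y0 t) / 2) x) ->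
  (forall x, v1 x = v0 x + tau * kdvF N (fun t => (v1 t + v0 t) / 2) x) ->
  (forall x, `|derive1 (fun t => (v1 t + v0 t) / 2) x| <= K) ->
  `|tau| * K <= 2 ->
  nrm (fun x => y1 x - v1 x) <= expR (`|tau| * K) * nrm (fun x => y0 x - v0 x).
Proof.
move=> hy0 hy1 hv0 hv1 ey ev vK tK.
set d1 := fun x => y1 x - v1 x; set d0 := fun x => y0 x - v0 x.
have K0 : 0 <= K by apply: le_trans (vK 0); exact: normr_ge0.
have hd1 : in_S N d1 by exact: in_SB. have hd0 : in_S N d0 by exact: in_SB.
set z := fun x => (v1 x + v0 x) / 2; set m := fun x => 2^-1 * (d1 x + d0 x).
have hz : in_S N z.
  by apply: in_S_ext (in_SZ 2^-1 (in_SD hv1 hv0)) => x; rewrite /z mulrC.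
have hm : in_S N m by apply: in_SZ; exact: in_SD.
have cm := in_S_continuous hm.
have cd1 := in_S_continuous hd1; have cd0 := in_S_continuous hd0.
have ezm : (fun x => (y1 x + y0 x) / 2) = fun x => z x + m x.
  by apply/funext => x; rewrite /z /m /d1 /d0; field.
have cF1 := in_S_continuous (kdvF_in_S (in_SD hz hm)).
have cF0 := in_S_continuous (kdvF_in_S hz).
have cz1 := in_S_continuous (in_S_derive1 hz).
have e1 : nrm d1 ^+ 2 - nrm d0 ^+ 2 = - tau * integ (fun x => derive1 z x * m x ^+ 2).
  rewrite !nrm_sqr -integB; do ?by cont.
  rewrite (@eq_integ _ _ (fun x => 2 * tau *
     ((kdvF N (fun y => z y + m y) x - kdvF N z x) * m x))); last first.
    move=> x; have ed : d1 x - d0 x = tau * (kdvF N (fun y => z y + m y) x - kdvF N z x).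
      rewrite /d1 /d0 ey ev ezm -/z.
      by move: (kdvF N (fun y => z y + m y) x) (kdvF N z x) => A B; ring.
    have -> : d1 x ^+ 2 - d0 x ^+ 2 = 2 * (d1 x - d0 x) * m x by rewrite /m; field.
    by rewrite ed !mulrA.
  apply: etrans (integZ (2 * tau) (continuous_mul (continuous_sub cF1 cF0) cm)) _.
  apply: etrans (congr1 (fun t => 2 * tau * t) (kdvF_energy hz hm)) _.
  by move: (integ _) => I; field.
have e2 : `|integ (fun x => derive1 z x * m x ^+ 2)| <= K * nrm m ^+ 2.
  apply: le_trans (le_norm_integ _) _; first by cont.
  rewrite nrm_sqr -integZ; last by cont.
  apply: le_integ => [||x]; do ?by cont.
  by rewrite normrM [`|m x ^+ 2|]ger0_norm ?sqr_ge0// ler_wpM2r ?sqr_ge0// vK.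
have e3 : nrm m <= (nrm d1 + nrm d0) / 2.
  have nm : nrm m = 2^-1 * nrm (fun x => d1 x + d0 x).
    rewrite /nrm -[2^-1]ger0_norm ?invr_ge0// -sqrtr_sqr -sqrtrM ?sqr_ge0//.
    congr Num.sqrt; rewrite -integZ; last by cont.
    by apply: eq_integ => x; rewrite exprMn.
  by rewrite nm mulrC ler_wpM2r ?invr_ge0// ler_nrmD.
set a := nrm d1 in e1 e3 *; set c := nrm d0 in e1 e3 *; set n := nrm m in e2 e3.
have a0 : 0 <= a by exact: nrm_ge0. have c0 : 0 <= c by exact: nrm_ge0.
have n0 : 0 <= n by exact: nrm_ge0.
pose q := `|tau| * K; have q0 : 0 <= q by rewrite mulr_ge0.
have e4 : a ^+ 2 - c ^+ 2 <= q / 4 * (a + c) ^+ 2.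
  rewrite e1; apply: le_trans (ler_norm _) _; rewrite normrM normrN.
  apply: le_trans (ler_wpM2l (normr_ge0 _) e2) _.
  rewrite mulrA -/q -mulrA ler_wpM2l//.
  have : n ^+ 2 <= ((a + c) / 2) ^+ 2 by rewrite ler_sqr ?nnegrE ?divr_ge0 ?addr_ge0.
  by rewrite exprMn; lra.
have e5 : a <= (1 + q) * c.
  have [ac0|acN0] := eqVneq (a + c) 0; first by nra.
  have acp : 0 < a + c by rewrite lt_neqAle eq_sym acN0 addr_ge0.
  have e6 : a - c <= q / 4 * (a + c).
    rewrite -(ler_pM2r acp); apply: le_trans (le_trans e4 _); first by lra.
    by rewrite expr2 mulrA.
  have q2 : q <= 2 by [].
  have qp : 0 < 1 - q / 4 by lra.
  (* Solving for [a] gives the factor [(1 + q/4) / (1 - q/4)], which is at most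
     [1 + q] exactly when [q <= 2]. *)
  have h : 0 <= c * q * (2 - q) by rewrite mulr_ge0 ?mulr_ge0// subr_ge0.
  by rewrite -(ler_pM2r qp); nra.
apply: le_trans e5 _; rewrite ler_wpM2r//; exact: expR_ge1Dx.
Qed.

End Energy.

(** * The midpoint stage on Fourier coefficients *)


Section Geometric.
Context {R : realType}.

(** A quantitative completeness for scalars, with the rate built in: the limit is
    the supremum of [u n - e n], where [e n] is the sum of the bounds on the
    remaining increments. *)
Lemma geometric_limit (u : nat -> R) (C : R) :
  (forall n, `|u n.+1 - u n| <= C / 2 ^+ n) ->
  exists l, forall n, `|l - u n| <= 2 * C / 2 ^+ n.
Proof.
move=> uC; pose e n := 2 * C / 2 ^+ n.
have eS n : e n = 2 * e n.+1.
  by rewrite /e exprS; field; rewrite expf_neq0.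
have uC' n : `|u n.+1 - u n| <= e n.+1.
  by have := uC n; rewrite /e exprS; congr (_ <= _); field; rewrite expf_neq0.
have e0 n : 0 <= e n by rewrite eS mulr_ge0//; exact: le_trans (uC' n).
have up n m : u (n + m)%N <= u n + e n - e (n + m)%N.
  elim: m => [|m ih]; first by rewrite addn0 addrK.
  rewrite addnS; have := uC' (n + m)%N; rewrite ler_norml => /andP[_ h].
  by have := eS (n + m)%N; lra.
have lo n m : u n - e n + e (n + m)%N <= u (n + m)%N.
  elim: m => [|m ih]; first by rewrite addn0 subrK.
  rewrite addnS; have := uC' (n + m)%N; rewrite ler_norml => /andP[h _].
  by have := eS (n + m)%N; lra.
have cross n m : u n - e n <= u m + e m.
  have h1 := lo n m; have h2 := up m n; rewrite addnC in h2.
  have := e0 (n + m)%N; lra.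
pose A := [set u n - e n | n in [set: nat]].
have supA : has_sup A.
  split; first by exists (u 0%N - e 0%N), 0%N.
  by exists (u 0%N + e 0%N) => _ [n _ <-].
exists (sup A) => n; rewrite -/(e n) ler_norml; apply/andP; split.
  have : u n - e n <= sup A by apply: sup_upper_bound => //; exists n.
  lra.
have : sup A <= u n + e n by apply: ge_sup; [case: supA | move=> _ [m _ <-]].
lra.
Qed.

Lemma geometric_eq0 (x C : R) : (forall n : nat, `|x| <= C / 2 ^+ n) -> x = 0.
Proof.
move=> h; apply/eqP; rewrite -normr_le0 leNgt; apply/negP => x0.
have [n Cn] : exists n : nat, C < `|x| * n%:R.
  exists (Num.bound `|C / `|x| |).
  rewrite mulrC -ltr_pdivrMr//; apply: le_lt_trans (ler_norm _) _.
  by apply: archi_boundP.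
have := h n; rewrite ler_pdivlMr ?exprn_gt0//.
have : (n%:R : R) <= 2 ^+ n by rewrite -natrX ler_nat ltnW// ltn_expl.
have := normr_ge0 x; nra.
Qed.

End Geometric.

Section Existence.
Context {R : realType}.
Implicit Types (N : nat) (k l m j : int) (a b : int -> R[i]) (z : R[i]).

Lemma nc_ge0 z : 0 <= nc z.
Proof. by case: z => p q; exact: sqrtr_ge0. Qed.

Lemma ncM z z' : nc (z * z') = nc z * nc z'.
Proof. exact: ComplexField.Normc.normcM. Qed.

Lemma ncD z z' : nc (z + z') <= nc z + nc z'.
Proof. exact: le_normcD. Qed.

Lemma ncN z : nc (- z) = nc z.
Proof. by case: z => p q /=; rewrite !sqrrN. Qed.

Lemma ncB z z' : nc (z - z') <= nc z + nc z'.
Proof. by rewrite -(ncN z'); exact: ncD. Qed.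

Lemma nc0 : nc (0 : R[i]) = 0.
Proof. by rewrite /= expr0n /= addr0 sqrtr0. Qed.

Lemma nc_real (x : R) : nc x%:C%C = `|x|.
Proof. by rewrite /= expr0n /= addr0 sqrtr_sqr. Qed.

Lemma nc_eq0 z : nc z = 0 -> z = 0.
Proof. exact: ComplexField.Normc.eq0_normc. Qed.

Lemma nc_sum (I : Type) (r : seq I) (F : I -> R[i]) :
  nc (\sum_(i <- r) F i) <= \sum_(i <- r) nc (F i).
Proof.
elim: r => [|i r ih]; first by rewrite !big_nil nc0.
by rewrite !big_cons; apply: le_trans (ncD _ _) _; rewrite lerD2l.
Qed.

Lemma nc_Re z : `|complex.Re z| <= nc z.
Proof.
case: z => p q /=; rewrite -ler_sqr ?nnegrE ?sqrtr_ge0// real_normK ?num_real//.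
by rewrite sqr_sqrtr ?addr_ge0 ?sqr_ge0// lerDl sqr_ge0.
Qed.

Lemma nc_Im z : `|complex.Im z| <= nc z.
Proof.
case: z => p q /=; rewrite -ler_sqr ?nnegrE ?sqrtr_ge0// real_normK ?num_real//.
by rewrite sqr_sqrtr ?addr_ge0 ?sqr_ge0// lerDr sqr_ge0.
Qed.

Lemma nc_le (p q : R) : nc (p +i* q)%C <= `|p| + `|q|.
Proof.
have -> : (p +i* q)%C = p%:C%C + (0 +i* q)%C by apply/eqP; rewrite eq_complex /= addr0 add0r !eqxx.
apply: le_trans (ncD _ _) _; rewrite nc_real lerD2l /=.
by rewrite expr0n /= add0r sqrtr_sqr.
Qed.

Definition cnorm (w : int -> R) N a : R := \sum_(k <- freqs N) w k * nc (a k).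

(** The coefficient of [e^(ijx)] in the product of two trigonometric polynomials,
    written over pairs so that both factors range over the same finite set. *)
Definition cauchy_prod N a b j : R[i] :=
  \sum_(l <- freqs N) \sum_(m <- freqs N) if l + m == j then a l * b m else 0.

(** Banach algebra property: a pair [(l, m)] contributes to the single frequency
    [l + m], where the weight is at most [w l * w m]. *)
Lemma cauchy_prod_norm (w : int -> R) N a b : (forall k, 0 <= w k) ->
  (forall l m, w (l + m) <= w l * w m) ->
  cnorm w N (cauchy_prod N a b) <= cnorm w N a * cnorm w N b.
Proof.
move=> w0 wM; rewrite /cnorm.
apply: (@le_trans _ _ (\sum_(j <- freqs N) \sum_(l <- freqs N) \sum_(m <- freqs N)
   if l + m == j then w j * (nc (a l) * nc (b m)) else 0)).
  apply: ler_sum => j _.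
  apply: (@le_trans _ _ (w j * \sum_(l <- freqs N) \sum_(m <- freqs N)
     if l + m == j then nc (a l) * nc (b m) else 0)).
    rewrite ler_wpM2l//; apply: le_trans (nc_sum _ _) _; apply: ler_sum => l _.
    apply: le_trans (nc_sum _ _) _; apply: ler_sum => m _.
    by case: ifP => _; rewrite ?nc0// ncM.
  rewrite mulr_sumr; apply: ler_sum => l _; rewrite mulr_sumr; apply: ler_sum => m _.
  by case: ifP => _ //; rewrite mulr0.
rewrite exchange_big /= mulr_suml; apply: ler_sum => l _.
rewrite exchange_big /= mulr_sumr; apply: ler_sum => m _.
rewrite (eq_bigr (fun j => if j == l + m then w j * (nc (a l) * nc (b m)) else 0));
  last by move=> j _; rewrite eq_sym.
rewrite (sum_freqs1 N (l + m) (fun j => w j * (nc (a l) * nc (b m)))).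
have h0 : 0 <= nc (a l) * nc (b m) by rewrite mulr_ge0 ?nc_ge0.
have h1 : w l * nc (a l) * (w m * nc (b m)) = (w l * w m) * (nc (a l) * nc (b m)) by ring.
case: ifP => _; rewrite h1; first by rewrite ler_wpM2r.
by rewrite mulr_ge0// mulr_ge0.
Qed.

Lemma cnorm_ge0 w N a : (forall k, 0 <= w k) -> 0 <= cnorm w N a.
Proof. by move=> w0; apply: sumr_ge0 => k _; rewrite mulr_ge0 ?nc_ge0. Qed.

Lemma cnormD w N a b : (forall k, 0 <= w k) ->
  cnorm w N (fun k => a k + b k) <= cnorm w N a + cnorm w N b.
Proof.
move=> w0; rewrite /cnorm -big_split /=; apply: ler_sum => k _.
by rewrite -mulrDr ler_wpM2l// ncD.
Qed.

Lemma cnormB w N a b : (forall k, 0 <= w k) ->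
  cnorm w N (fun k => a k - b k) <= cnorm w N a + cnorm w N b.
Proof.
move=> w0; rewrite /cnorm -big_split /=; apply: ler_sum => k _.
by rewrite -mulrDr ler_wpM2l// ncB.
Qed.

Lemma cnorm_mul w N a (g : int -> R[i]) (C : R) : (forall k, 0 <= w k) ->
  (forall k, k \in freqs N -> nc (g k) <= C) ->
  cnorm w N (fun k => g k * a k) <= C * cnorm w N a.
Proof.
move=> w0 gC; rewrite /cnorm mulr_sumr big_seq [leRHS]big_seq.
apply: ler_sum => k kN; rewrite ncM mulrCA ler_wpM2r//; last exact: gC.
by rewrite mulr_ge0 ?nc_ge0.
Qed.

Lemma cauchy_prod_diff N a b j : cauchy_prod N a a j - cauchy_prod N b b j =
  cauchy_prod N a (fun k => a k - b k) j + cauchy_prod N (fun k => a k - b k) b j.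
Proof.
rewrite /cauchy_prod -sumrB -big_split /=; apply: eq_bigr => l _.
rewrite -sumrB -big_split /=; apply: eq_bigr => m _.
by case: ifP => _; [ring | rewrite subr0 addr0].
Qed.

(** Coefficients of real-valued functions. *)
Definition herm a := forall k, a (- k) = conjc (a k).

Lemma herm_cauchy_prod N a b : herm a -> herm b -> herm (cauchy_prod N a b).
Proof.
move=> ha hb k; rewrite /cauchy_prod rmorph_sum /=.
rewrite -(sum_freqsN N (fun l => \sum_(m <- freqs N) _)); apply: eq_bigr => l _.
rewrite rmorph_sum /= -(sum_freqsN N (fun m => if _ then _ else _)).
apply: eq_bigr => m _; rewrite -opprD eqr_opp; case: ifP => _; last by rewrite rmorph0.
by rewrite ha hb rmorphM.
Qed.

(** The symbol of [1 + tau d^3/dx^3]: dispersion is moved to the left side of the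
    stage equation and inverted exactly. *)
Definition den (tau : R) j : R[i] := (1 +i* (- (tau * j%:~R ^+ 3)))%C.

Lemma den_ge1 tau j : 1 <= nc (den tau j).
Proof.
rewrite /den /= -[leLHS]sqrtr1 ler_wsqrtr// expr1n lerDl sqr_ge0 //.
Qed.

Lemma den_neq0 tau j : den tau j != 0.
Proof. by rewrite eq_complex /= oner_eq0. Qed.

Lemma herm_den tau j : den tau (- j) = conjc (den tau j).
Proof.
rewrite /den /= mulrNz; apply/eqP; rewrite eq_complex /= eqxx /=; apply/eqP; ring.
Qed.

(** The symbol [i j / 2] of the map [g |-> g_x / 2]. *)
Definition half_ij j : R[i] := (0 +i* (j%:~R / 2))%C.

Lemma herm_half_ij j : half_ij (- j) = conjc (half_ij j).
Proof.
by rewrite /half_ij /= mulrNz; apply/eqP; rewrite eq_complex /= eqxx /=; apply/eqP; ring.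
Qed.

(** Its fixed points are the coefficients of the solutions [z] of
    [z = y + tau F(z)]. *)
Definition stage_map N (tau : R) (y : int -> R[i]) a j : R[i] :=
  (den tau j)^-1 * (y j - tau%:C%C * (half_ij j * cauchy_prod N a a j)).

Lemma herm_stage_map N tau y a : herm y -> herm a -> herm (stage_map N tau y a).
Proof.
move=> hy ha k; rewrite /stage_map herm_den hy herm_half_ij (herm_cauchy_prod _ ha ha).
rewrite rmorphM fmorphV rmorphB !rmorphM /=; congr (_ * (_ - _ * _)).
by rewrite /= oppr0.
Qed.

Lemma nc_inv z : nc z^-1 = (nc z)^-1.
Proof. exact: ComplexField.Normc.normcV. Qed.

Lemma den_inv_le1 tau j : nc (den tau j)^-1 <= 1.
Proof.
rewrite nc_inv invf_le1 ?den_ge1//; exact: lt_le_trans (den_ge1 tau j).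
Qed.

Lemma nc_half_ij N j : j \in freqs N -> nc (half_ij j) <= N%:R / 2.
Proof.
move=> jN; rewrite /half_ij /= expr0n /= add0r sqrtr_sqr normrM.
by rewrite [`|2^-1|]ger0_norm// ler_wpM2r// freqs_normr.
Qed.

Section FixedPoint.
Variables (w : int -> R) (N : nat) (tau r : R) (y : int -> R[i]).
Hypothesis w1 : forall k, 1 <= w k.
Hypothesis wM : forall l m, w (l + m) <= w l * w m.
Hypothesis hy : herm y.
Hypothesis yr : cnorm w N y <= r.
Hypothesis small : `|tau| * N%:R * r <= 4^-1.

Let w0 k : 0 <= w k. Proof. exact: le_trans ler01 (w1 k). Qed.
Let r0 : 0 <= r. Proof. by apply: le_trans yr; exact: cnorm_ge0. Qed.

Lemma nonlinear_norm a b :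
  cnorm w N (fun j => tau%:C%C * (half_ij j * cauchy_prod N a b j)) <=
  `|tau| * (N%:R / 2) * (cnorm w N a * cnorm w N b).
Proof.
have h : cnorm w N (fun j => (tau%:C%C * half_ij j) * cauchy_prod N a b j) <=
    `|tau| * (N%:R / 2) * cnorm w N (cauchy_prod N a b).
  apply: cnorm_mul => // k kN; rewrite ncM nc_real ler_wpM2l//.
  exact: nc_half_ij.
apply: le_trans (le_trans _ h) _.
  by rewrite le_eqVlt; apply/orP; left; apply/eqP; apply: eq_bigr => k _; rewrite mulrA.
by rewrite ler_wpM2l ?mulr_ge0// ?divr_ge0//; exact: cauchy_prod_norm.
Qed.

(** The quadratic term is at most [|tau| N/2 (2r)^2 <= r/2]. *)
Lemma stage_map_bounded a : cnorm w N a <= 2 * r ->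
  cnorm w N (stage_map N tau y a) <= 2 * r.
Proof.
move=> ar; apply: le_trans (cnorm_mul (C := 1) _ _ _) _ => //.
  by move=> k _; exact: den_inv_le1.
rewrite mul1r; apply: le_trans (cnormB _ _ _ w0) _.
have h := nonlinear_norm a a.
have a0 : 0 <= cnorm w N a by exact: cnorm_ge0.
have t0 : 0 <= `|tau| * N%:R :> R by rewrite mulr_ge0.
have : `|tau| * (N%:R / 2) * (cnorm w N a * cnorm w N a) <= r.
  have -> : `|tau| * (N%:R / 2) * (cnorm w N a * cnorm w N a) =
     (`|tau| * N%:R) / 2 * (cnorm w N a * cnorm w N a) by ring.
  apply: (@le_trans _ _ ((`|tau| * N%:R) / 2 * ((2 * r) * (2 * r)))).
    by rewrite ler_wpM2l ?divr_ge0//; apply: ler_pM.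
  have -> : (`|tau| * N%:R) / 2 * ((2 * r) * (2 * r)) = 2 * (`|tau| * N%:R * r) * r by field.
  by rewrite -[leRHS]mul1r ler_wpM2r//; move: small; move: (_ * r) => X; lra.
by move: yr h; lra.
Qed.

(** [a a - b b = a (a - b) + (a - b) b] costs [|tau| N/2 * 4r <= 1/2]. *)
Lemma stage_map_contract a b : cnorm w N a <= 2 * r -> cnorm w N b <= 2 * r ->
  cnorm w N (fun k => stage_map N tau y a k - stage_map N tau y b k) <=
  2^-1 * cnorm w N (fun k => a k - b k).
Proof.
move=> ar br; set d := fun k => a k - b k.
have -> : (fun k => stage_map N tau y a k - stage_map N tau y b k) =
   fun k => - (den tau k)^-1 * (tau%:C%C * (half_ij k * cauchy_prod N a d k)
         + tau%:C%C * (half_ij k * cauchy_prod N d b k)).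
  apply/funext => k; rewrite /stage_map -mulrBr.
  have -> : y k - tau%:C%C * (half_ij k * cauchy_prod N a a k) -
    (y k - tau%:C%C * (half_ij k * cauchy_prod N b b k)) =
    - (tau%:C%C * (half_ij k * (cauchy_prod N a a k - cauchy_prod N b b k))) by ring.
  by rewrite cauchy_prod_diff -/d; ring.
apply: le_trans (cnorm_mul (C := 1) _ _ _) _ => //.
  by move=> k _; rewrite ncN; exact: den_inv_le1.
rewrite mul1r; apply: le_trans (cnormD _ _ _ w0) _.
have h1 := nonlinear_norm a d; have h2 := nonlinear_norm d b.
have d0 : 0 <= cnorm w N d by exact: cnorm_ge0.
apply: le_trans (lerD h1 h2) _.
have -> : `|tau| * (N%:R / 2) * (cnorm w N a * cnorm w N d) +
  `|tau| * (N%:R / 2) * (cnorm w N d * cnorm w N b) =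
  (`|tau| * N%:R / 2 * (cnorm w N a + cnorm w N b)) * cnorm w N d by ring.
rewrite ler_wpM2r//.
apply: (@le_trans _ _ (`|tau| * N%:R / 2 * (4 * r))).
  by rewrite ler_wpM2l ?divr_ge0 ?mulr_ge0//; lra.
have -> : `|tau| * N%:R / 2 * (4 * r) = 2 * (`|tau| * N%:R * r) by field.
by move: small; move: (_ * r) => X; lra.
Qed.

(** Picard iteration from 0.  The limit is taken coefficient by coefficient, and
    only on [freqs N]; outside it is set to 0, which keeps the symmetry
    [herm]. *)
Lemma stage_map_fixpoint : exists a, [/\ herm a, cnorm w N a <= 2 * r &
  forall k, k \in freqs N -> a k = stage_map N tau y a k].
Proof.
pose s n : int -> R[i] := iter n (stage_map N tau y) (fun=> 0).
have hs n : herm (s n).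
  elim: n => [k|n ih]; first by rewrite /s /= oppr0.
  exact: herm_stage_map.
have sr n : cnorm w N (s n) <= 2 * r.
  elim: n => [|n ih]; last exact: stage_map_bounded.
  by rewrite /cnorm big1 ?mulr_ge0// => k _; rewrite nc0 mulr0.
pose C := 4 * r.
have sd n : cnorm w N (fun k => s n.+1 k - s n k) <= C / 2 ^+ n.
  elim: n => [|n ih].
    by rewrite expr0 divr1; apply: le_trans (cnormB _ _ _ w0) _;
      have := sr 0%N; have := sr 1%N; rewrite /C; lra.
  apply: le_trans (stage_map_contract (sr n.+1) (sr n)) _.
  have -> : C / 2 ^+ n.+1 = 2^-1 * (C / 2 ^+ n).
    by rewrite exprS; field; rewrite expf_neq0.
  by rewrite ler_wpM2l.
have sk n k : k \in freqs N -> nc (s n.+1 k - s n k) <= C / 2 ^+ n.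
  move=> kN; apply: le_trans (sd n); rewrite /cnorm (bigD1_seq k kN (freqs_uniq N)) /=.
  rewrite -[leLHS]addr0 lerD//; last by apply: sumr_ge0 => j _; rewrite mulr_ge0 ?nc_ge0.
  by rewrite ler_peMl ?nc_ge0.
have lim k : exists z : R[i], k \in freqs N -> forall n, nc (z - s n k) <= 4 * C / 2 ^+ n.
  have [kN|_] := boolP (k \in freqs N); last by exists 0.
  have [n|p hp] := @geometric_limit _ (fun n => complex.Re (s n k)) C.
    by rewrite -raddfB; apply: le_trans (nc_Re _) (sk n k kN).
  have [n|q hq] := @geometric_limit _ (fun n => complex.Im (s n k)) C.
    by rewrite -raddfB; apply: le_trans (nc_Im _) (sk n k kN).
  exists (p +i* q)%C => _ n.
  have -> : (p +i* q)%C - s n k = ((p - complex.Re (s n k)) +i* (q - complex.Im (s n k)))%C.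
    by case: (s n k).
  apply: le_trans (nc_le _ _) _; have := hp n; have := hq n; lra.
have [lm hlm] := choice lim.
pose a k := if k \in freqs N then lm k else 0.
have al k n : k \in freqs N -> nc (a k - s n k) <= 4 * C / 2 ^+ n.
  by move=> kN; rewrite /a kN; exact: hlm.
have nc0P (z : R[i]) (D : R) : (forall n : nat, nc z <= D / 2 ^+ n) -> z = 0.
  move=> h; apply: nc_eq0; apply: (@geometric_eq0 _ _ D) => n.
  by rewrite ger0_norm ?nc_ge0.
pose W := \sum_(k <- freqs N) w k * (4 * C).
have aW n : cnorm w N (fun k => a k - s n k) <= W / 2 ^+ n.
  rewrite /cnorm /W big_seq mulr_suml [leRHS]big_seq; apply: ler_sum => k kN.
  by rewrite -mulrA ler_wpM2l// al.
have ar : cnorm w N a <= 2 * r.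
  have : Num.max 0 (cnorm w N a - 2 * r) = 0.
    apply: (@geometric_eq0 _ _ W) => n; rewrite ger0_norm ?le_max ?lexx//.
    have W0 : 0 <= W / 2 ^+ n by apply: le_trans (aW n); exact: cnorm_ge0.
    rewrite ge_max W0 /= lerBlDl.
    have -> : a = fun k => s n k + (a k - s n k) by apply/funext => k; rewrite addrC subrK.
    apply: le_trans (cnormD _ _ _ w0) _; apply: lerD.
      exact: sr.
    exact: aW.
  by move=> /eqP; rewrite eq_maxl subr_le0.
exists a; split => // [k|k kN].
  have [kN|kN] := boolP (k \in freqs N); last first.
    by rewrite /a mem_freqsN (negbTE kN) /= oppr0.
  apply/eqP; rewrite -subr_eq0; apply/eqP; apply: (@nc0P _ (4 * C + 4 * C)) => n.
  have -> : a (- k) - conjc (a k) = (a (- k) - s n (- k)) - conjc (a k - s n k).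
    by rewrite rmorphB /= hs; ring.
  apply: le_trans (ncB _ _) _; rewrite mulrDl lerD//; first by rewrite al ?mem_freqsN.
  have -> : nc (conjc (a k - s n k)) = nc (a k - s n k).
    by case: (a k - s n k) => p q /=; rewrite sqrrN.
  exact: al.
apply/eqP; rewrite -subr_eq0; apply/eqP; apply: (@nc0P _ (2 * W)) => n.
have -> : a k - stage_map N tau y a k = (a k - s n.+1 k) +
   (stage_map N tau y (s n) k - stage_map N tau y a k).
  by rewrite [s n.+1]/s iterS -/(s n); ring.
have le1 (g : int -> R[i]) : nc (g k) <= cnorm w N g.
  rewrite /cnorm (bigD1_seq k kN (freqs_uniq N)) /=.
  rewrite -[leLHS]addr0 lerD//; last by apply: sumr_ge0 => j _; rewrite mulr_ge0 ?nc_ge0.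
  by rewrite ler_peMl ?nc_ge0.
apply: le_trans (ncD _ _) _.
have h1 := le_trans (le1 (fun k => a k - s n.+1 k)) (aW n.+1).
have h2 := le_trans (le1 (fun k => stage_map N tau y (s n) k - stage_map N tau y a k))
   (stage_map_contract (sr n) ar).
have h3 : cnorm w N (fun k => s n k - a k) = cnorm w N (fun k => a k - s n k).
  by apply: eq_bigr => j _; rewrite -opprB ncN.
have h4 : W / 2 ^+ n.+1 = 2^-1 * (W / 2 ^+ n).
  by rewrite exprS; field; rewrite expf_neq0.
have := aW n; rewrite h3 in h2; rewrite h4 in h1.
have W0 : 0 <= W / 2 ^+ n by apply: le_trans (aW n); exact: cnorm_ge0.
move: h1 h2 => /=; rewrite -mulrA; lra.
Qed.

End FixedPoint.
End Existence.

(** * Solvability of the midpoint equation *)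


Section Solve.
Context {R : realType}.
Implicit Types (N : nat) (k l m j : int) (a b : int -> R[i]) (f g : R -> R).

Definition wave (c : R[i]) k (x : R) : R := complex.Re (c * cis (k%:~R * x)).

Lemma waveE c k x : wave c k x =
  complex.Re c * cos (k%:~R * x) + (- complex.Im c) * sin (k%:~R * x).
Proof. by case: c => p q; rewrite /wave /= mulNr. Qed.

Lemma wave_continuous c k : continuous (wave c k).
Proof.
rewrite (_ : wave c k = fun x => complex.Re c * cos (k%:~R * x) +
   (- complex.Im c) * sin (k%:~R * x)); last by apply/funext => x; rewrite waveE.
by cont.
Qed.

Lemma proj_wave N c k x : proj N (wave c k) x = if k \in freqs N then wave c k x else 0.
Proof.
rewrite (_ : wave c k = fun x => complex.Re c * cos (k%:~R * x) +
   (- complex.Im c) * sin (k%:~R * x)); last by apply/funext => t; rewrite waveE.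
rewrite projD; do ?by cont.
rewrite !projZ; do ?by cont.
by rewrite proj_cos proj_sin; case: ifP => _ //; rewrite !mulr0 addr0.
Qed.

Lemma wave_derives c k : derives (wave c k) (wave ((0 +i* k%:~R)%C * c) k).
Proof.
apply: derives_ext (derivesD (derivesZ (complex.Re c) (derives_cos k%:~R))
  (derivesZ (- complex.Im c) (derives_sin k%:~R))) => x; first by rewrite waveE.
by rewrite waveE; case: c => p q /=; ring.
Qed.

(** The real part is taken termwise, so that this is a real function for any [a];
    for [herm a] it is the complex sum, by [synth_complex]. *)
Definition synth N a (x : R) : R := \sum_(k <- freqs N) wave (a k) k x.

Lemma synth_complex N a x : herm a ->
  \sum_(k <- freqs N) a k * cis (k%:~R * x) = (synth N a x)%:C%C.
Proof.
move=> ha; set S := \sum_(k <- freqs N) _.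
have ReS : complex.Re S = synth N a x by rewrite /S raddf_sum.
suff ImS : complex.Im S = 0 by move: ReS ImS; case: S => p q /= -> ->.
have FE : complex.Im S = \sum_(k <- freqs N) complex.Im (a k * cis (k%:~R * x)).
  by rewrite /S raddf_sum.
have : complex.Im S = - complex.Im S.
  rewrite {1}FE -sum_freqsN FE -sumrN; apply: eq_bigr => k _.
  rewrite ha mulrNz mulNr /cis cosN sinN; case: (a k) => p q /=; ring.
lra.
Qed.

Lemma synth_in_S N a : herm a -> in_S N (synth N a).
Proof. by move=> ha; exists a => x; rewrite synth_complex. Qed.

Lemma fcos_synth N a j : herm a -> j \in freqs N ->
  fcos (synth N a) j = complex.Re (a j).
Proof.
move=> ha jN; have hS := synth_in_S N ha.
rewrite /fcos (@eq_integ _ _ (fun x => \sum_(k <- freqs N)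
  (complex.Re (a k) * (cos (j%:~R * x) * cos (k%:~R * x))
   + (- complex.Im (a k)) * (sin (k%:~R * x) * cos (j%:~R * x))))); last first.
  move=> x; rewrite /synth mulr_sumr; apply: eq_bigr => k _; rewrite waveE; ring.
rewrite integ_sum; last by move=> k; cont.
rewrite (eq_bigr (fun k => pi * ((if k == j then complex.Re (a k) else 0) +
   (if k == - j then complex.Re (a k) else 0)))).
  rewrite -mulr_sumr big_split /= !sum_freqs1 mem_freqsN jN ha.
  have -> : complex.Re (conjc (a j)) = complex.Re (a j) by case: (a j).
  by move: pi (@pi_neq0 R) => p p0; field.
move=> k _; rewrite integD ?integZ; do ?by cont.
rewrite integ_coscos integ_sincos mulr0 addr0.
rewrite [j == k]eq_sym -[j == - k]eqr_opp opprK [- j == k]eq_sym.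
by case: eqP => _; case: eqP => _ /=; ring.
Qed.

Lemma fsin_synth N a j : herm a -> j \in freqs N ->
  fsin (synth N a) j = - complex.Im (a j).
Proof.
move=> ha jN; have hS := synth_in_S N ha.
rewrite /fsin (@eq_integ _ _ (fun x => \sum_(k <- freqs N)
  (complex.Re (a k) * (sin (j%:~R * x) * cos (k%:~R * x))
   + (- complex.Im (a k)) * (sin (j%:~R * x) * sin (k%:~R * x))))); last first.
  move=> x; rewrite /synth mulr_sumr; apply: eq_bigr => k _; rewrite waveE; ring.
rewrite integ_sum; last by move=> k; cont.
rewrite (eq_bigr (fun k => - pi * ((if k == j then complex.Im (a k) else 0) -
   (if k == - j then complex.Im (a k) else 0)))).
  rewrite -mulr_sumr big_split /= sumrN !sum_freqs1 mem_freqsN jN ha.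
  have -> : complex.Im (conjc (a j)) = - complex.Im (a j) by case: (a j).
  by move: pi (@pi_neq0 R) => p p0; field.
move=> k _; rewrite integD ?integZ; do ?by cont.
rewrite integ_sinsin integ_sincos mulr0 add0r.
rewrite [j == k]eq_sym -[j == - k]eqr_opp opprK [- j == k]eq_sym.
by case: eqP => _; case: eqP => _ /=; ring.
Qed.

Lemma fourier_synth N a j : herm a -> j \in freqs N ->
  fourier_coef (synth N a) j = a j.
Proof.
move=> ha jN; rewrite fourier_coefE fcos_synth// fsin_synth// opprK.
by case: (a j).
Qed.

Lemma synth_fourier N v : in_S N v -> synth N (fourier_coef v) = v.
Proof. by move=> hv; rewrite -[RHS](proj_id hv); apply/funext => x; rewrite /synth /Defs.proj /fourier_sum raddf_sum. Qed.

Lemma herm_fourier f : herm (fourier_coef f).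
Proof. by move=> k; rewrite fourier_coefN; case: (fourier_coef f k). Qed.

Lemma wiener_cnorm w N f : wiener w N f = cnorm w N (fourier_coef f).
Proof. by apply: eq_bigr => k _; rewrite fourier_mod_normc. Qed.

Lemma wiener_synth w N a : herm a -> wiener w N (synth N a) = cnorm w N a.
Proof.
move=> ha; rewrite wiener_cnorm /cnorm big_seq [RHS]big_seq.
by apply: eq_bigr => k kN; rewrite fourier_synth.
Qed.

Lemma synth_derive1 N a :
  derive1 (synth N a) = synth N (fun k => (0 +i* k%:~R)%C * a k).
Proof.
by apply: derivesE; apply: derives_sum => k; exact: wave_derives.
Qed.

Lemma wave_sum (I : Type) (r : seq I) (c : I -> R[i]) k x :
  \sum_(i <- r) wave (c i) k x = wave (\sum_(i <- r) c i) k x.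
Proof. by rewrite /wave mulr_suml raddf_sum. Qed.

Lemma cisM (x y : R) : cis x * cis y = cis (x + y).
Proof.
rewrite /cis cosD sinD; apply/eqP; rewrite eq_complex /= eqxx /=.
by apply/eqP; ring.
Qed.

Lemma synth_sqr N a x : herm a -> synth N a x ^+ 2 / 2 =
  \sum_(l <- freqs N) \sum_(m <- freqs N) wave (2^-1%:C%C * (a l * a m)) (l + m) x.
Proof.
move=> ha.
have -> : synth N a x ^+ 2 / 2 = complex.Re (2^-1%:C%C *
   ((synth N a x)%:C%C * (synth N a x)%:C%C)).
  by rewrite -rmorphM -rmorphM /= expr2 mulrC.
rewrite -synth_complex// mulr_suml mulr_sumr raddf_sum; apply: eq_bigr => l _.
rewrite mulr_sumr mulr_sumr raddf_sum; apply: eq_bigr => m _.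
rewrite /wave intrD mulrDl -cisM; congr complex.Re; ring.
Qed.

(** Products of exponentials add frequencies, differentiation multiplies by
    [i (l + m)], and the projection keeps the pairs with [l + m] in [freqs N]. *)
Lemma synth_nonlinear N a x : herm a ->
  proj N (derive1 (fun y => synth N a y ^+ 2 / 2)) x =
  synth N (fun j => half_ij j * cauchy_prod N a a j) x.
Proof.
move=> ha.
pose G l m := wave ((0 +i* (l + m)%:~R)%C * (2^-1%:C%C * (a l * a m))) (l + m).
have -> : derive1 (fun y => synth N a y ^+ 2 / 2) =
   fun y => \sum_(l <- freqs N) \sum_(m <- freqs N) G l m y.
  rewrite (_ : (fun y => _) = fun y => \sum_(l <- freqs N) \sum_(m <- freqs N)
     wave (2^-1%:C%C * (a l * a m)) (l + m) y); last first.
    by apply/funext => y; rewrite synth_sqr.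
  apply: derivesE; apply: derives_sum => l; apply: derives_sum => m.
  exact: wave_derives.
have cG l m : continuous (G l m) by exact: wave_continuous.
rewrite proj_sum; last by move=> l; apply: continuous_sum.
have -> : synth N (fun j => half_ij j * cauchy_prod N a a j) x =
  \sum_(j <- freqs N) \sum_(l <- freqs N) \sum_(m <- freqs N)
   if j == l + m then G l m x else 0.
  apply: eq_bigr => j _; rewrite /cauchy_prod mulr_sumr -wave_sum; apply: eq_bigr => l _.
  rewrite mulr_sumr -wave_sum; apply: eq_bigr => m _.
  rewrite [j == _]eq_sym; case: eqP => [<-|_]; last by rewrite mulr0 /wave mul0r.
  have -> : half_ij (l + m) = (0 +i* (l + m)%:~R)%C * (2^-1)%:C%C :> R[i].
    rewrite /half_ij; apply/eqP; rewrite eq_complex /=; apply/andP; split;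
    by apply/eqP; move: (_%:~R : R) => n; field.
  by rewrite /G -mulrA.
rewrite exchange_big /=; apply: eq_bigr => l _.
rewrite proj_sum// exchange_big /=; apply: eq_bigr => m _.
by rewrite proj_wave (sum_freqs1 N (l + m) (fun=> G l m x)).
Qed.

Lemma kdvF_synth N a x : herm a -> kdvF N (synth N a) x =
  synth N (fun j => (0 +i* (j%:~R ^+ 3))%C * a j - half_ij j * cauchy_prod N a a j) x.
Proof.
move=> ha; rewrite /kdvF (synth_nonlinear N x ha) /derive1n /= !synth_derive1 /synth.
rewrite -sumrN -sumrB; apply: eq_bigr => k _.
rewrite /wave -raddfN -raddfB; congr complex.Re.
rewrite mulrBl -mulNr; congr (_ * _ - _).
rewrite !mulrA -mulNr; congr (_ * _); apply/eqP; rewrite eq_complex /=.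
by apply/andP; split; apply/eqP; ring.
Qed.

(** The smallness condition makes [stage_map] a contraction of the ball of radius
    [2 r]; the same ball bounds the solution. *)
Theorem midpoint_solvable (w : int -> R) N (tau r : R) (y : R -> R) :
  (forall k, 1 <= w k) -> (forall l m, w (l + m) <= w l * w m) ->
  in_S N y -> wiener w N y <= r -> `|tau| * N%:R * r <= 4^-1 ->
  exists z, [/\ in_S N z, forall x, z x = y x + tau * kdvF N z x &
                wiener w N z <= 2 * r].
Proof.
move=> w1 wM hy yr small; rewrite wiener_cnorm in yr.
have [a [ha ar fix_a]] := stage_map_fixpoint w1 wM (herm_fourier y) yr small.
exists (synth N a); split; [exact: synth_in_S | | by rewrite wiener_synth].
move=> x; rewrite (kdvF_synth _ _ ha) -{1}(synth_fourier hy) /synth mulr_sumr -big_split /=.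
rewrite big_seq [RHS]big_seq; apply: eq_bigr => k kN.
have h : a k = fourier_coef y k + tau%:C%C *
   ((0 +i* (k%:~R ^+ 3))%C * a k - half_ij k * cauchy_prod N a a k).
  have := fix_a k kN; rewrite /stage_map; move: (cauchy_prod N a a k) => c.
  move=> /(congr1 (fun u => den tau k * u)); rewrite mulVKf ?den_neq0// => e.
  have -> : fourier_coef y k = den tau k * a k + tau%:C%C * (half_ij k * c).
    by rewrite e subrK.
  have -> : den tau k = 1 - tau%:C%C * (0 +i* (k%:~R ^+ 3))%C.
    rewrite /den; apply/eqP; rewrite eq_complex /=; apply/andP; split; by apply/eqP; ring.
  ring.
rewrite {1}h /wave mulrDl raddfD /=; congr (_ + _).
by rewrite -mulrA; case: (_ * cis _) => p q /=; rewrite mul0r subr0.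
Qed.

End Solve.

(** * Stages and time steps *)


Section Stepping.
Context {R : realType}.
Implicit Types (N n i : nat) (k l m : int).

(** In terms of the average [z] of the stage values the equation reads
    [z = y + (tau / 2) F(z)], and [v = 2 z - y], whence the factor
    [5 = 2 * 2 + 1].  Uniqueness is [stage_stable] with equal initial data: the
    average of [v] has derivative at most [2 N r]. *)
Lemma stage_exists (w : int -> R) N (tau r : R) (y : R -> R) :
  (forall k, 1 <= w k) -> (forall l m, w (l + m) <= w l * w m) ->
  in_S N y -> wiener w N y <= r -> `|tau| * N%:R * r <= 2^-1 ->
  exists v, [/\ in_S N v,
    forall x, v x = y x + tau * kdvF N (fun t => (v t + y t) / 2) x,
    wiener w N v <= 5 * r, wiener w N (fun t => (v t + y t) / 2) <= 2 * r &
    forall v', in_S N v' ->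
      (forall x, v' x = y x + tau * kdvF N (fun t => (v' t + y t) / 2) x) ->
      v' = v].
Proof.
move=> w1 wM hy yr small.
have w0 k : 0 <= w k by exact: le_trans ler01 (w1 k).
have r0 : 0 <= r.
  by apply: le_trans yr; apply: sumr_ge0 => k _; rewrite mulr_ge0 ?fourier_mod_ge0.
have small2 : `|tau / 2| * N%:R * r <= 4^-1.
  rewrite normrM [`|2^-1|]ger0_norm//.
  have -> : `|tau| / 2 * N%:R * r = (`|tau| * N%:R * r) / 2 by field.
  by move: small; move: (_ * r) => X; lra.
have [z [hz ez zr]] := midpoint_solvable w1 wM hy yr small2.
have cz := in_S_continuous hz; have cy := in_S_continuous hy.
pose v x := 2 * z x + (-1) * y x.
have hv : in_S N v by apply: in_SD; exact: in_SZ.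
have evz : (fun t => (v t + y t) / 2) = z by apply/funext => t; rewrite /v; field.
have ev x : v x = y x + tau * kdvF N (fun t => (v t + y t) / 2) x.
  by rewrite evz /v {1}ez; move: (kdvF N z x) => A; field.
exists v; split => //.
- apply: le_trans (@wienerD _ w N (fun x => 2 * z x) (fun x => (-1) * y x) w0 _ _) _;
    [by cont | by cont |].
  rewrite !wienerZ// normrN1 mul1r ger0_norm//; lra.
- by rewrite evz.
- move=> v' hv' ev'; apply/funext => x; apply/eqP; rewrite -subr_eq0; apply/eqP.
  have dz t : `|derive1 (fun t => (v t + y t) / 2) t| <= N%:R * (2 * r).
    rewrite evz; apply: le_trans (sup_derive_wiener t hz) _.
    apply: (@le_trans _ _ (wiener (fun k => N%:R * w k) N z)).
      apply: le_wiener => k kN; rewrite -[leLHS]mulr1.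
      by rewrite ler_pM ?freqs_normr.
    by rewrite wienerZl ler_wpM2l.
  apply: (nrm_eq0 (in_SB hv' hv)); apply/eqP; rewrite eq_le nrm_ge0 andbT.
  apply: le_trans (stage_stable hy hv' hy hv ev' ev dz _) _.
    have -> : `|tau| * (N%:R * (2 * r)) = 2 * (`|tau| * N%:R * r) by ring.
    by move: small; move: (_ * r) => X; lra.
  rewrite /nrm (@eq_integ _ _ (fun=> 0)) ?integ_cst ?mul0r ?sqrtr0 ?mulr0//.
  by move=> t; rewrite subrr expr0n.
Qed.

Section TimeStep.
Variables (N s : nat) (b : nat -> R) (k beta r : R).
Hypothesis N0 : (0 < N)%N.
Hypothesis k0 : 0 <= k.
Hypothesis beta0 : 0 <= beta.
Hypothesis bbeta : forall i, (i <= s)%N -> `|b i| <= beta.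
Hypothesis r0 : 0 <= r.
Hypothesis small : k * N%:R * (beta * 5 ^+ s * r) <= 2^-1.

Let pow5 i : (i <= s)%N -> 5 ^+ i * r <= 5 ^+ s * r.
Proof. by move=> iS; rewrite ler_wpM2r// ler_weXn2l// ler1n. Qed.

Let stage_small i : (i < s)%N -> `|k * b i.+1| * N%:R * (5 ^+ i * r) <= 2^-1.
Proof.
move=> iS; apply: le_trans small; rewrite normrM (ger0_norm k0).
have -> : k * `|b i.+1| * N%:R * (5 ^+ i * r) = (k * N%:R) * (`|b i.+1| * (5 ^+ i * r)) by ring.
rewrite ler_wpM2l ?mulr_ge0// -mulrA ler_pM// ?bbeta//; last exact: pow5 (ltnW iS).
by rewrite mulr_ge0// exprn_ge0.
Qed.

Section Weight.
Variable w : int -> R.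
Hypothesis w1 : forall k, 1 <= w k.
Hypothesis wM : forall l m, w (l + m) <= w l * w m.

(** Each stage multiplies the norm by at most 5.  The stages of any solution are
    the ones constructed in [stage_exists], by uniqueness, so they inherit its
    bounds. *)
Lemma time_step_bound y Y : in_S N y -> wiener w N y <= r ->
  time_step N s b k y Y ->
  (forall i, (i <= s)%N -> wiener w N (Y i) <= 5 ^+ i * r) /\
  (forall i, (i < s)%N -> wiener w N (fun t => (Y i.+1 t + Y i t) / 2) <= 5 ^+ s * r).
Proof.
move=> hy yr [hY Y0 eY].
have bound i : (i <= s)%N -> wiener w N (Y i) <= 5 ^+ i * r.
  elim: i => [_|i ih iS].
    by rewrite expr0 mul1r; have -> : Y 0%N = y by apply/funext.
  have hYi := hY i (ltnW iS).
  have [v [_ _ vr _ uniq_v]] := stage_exists w1 wM hYi (ih (ltnW iS)) (stage_small iS).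
  by rewrite (uniq_v (Y i.+1)) ?exprS -?mulrA//; [exact: hY | move=> x; exact: eY].
split=> // i iS; have hYi := hY i (ltnW iS).
have [v [_ _ _ mr uniq_v]] := stage_exists w1 wM hYi (bound i (ltnW iS)) (stage_small iS).
have -> : Y i.+1 = v by apply: uniq_v; [exact: hY | move=> x; exact: eY].
apply: le_trans mr (le_trans _ (pow5 iS)); rewrite exprS mulrA ler_wpM2r//.
by rewrite ler_wpM2r ?exprn_ge0// ler_nat.
Qed.

Lemma time_step_unique y Y Y' : in_S N y -> wiener w N y <= r ->
  time_step N s b k y Y -> time_step N s b k y Y' ->
  forall i, (i <= s)%N -> Y' i = Y i.
Proof.
move=> hy yr hYY hYY'; have [bound _] := time_step_bound hy yr hYY.
move: hYY hYY' => [hY Y0 eY] [hY' Y0' eY']; elim=> [_|i ih iS].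
  by apply/funext => x; rewrite Y0 Y0'.
have hYi := hY i (ltnW iS).
have [v [_ _ _ _ uniq_v]] := stage_exists w1 wM hYi (bound i (ltnW iS)) (stage_small iS).
rewrite (uniq_v (Y i.+1)); last 2 first.
- exact: hY.
- by move=> x; exact: eY.
apply: uniq_v; first exact: hY'.
by move=> x; have := eY' i.+1 x iS; rewrite /= (ih (ltnW iS)).
Qed.

(** The stages are built by recursion on a choice function; its property is
    conditional because it is a total function of the stage index and the
    previous value. *)
Lemma time_step_exists y : in_S N y -> wiener w N y <= r ->
  exists Y, time_step N s b k y Y.
Proof.
move=> hy yr.
have nxt (i : nat) (v : R -> R) : exists v' : R -> R,
    (i < s)%N -> in_S N v -> wiener w N v <= 5 ^+ i * r ->
    [/\ in_S N v', wiener w N v' <= 5 ^+ i.+1 * r &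
     forall x, v' x = v x + k * b i.+1 * kdvF N (fun t => (v' t + v t) / 2) x].
  have [[iS hv vr]|no] := pselect [/\ (i < s)%N, in_S N v & wiener w N v <= 5 ^+ i * r].
    have [v' [hv' e vr' _ _]] := stage_exists w1 wM hv vr (stage_small iS).
    by exists v'; rewrite exprS -mulrA.
  by exists v => iS hv vr; exfalso; apply: no.
have [g hg] := choice (fun p : nat * (R -> R) => nxt p.1 p.2).
pose Y := fix Y (i : nat) : R -> R := if i is i'.+1 then g (i', Y i') else y.
have hY i : (i <= s)%N -> in_S N (Y i) /\ wiener w N (Y i) <= 5 ^+ i * r.
  elim: i => [_|i ih iS]; first by rewrite expr0 mul1r.
  have [h1 h2] := ih (ltnW iS).
  by have [h3 h4 _] := hg (i, Y i) iS h1 h2.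
exists Y; split=> // [i iS|[//|i] x iS]; first by have [] := hY i iS.
have [h1 h2] := hY i (ltnW iS).
by have [_ _ e] := hg (i, Y i) iS h1 h2; exact: e.
Qed.

End Weight.

(** Dominates [|j|], so that the norm controls the supremum of the derivative,
    and is submultiplicative. *)
Definition deriv_weight (j : int) : R := 1 + `|j%:~R|.

Lemma deriv_weight_ge1 j : 1 <= deriv_weight j. Proof. by rewrite lerDl. Qed.

Lemma deriv_weightM l m : deriv_weight (l + m) <= deriv_weight l * deriv_weight m.
Proof.
rewrite /deriv_weight intrD; have := ler_normD (l%:~R : R) m%:~R.
have := normr_ge0 (l%:~R : R); have := normr_ge0 (m%:~R : R).
by move: `|_ + _| `|l%:~R| `|m%:~R| => p q t; nra.
Qed.

(** [stage_stable] over the [s] stages: the averages of the stages of [v] have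
    derivative at most [5^s r]. *)
Lemma time_step_stable y v Y V : in_S N v -> wiener deriv_weight N v <= r ->
  time_step N s b k y Y -> time_step N s b k v V ->
  nrm (fun x => Y s x - V s x) <=
  expR (k * (beta * 5 ^+ s * r) * s%:R) * nrm (fun x => y x - v x).
Proof.
move=> hv vr [hY Y0 eY] hVV.
have [_ mid] := time_step_bound deriv_weight_ge1 deriv_weightM hv vr hVV.
move: hVV => [hV V0 eV].
set q := k * (beta * 5 ^+ s * r).
have Kr0 : 0 <= beta * 5 ^+ s * r by rewrite !mulr_ge0 ?exprn_ge0.
have q2 : q <= 2.
  apply: (@le_trans _ _ (k * N%:R * (beta * 5 ^+ s * r))); last first.
    by apply: le_trans small _; lra.
  by rewrite /q ler_wpM2r// ler_peMr// ler1n.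
suff H i : (i <= s)%N -> nrm (fun x => Y i x - V i x) <=
    expR (q * i%:R) * nrm (fun x => y x - v x) by exact: H.
elim: i => [_|i ih iS].
  rewrite mulr0 expR0 mul1r le_eqVlt; apply/orP; left; apply/eqP.
  by apply: eq_nrm => x; rewrite Y0 V0.
have hz : in_S N (fun t => (V i.+1 t + V i t) / 2).
  apply: in_S_ext (in_SZ 2^-1 (in_SD (hV i.+1 iS) (hV i (ltnW iS)))) => x.
  by rewrite mulrC.
have bq : `|k * b i.+1| * (5 ^+ s * r) <= q.
  rewrite normrM (ger0_norm k0) -mulrA ler_wpM2l// -mulrA ler_wpM2r ?bbeta//.
  by rewrite mulr_ge0// exprn_ge0.
apply: le_trans (@stage_stable _ N (k * b i.+1) (5 ^+ s * r) _ _ _ _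
   (hY i (ltnW iS)) (hY i.+1 iS) (hV i (ltnW iS)) (hV i.+1 iS) _ _ _ _) _.
- by move=> x; exact: (eY i.+1 x iS).
- by move=> x; exact: (eV i.+1 x iS).
- move=> x; apply: le_trans (sup_derive_wiener x hz) _; apply: le_trans (mid i iS).
  by apply: le_wiener => j _; rewrite /deriv_weight lerDr.
- exact: le_trans bq q2.
apply: (@le_trans _ _ (expR q * (expR (q * i%:R) * nrm (fun x => y x - v x)))).
  by apply: ler_pM; rewrite ?expR_ge0 ?nrm_ge0 ?ler_expR// ih// ltnW.
by rewrite mulrA -expRD -natr1 mulrDr mulr1 addrC.
Qed.

End TimeStep.

End Stepping.

(** * The fully discrete scheme against the semidiscrete solution *)


Section Discrete.
Context {R : realType}.

Section Scheme.
Variables (N M s alpha : nat) (b : nat -> R) (T beta r C0 : R).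
Variables (u0 : R -> R) (w : nat -> R -> R) (V : nat -> nat -> R -> R).
Hypothesis N0 : (0 < N)%N.
Hypothesis M0 : (0 < M)%N.
Hypothesis alpha0 : (0 < alpha)%N.
Hypothesis T0 : 0 < T.
Hypothesis beta0 : 0 <= beta.
Hypothesis bbeta : forall i, (i <= s)%N -> `|b i| <= beta.
Hypothesis r0 : 0 <= r.
Hypothesis C0_ge0 : 0 <= C0.
Hypothesis hw : forall n, (n <= M)%N -> in_S N (w n).
Hypothesis wr : forall n, (n <= M)%N -> wiener deriv_weight N (w n) <= r.
Hypothesis w0 : w 0%N = proj N u0.

Let k := T / M%:R.

Hypothesis hV : forall n, (n < M)%N -> time_step N s b k (w n) (V n).
Hypothesis loc : forall n, (n < M)%N ->
  nrm (fun x => w n.+1 x - V n s x) <= C0 * k ^+ alpha.+1.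

(** The exponent per unit time in [time_step_stable]. *)
Definition growth_rate := beta * 5 ^+ s * r * s%:R.
(** Discrete Gronwall: at most [T / k] local errors [C0 k^(alpha+1)], each
    amplified by at most [exp (growth_rate T)]. *)
Definition stability_const := C0 * T * expR (growth_rate * T).
(** Radius of a ball that the fully discrete solution cannot leave: the bound
    [r] of the semidiscrete one, plus the error [stability_const k^alpha] times
    the factor [2 N] of the inverse inequality, where [k N <= 1]. *)
Definition wiener_radius := r + 2 * stability_const * T ^+ alpha.-1.

Hypothesis kN1 : k * N%:R <= 1.
Hypothesis small : k * N%:R * (beta * 5 ^+ s * wiener_radius) <= 2^-1.

Let T_ge0 : 0 <= T. Proof. exact: ltW. Qed.

Let k0 : 0 <= k. Proof. by rewrite divr_ge0// ltW. Qed.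

Let growth_rate_ge0 : 0 <= growth_rate.
Proof. by rewrite /growth_rate !mulr_ge0// exprn_ge0. Qed.

Let stability_const_ge0 : 0 <= stability_const.
Proof. by rewrite /stability_const !mulr_ge0// ?expR_ge0// ltW. Qed.

Let r_le : r <= wiener_radius.
Proof.
by rewrite /wiener_radius lerDl mulr_ge0 ?exprn_ge0// mulr_ge0.
Qed.

Let wradius0 : 0 <= wiener_radius. Proof. exact: le_trans r_le. Qed.

Let small_r : k * N%:R * (beta * 5 ^+ s * r) <= 2^-1.
Proof.
apply: le_trans small; rewrite ler_wpM2l ?mulr_ge0//.
by rewrite ler_wpM2l// mulr_ge0// exprn_ge0.
Qed.

Let kT : k <= T.
Proof. by rewrite /k ler_pdivrMr ?ltr0n// ler_peMr ?ler1n// ltW. Qed.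

(* The error bound after [n] steps that is carried through the induction. *)
Let err n := C0 * k ^+ alpha.+1 * n%:R * expR (growth_rate * (k * n%:R)).

Let err_le n : (n <= M)%N -> err n <= stability_const * k ^+ alpha.
Proof.
move=> nM; have knT : k * n%:R <= T.
  rewrite /k mulrAC ler_pdivrMr ?ltr0n// ler_wpM2l ?ler_nat// ltW//.
have -> : err n = C0 * (k * n%:R) * expR (growth_rate * (k * n%:R)) * k ^+ alpha.
  by rewrite /err exprS; ring.
rewrite ler_wpM2r ?exprn_ge0// /stability_const ler_pM ?mulr_ge0 ?expR_ge0//.
  by rewrite ler_wpM2l.
by rewrite ler_expR ler_wpM2l.
Qed.

(* Closeness in the [L^2] norm gives boundedness in the norm of weight 1, since
   [alpha >= 1] and [k N <= 1] compensate the inverse inequality. *)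
Let wiener_close v n : (n <= M)%N -> in_S N v ->
  nrm (fun x => v x - w n x) <= stability_const * k ^+ alpha -> wiener (fun=> 1) N v <= wiener_radius.
Proof.
move=> nM hv close; have hd := in_SB hv (hw nM).
have -> : v = fun x => w n x + (v x - w n x).
  by apply/funext => x; rewrite addrC subrK.
have cw := in_S_continuous (hw nM); have cd := in_S_continuous hd.
apply: le_trans (@wienerD _ _ N (w n) (fun x => v x - w n x) (fun=> ler01) cw cd) _.
apply: lerD.
  by apply: le_trans (wr nM); apply: le_wiener => j _; exact: deriv_weight_ge1.
apply: le_trans (wiener1_nrm N0 hd) _.
apply: le_trans (ler_wpM2l (sqrtr_ge0 _) close) _.
have sN := @sqrt_3N_le R N N0.
have ka : k ^+ alpha <= k * T ^+ alpha.-1.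
  by rewrite -[alpha](prednK alpha0) exprS ler_wpM2l// lerXn2r// nnegrE// ltW.
apply: le_trans (ler_pM _ _ sN (ler_wpM2l stability_const_ge0 ka)) _; rewrite ?sqrtr_ge0//.
  by rewrite mulr_ge0// exprn_ge0.
have -> : 2 * N%:R * (stability_const * (k * T ^+ alpha.-1)) = (k * N%:R) * (2 * stability_const * T ^+ alpha.-1).
  by ring.
by rewrite ler_piMl// mulr_ge0 ?exprn_ge0// mulr_ge0.
Qed.

Let one_weight_ge1 (j : int) : (1 : R) <= 1. Proof. by []. Qed.
Let one_weightM (l m : int) : (1 : R) <= 1 * 1. Proof. by rewrite mulr1. Qed.

(** Solvability of step [n] needs the bound on [U n], which needs the error after
    [n] steps, so existence and error are obtained in a single induction.
    Smallness for existence uses [wiener_radius], stability uses the bound [r]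
    of the semidiscrete solution, on which the local solutions start. *)
Theorem discrete_error : exists (U : nat -> R -> R) (Y : nat -> nat -> R -> R),
  [/\ fully_discrete N s b k u0 M U Y,
      forall m U' Y', (m <= M)%N ->
        fully_discrete N s b k u0 m U' Y' ->
        (forall n x, (n <= m)%N -> U' n x = U n x) /\
        (forall n i x, (n < m)%N -> (i <= s)%N -> Y' n i x = Y n i x)
    & forall n, (n <= M)%N ->
        nrm (fun x => U n x - w n x) <= stability_const * k ^+ alpha].
Proof.
have solve v n : (n <= M)%N -> in_S N v ->
    nrm (fun x => v x - w n x) <= stability_const * k ^+ alpha -> exists Y, time_step N s b k v Y.
  move=> nM hv close; apply: (time_step_exists k0 bbeta wradius0 small one_weight_ge1
    one_weightM) => //; exact: wiener_close close.
(* A total choice of the step, meaningful where a step exists. *)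
have pick_step (v : R -> R) : exists Y' : nat -> R -> R,
    (exists Y, time_step N s b k v Y) -> time_step N s b k v Y'.
  have [[Y hY]|no] := pselect (exists Y, time_step N s b k v Y); first by exists Y.
  by exists (fun=> v) => /no.
have [st hst] := choice pick_step.
pose U n := iter n (fun v => st v s) (w 0%N); pose Y n := st (U n).
have main n : (n <= M)%N -> in_S N (U n) /\ nrm (fun x => U n x - w n x) <= err n.
  elim: n => [_|n ih nM].
    split; first exact: hw.
    rewrite /err mulr0 mul0r /nrm (@eq_integ _ _ (fun=> 0)) ?integ_cst ?mul0r ?sqrtr0//.
    by move=> t; rewrite /= subrr expr0n.
  have [hU eU] := ih (ltnW nM).
  have closeU := le_trans eU (err_le (ltnW nM)).
  have hY := hst _ (solve _ _ (ltnW nM) hU closeU).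
  have hUS : in_S N (U n.+1) by have [h _ _] := hY; exact: h.
  split=> //; have [hVS _ _] := hV nM; have hVs := hVS s (leqnn s).
  have hwS := hw nM.
  have cd1 := in_S_continuous (in_SB hUS hVs).
  have cd2 := in_S_continuous (in_SB hVs hwS).
  have -> : nrm (fun x => U n.+1 x - w n.+1 x) =
     nrm (fun x => (U n.+1 x - V n s x) + (V n s x - w n.+1 x)).
    by apply: eq_nrm => x; rewrite addrA subrK.
  apply: le_trans (ler_nrmD cd1 cd2) _.
  have l1 : nrm (fun x => V n s x - w n.+1 x) <= C0 * k ^+ alpha.+1.
    apply: le_trans (loc nM); rewrite -nrmN le_eqVlt; apply/orP; left; apply/eqP.
    by apply: eq_nrm => x; rewrite opprB.
  have l2 := time_step_stable N0 k0 beta0 bbeta r0 small_r (hw (ltnW nM))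
    (wr (ltnW nM)) hY (hV nM).
  have eg : k * (beta * 5 ^+ s * r) * s%:R = growth_rate * k by rewrite /growth_rate; ring.
  rewrite eg in l2.
  have l3 : nrm (fun x => U n.+1 x - V n s x) <= expR (growth_rate * k) * err n.
    by apply: le_trans l2 _; rewrite ler_wpM2l ?expR_ge0.
  apply: le_trans (lerD l3 l1) _.
  have e1 : expR (growth_rate * k) * err n =
     C0 * k ^+ alpha.+1 * n%:R * expR (growth_rate * (k * n.+1%:R)).
    have -> : growth_rate * (k * n.+1%:R) = growth_rate * k + growth_rate * (k * n%:R).
      by rewrite -natr1; ring.
    by rewrite /err expRD; ring.
  have e2 : err n.+1 = C0 * k ^+ alpha.+1 * n%:R * expR (growth_rate * (k * n.+1%:R))
      + C0 * k ^+ alpha.+1 * expR (growth_rate * (k * n.+1%:R)).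
    by rewrite /err; move: (expR _) => E; rewrite -natr1; ring.
  rewrite e1 e2 lerD2l ler_peMr ?mulr_ge0 ?exprn_ge0//.
  by rewrite -[leLHS]expR0 ler_expR mulr_ge0// mulr_ge0.
have close n : (n <= M)%N -> nrm (fun x => U n x - w n x) <= stability_const * k ^+ alpha.
  by move=> nM; have [_ h] := main n nM; apply: le_trans h (err_le nM).
have hY n : (n < M)%N -> time_step N s b k (U n) (Y n).
  move=> nM; have [hU _] := main n (ltnW nM).
  exact: hst _ (solve _ _ (ltnW nM) hU (close n (ltnW nM))).
exists U, Y; split=> //.
- split=> [n nM|x|n nM]; first by have [] := main n nM.
    by rewrite -w0.
  by split; [exact: hY|].
- move=> m U' Y' mM [hU' U0' hY'].
  have eqU n : (n <= m)%N -> U' n = U n.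
    elim: n => [_|n ih nm]; first by apply/funext => x; rewrite U0' -w0.
    have nM : (n < M)%N := leq_trans nm mM.
    have [hU _] := main n (ltnW nM).
    have [hYn eYn] := hY' n nm; rewrite (ih (ltnW nm)) in hYn.
    apply/funext => x; rewrite eYn.
    by rewrite (time_step_unique k0 bbeta wradius0 small one_weight_ge1 one_weightM
      hU (wiener_close (ltnW nM) hU (close n (ltnW nM))) (hY n nM) hYn (leqnn s)).
  split=> [n x nm|n i x nm iS]; first by rewrite eqU.
  have nM : (n < M)%N := leq_trans nm mM.
  have [hU _] := main n (ltnW nM).
  have [hYn eYn] := hY' n nm; rewrite (eqU _ (ltnW nm)) in hYn.
  by rewrite (time_step_unique k0 bbeta wradius0 small one_weight_ge1 one_weightM
    hU (wiener_close (ltnW nM) hU (close n (ltnW nM))) (hY n nM) hYn iS).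
Qed.

End Scheme.
End Discrete.

(** * Pointwise convergence of Fourier series *)


Section Dirichlet.
Context {R : realType}.
Implicit Types (f g h : R -> R) (N n : nat).

Lemma freqsS_perm N : perm_eq (freqs N.+1) [:: N.+1%:Z, - N.+1%:Z & freqs N].
Proof.
apply: uniq_perm; first exact: freqs_uniq.
  rewrite 2!cons_uniq freqs_uniq in_cons !mem_freqs negb_or andbT -andbA.
  by apply/and3P; split; [lia | lia | lia].
by move=> k; rewrite [LHS]mem_freqs 2!in_cons mem_freqs; lia.
Qed.

Lemma sum_freqsS (V : nmodType) N (F : int -> V) :
  \sum_(k <- freqs N.+1) F k = F N.+1%:Z + (F (- N.+1%:Z) + \sum_(k <- freqs N) F k).
Proof. by rewrite (perm_big _ (freqsS_perm N)) 2!big_cons. Qed.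

Lemma sum_freqs0 (V : nmodType) (F : int -> V) : \sum_(k <- freqs 0) F k = F 0.
Proof. by rewrite /freqs /= big_seq1 subrr. Qed.

Lemma bessel_nat N h : continuous h ->
  \sum_(0 <= n < N) fourier_mod h n%:Z ^+ 2 <= nrm h ^+ 2.
Proof.
move=> ch; apply: (@le_trans _ _ (\sum_(k <- freqs N) fourier_mod h k ^+ 2)); last first.
  apply: le_trans (bessel N ch); rewrite ler_peMl//.
    by apply: sumr_ge0 => k _; exact: sqr_ge0.
  by have := @pi_ge2 R; lra.
have F0 k : 0 <= fourier_mod h k ^+ 2 by exact: sqr_ge0.
suff : fourier_mod h N%:Z ^+ 2 + \sum_(0 <= n < N) fourier_mod h n%:Z ^+ 2 <=
   \sum_(k <- freqs N) fourier_mod h k ^+ 2.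
  by apply: le_trans; rewrite lerDr.
elim: N => [|N ih]; first by rewrite big_geq// addr0 sum_freqs0.
rewrite big_nat_recr//= sum_freqsS lerD2l.
apply: (le_trans _ (le_trans ih _)); first by rewrite addrC.
by rewrite lerDr.
Qed.

Lemma fourier_mod_cvg0 h : continuous h -> (fun n : nat => fourier_mod h n%:Z ^+ 2) @ \oo --> (0 : R).
Proof.
move=> ch; apply: cvg_series_cvg_0; apply: nondecreasing_is_cvgn.
  by apply: nondecreasing_series => n _ _; exact: sqr_ge0.
by exists (nrm h ^+ 2) => _ [n _ <-]; exact: bessel_nat.
Qed.

(** The squares of the coefficients are summable, by Bessel's inequality. *)
Lemma riemann_lebesgue h (e : R) : continuous h -> 0 < e ->
  \forall n \near \oo, fourier_mod h n%:Z <= e.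
Proof.
move=> ch e0; have e2 : 0 < e ^+ 2 by rewrite exprn_gt0.
have /cvgrPdist_le /(_ _ e2) := fourier_mod_cvg0 ch.
apply: filterS => n; rewrite sub0r normrN ger0_norm ?sqr_ge0//.
by rewrite ler_sqr ?nnegrE ?fourier_mod_ge0// ltW.
Qed.

(** Multiplied by [sin (t / 2)], the sum telescopes to [sin ((N + 1/2) t)], which
    is expanded here so that integer frequencies remain. *)
Lemma dirichlet_kernel N (t : R) :
  sin (t / 2) * \sum_(k <- freqs N) cos (k%:~R * t) =
  sin (N%:R * t) * cos (t / 2) + cos (N%:R * t) * sin (t / 2).
Proof.
rewrite -sinD; elim: N => [|N ih].
  by rewrite sum_freqs0 !mul0r cos0 mulr1 add0r.
rewrite sum_freqsS !mulrDr ih mulrNz mulNr cosN.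
have -> : N.+1%:R * t + t / 2 = (N%:R * t + t / 2) + t by rewrite -natr1; ring.
rewrite -[(N.+1%:Z)%:~R]/(N.+1%:R : R).
have -> : N.+1%:R * t = (N%:R * t + t / 2) + t / 2 by rewrite -natr1; field.
have -> : N%:R * t + t / 2 + t = N%:R * t + t / 2 + (t / 2 + t / 2) by field.
move: (N%:R * t + t / 2) => A; move: (t / 2) => q.
have -> : sin (A + (q + q)) = sin A + 2 * (sin q * cos (A + q)).
  rewrite !(sinD, cosD); have := cos2Dsin2 q.
  move: (cos q) (sin q) (cos A) (sin A) => a c d e h.
  have -> : a * a = 1 - c ^+ 2 by rewrite -h expr2; ring.
  by ring.
by move: (sin q * cos (A + q)) (sin A) => X Y; ring.
Qed.

Lemma sin_eq0_int (a : R) : sin a = 0 -> exists m : int, a = m%:~R * pi.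
Proof.
move=> sa; exists (Num.floor (a / pi)); set m := Num.floor _.
have pp : 0 < pi :> R := pi_gt0 R.
have /andP[m1 m2] : (m%:~R <= a / pi < (m + 1)%:~R) by exact: floor_itv.
pose q := a - m%:~R * pi.
have q0 : 0 <= q by rewrite /q subr_ge0 -ler_pdivlMr.
have qp : q < pi.
  by move: m2; rewrite ltr_pdivrMr// intrD mulrDl mul1r /q; lra.
have sq : sin q = 0 by rewrite /q sinB sa mul0r sin_intpi mulr0 subrr.
have [q00|qN0] := eqVneq q 0; first by apply/eqP; rewrite -subr_eq0 -/q q00.
have : 0 < sin q by apply: sin_gt0_pi; rewrite qp andbT lt_neqAle eq_sym qN0.
by rewrite sq ltxx.
Qed.

Lemma sin_mulrn0 (a : R) n : sin a = 0 -> sin (n%:R * a) = 0.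
Proof.
move=> sa; elim: n => [|n ih]; first by rewrite mul0r sin0.
by rewrite -natr1 mulrDl mul1r sinD ih sa mul0r mulr0 addr0.
Qed.

Lemma periodic_int f (T : R) (m : int) x : periodic f T -> f (x + m%:~R * T) = f x.
Proof.
move=> pf; case: m => n; first by rewrite -(periodicn pf n x) mulr_natl.
by rewrite NegzE mulrNz mulNr -(periodicn pf n.+1 (x - _)) -mulr_natl subrK.
Qed.

Section Chernoff.
Variables (f f' : R -> R) (x : R).
Hypothesis df : derives f f'.
Hypothesis pf : periodic f (2 * pi).

Let s (y : R) := sin ((y - x) / 2).
Let c (y : R) := cos ((y - x) / 2).

(* The function [f - f x] divided by [tan ((y - x) / 2)].  Differentiability of
   [f] makes it continuous across the zeros of the sine, where its value is
   forced. *)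
Let G (y : R) := if s y == 0 then 2 * f' y else (f y - f x) * c y / s y.

Let s_zero y : s y = 0 -> f y = f x.
Proof.
move=> /sin_eq0_int[m hm]; have -> : y = x + m%:~R * (2 * pi); last exact: periodic_int.
have : y - x = 2 * ((y - x) / 2) by field.
by rewrite hm => /eqP; rewrite subr_eq => /eqP ->; ring.
Qed.

Let ds : derives s (fun y => 2^-1 * c y).
Proof.
move=> y; have d1 : is_derive y 1 (fun y => (y - x) / 2) (2^-1 : R).
  have := @derivesZ R 2^-1 _ _ (derivesB (@derives_lin R 1) (derives_cst x)) y.
  by congr (is_derive _ _ _ _); [apply/funext => z; rewrite mul1r mulrC | rewrite subr0 mulr1].
rewrite mulrC; exact: (is_derive1_comp (f := sin) (g := fun y => (y - x) / 2)).
Qed.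

Let cs : continuous s. Proof. exact: derives_continuous ds. Qed.

Let cc : continuous c.
Proof.
move=> y; apply: (@continuous_comp _ _ _ (fun y => (y - x) / 2) cos); last exact: continuous_cos.
by apply: cvgM; [apply: cvgB; [exact: cvg_id | exact: cvg_cst] | exact: cvg_cst].
Qed.

Let cf : continuous f. Proof. exact: derives_continuous df. Qed.

(* Near a zero of the sine, numerator and denominator are [z - y] times functions
   continuous at [y], by the theorem of Caratheodory. *)
Let G_continuous : continuous G.
Proof.
move=> y; have [sy0|syN0] := eqVneq (s y) 0; last first.
  have nz : \forall z \near y, s z != 0.
    have := @cs y; move/cvgr_neq0 => /(_ syN0); exact.
  rewrite /continuous_at.
  have -> : G y = (f y - f x) * c y / s y by rewrite /G (negbTE syN0).
  apply: cvg_trans (_ : (fun z => (f z - f x) * c z / s z) @ y --> _); last first.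
    apply: cvgM; last by apply: cvgV => //; exact: cs.
    by apply: cvgM; [apply: cvgB; [exact: cf|exact: cvg_cst] | exact: cc].
  by apply: near_eq_cvg; near=> z; rewrite /G ifF//; apply/negbTE; near: z.
have [ph [fE cph phy]] := (is_derive1_caratheodory f y (f' y)).1 (df y).
have [ps [sE cps psy]] := (is_derive1_caratheodory s y _).1 (ds y).
have cy0 : c y != 0.
  have := cos2Dsin2 ((y - x) / 2); rewrite -/(s y) sy0 expr0n addr0 -/(c y).
  by move=> h; apply/eqP => cy; move: h; rewrite cy expr0n => /eqP; rewrite eq_sym oner_eq0.
have psN0 : ps y != 0 by rewrite psy mulf_neq0// invr_eq0 pnatr_eq0.
have nz : \forall z \near y, ps z != 0 by move/cvgr_neq0: cps => /(_ psN0); exact.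
have fyx := s_zero sy0.
rewrite /continuous_at.
have -> : G y = ph y * c y / ps y.
  by rewrite /G sy0 eqxx phy psy invfM invrK; field.
apply: cvg_trans (_ : (fun z => ph z * c z / ps z) @ y --> _); last first.
  by apply: cvgM; [apply: cvgM => //; exact: cc | apply: cvgV].
apply: near_eq_cvg; near=> z.
have [->|zy] := eqVneq z y; first by rewrite /G sy0 eqxx phy psy invfM invrK; field.
have psz : ps z != 0 by near: z.
have zy0 : z - y != 0 by rewrite subr_eq0.
have sz : s z = ps z * (z - y) by rewrite -sE sy0 subr0.
rewrite /G ifF; last by rewrite sz mulf_eq0 (negbTE psz) (negbTE zy0).
by rewrite sz -fyx fE; field; rewrite psz zy0.
Unshelve. all: by end_near. Qed.

(* The Dirichlet kernel times [f - f x], as two oscillating factors times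
   continuous functions. *)
Let kernel_id N y :
  (\sum_(k <- freqs N) cos (k%:~R * (y - x))) * (f y - f x) =
  sin (N%:R * (y - x)) * G y + cos (N%:R * (y - x)) * (f y - f x).
Proof.
have [sy0|syN0] := eqVneq (s y) 0.
  rewrite (s_zero sy0) subrr !mulr0 addr0.
  have -> : N%:R * (y - x) = (N * 2)%:R * ((y - x) / 2).
    by rewrite natrM; field.
  by rewrite sin_mulrn0// mul0r.
rewrite /G (negbTE syN0).
have := dirichlet_kernel N (y - x); rewrite -/(s y) -/(c y) => h.
apply: (mulfI syN0); rewrite [LHS]mulrA h.
by move: (sin _) (cos _) (f y - f x) (c y) => A B C E; field.
Qed.

Let proj_error N : proj N f x - f x =
  (2 * pi)^-1 * integ (fun y => sin (N%:R * (y - x)) * G y + cos (N%:R * (y - x)) * (f y - f x)).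
Proof.
have cst_S : in_S N (fun=> f x).
  have h0 : 0 \in freqs N by rewrite mem_freqs.
  by apply: in_S_ext (in_SZ (f x) (in_S_cos h0)) => y; rewrite mul0r cos0 mulr1.
have cg : continuous (fun y => f y - f x) by cont.
have -> : proj N f x - f x = proj N (fun y => f y - f x) x.
  rewrite projB//; last exact: continuous_const.
  by rewrite (proj_id cst_S).
rewrite (eq_integ (fun y => esym (kernel_id N y))).
rewrite (@eq_integ _ _ (fun y => \sum_(k <- freqs N)
   (cos (k%:~R * x) * (cos (k%:~R * y) * (f y - f x)) +
    sin (k%:~R * x) * (sin (k%:~R * y) * (f y - f x))))); last first.
  move=> y; rewrite mulr_suml; apply: eq_bigr => k _; rewrite [_%:~R * (y - x)]mulrBr cosB; ring.
rewrite integ_sum; last by move=> k; cont.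
rewrite projE mulr_sumr; apply: eq_bigr => k _.
rewrite integD; do ?by cont.
rewrite !integZ; do ?by cont.
by rewrite /fcos /fsin; ring.
Qed.

(** By the Dirichlet kernel the error is a combination of Fourier coefficients of
    order [N] of two continuous functions, which vanish in the limit. *)
Lemma fourier_pointwise : (fun N => proj N f x) @ \oo --> f x.
Proof.
have cg : continuous (fun y => f y - f x) by cont.
have cG := G_continuous.
have bound N : `|proj N f x - f x| <= 2 * fourier_mod G N%:Z + 2 * fourier_mod (fun y => f y - f x) N%:Z.
  have -> : proj N f x - f x =
     (cos (N%:R * x) * fsin G N%:Z + (- sin (N%:R * x)) * fcos G N%:Z) +
     (cos (N%:R * x) * fcos (fun y => f y - f x) N%:Z +
      sin (N%:R * x) * fsin (fun y => f y - f x) N%:Z).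
    rewrite proj_error /fcos /fsin.
    rewrite (@eq_integ _ _ (fun y => (cos (N%:R * x) * (sin (N%:~R * y) * G y) +
      (- sin (N%:R * x)) * (cos (N%:~R * y) * G y)) +
      (cos (N%:R * x) * (cos (N%:~R * y) * (f y - f x)) +
       sin (N%:R * x) * (sin (N%:~R * y) * (f y - f x))))); last first.
      move=> y; rewrite [_%:R * (y - x)]mulrBr cosB sinB -[(N%:Z)%:~R]/(N%:R : R); ring.
    rewrite integD; do ?by cont.
    rewrite integD; do ?by cont.
    rewrite integD; do ?by cont.
    rewrite !integZ; do ?by cont.
    by ring.
  have g1 := fcos_le_fourier_mod G N%:Z; have g2 := fsin_le_fourier_mod G N%:Z.
  have h1 := fcos_le_fourier_mod (fun y => f y - f x) N%:Z.
  have h2 := fsin_le_fourier_mod (fun y => f y - f x) N%:Z.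
  have bm (u v : R) : `|u| <= 1 -> `|u * v| <= `|v|.
    by move=> u1; rewrite normrM ler_piMl.
  have c1 := cos_max (N%:R * x); have s1 := sin_max (N%:R * x).
  apply: le_trans (ler_normD _ _) _; apply: lerD.
    apply: le_trans (ler_normD _ _) _; rewrite mulrDl mul1r; apply: lerD.
      exact: le_trans (bm _ _ c1) g2.
    by apply: le_trans (bm _ _ _) g1; rewrite normrN.
  apply: le_trans (ler_normD _ _) _; rewrite mulrDl mul1r; apply: lerD.
    exact: le_trans (bm _ _ c1) h1.
  exact: le_trans (bm _ _ s1) h2.
apply/cvgrPdist_le => e e0.
have e4 : 0 < e / 4 by rewrite divr_gt0.
near=> N; rewrite distrC; apply: le_trans (bound N) _.
have h1 : fourier_mod G N%:Z <= e / 4.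
  by near: N; exact: riemann_lebesgue.
have h2 : fourier_mod (fun y => f y - f x) N%:Z <= e / 4.
  by near: N; exact: riemann_lebesgue.
by lra.
Unshelve. all: by end_near. Qed.

End Chernoff.
End Dirichlet.

(** * Smoothness from decay of Fourier coefficients *)


Section Regularity.
Context {R : realType}.
Implicit Types (f g : R -> R) (N n : nat).

Lemma derives_lipschitz g g' (B : R) : derives g g' -> (forall x, `|g' x| <= B) ->
  forall x y, `|g x - g y| <= B * `|x - y|.
Proof.
move=> dg gB; suff H x y : y <= x -> `|g x - g y| <= B * `|x - y|.
  move=> x y; have [/H//|/ltW/H] := leP y x.
  by rewrite distrC [`|y - x|]distrC.
move=> yx; have cg := derives_continuous dg.
have [c _ ->] := MVT_segment yx (fun z _ => dg z) (continuous_subspaceT cg).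
by rewrite normrM ler_wpM2r.
Qed.

Lemma derives_remainder (F F1 F2 : R -> R) (B x h : R) :
  derives F F1 -> derives F1 F2 -> (forall y, `|F2 y| <= B) -> 0 <= h ->
  `|F (x + h) - F x - F1 x * h| <= B * h * h.
Proof.
move=> dF dF1 F2B h0.
have cF := derives_continuous dF.
have xh : x <= x + h by rewrite lerDl.
have [c + ->] := MVT_segment xh (fun z _ => dF z) (continuous_subspaceT cF).
rewrite in_itv /= => /andP[xc cxh].
have -> : x + h - x = h by rewrite addrAC subrr add0r.
rewrite -mulrBl normrM (ger0_norm h0) ler_wpM2r//.
apply: le_trans (derives_lipschitz dF1 F2B c x) _.
have B0 : 0 <= B by apply: le_trans (F2B 0); exact: normr_ge0.
by rewrite ler_wpM2l// ger0_norm ?subr_ge0// lerBlDl.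
Qed.

(** With second derivatives at most [B], the difference quotient of [F n] with
    step [h] is within [B h] of [F1 n x], uniformly in [n]; choose [h] small
    first, then [n] large.  It identifies a derivative of [f], known only to
    exist, with the limit of the derivatives of the partial sums. *)
Lemma cvg_derives (F F1 F2 : nat -> R -> R) f f1 (B x : R) :
  (forall n, derives (F n) (F1 n)) -> (forall n, derives (F1 n) (F2 n)) ->
  (forall n y, `|F2 n y| <= B) -> (forall y, F ^~ y @ \oo --> f y) ->
  derives f f1 -> F1 ^~ x @ \oo --> f1 x.
Proof.
move=> dF dF1 F2B cvF df.
have [ph [fE cph phx]] := (is_derive1_caratheodory f x (f1 x)).1 (df x).
have B0 : 0 <= B by apply: le_trans (F2B 0%N 0); exact: normr_ge0.
apply/cvgrPdist_le => e e0.
have e3 : 0 < e / 3 by rewrite divr_gt0.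
have [h [h0 phh Bh]] : exists h : R, [/\ 0 < h, `|ph (x + h) - f1 x| <= e / 3 & B * h <= e / 3].
  have /cvgrPdist_le /(_ _ e3) := cph; rewrite phx => /nbhs_ballP[d /= d0 hd].
  pose h := Num.min (d / 2) (e / 3 / (B + 1)).
  have B1 : 0 < B + 1 by rewrite ltr_wpDl.
  have h0 : 0 < h by rewrite /h lt_min !divr_gt0.
  exists h; split=> //.
    rewrite distrC; apply: hd; rewrite /ball /= opprD addrA subrr sub0r normrN gtr0_norm//.
    apply: (@le_lt_trans _ _ (d / 2)); first by rewrite /h ge_min lexx.
    by rewrite ltr_pdivrMr// ltr_pMr// ltr1n.
  have : h <= e / 3 / (B + 1) by rewrite /h ge_min lexx orbT.
  rewrite ler_pdivlMr// => hh; apply: le_trans hh.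
  by rewrite mulrC ler_wpM2l ?lerDl// ltW.
have eh : 0 < e / 3 * h / 2 by rewrite !(mulr_gt0, divr_gt0).
have /cvgrPdist_le /(_ _ eh) c1 := cvF (x + h).
have /cvgrPdist_le /(_ _ eh) c2 := cvF x.
near=> n.
have a1 : `|f (x + h) - F n (x + h)| <= e / 3 * h / 2 by near: n.
have a2 : `|f x - F n x| <= e / 3 * h / 2 by near: n.
have a3 := derives_remainder x (dF n) (dF1 n) (F2B n) (ltW h0).
have a4 : f (x + h) - f x = ph (x + h) * h by rewrite fE addrAC subrr add0r.
rewrite -(ler_pM2r h0) -{1}(gtr0_norm h0) -normrM mulrBl.
have a5 : `|ph (x + h) * h - f1 x * h| <= e / 3 * h.
  by rewrite -mulrBl normrM (gtr0_norm h0) ler_wpM2r// ltW.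
have a6 : B * h * h <= e / 3 * h by rewrite ler_wpM2r// ltW.
apply: (@le_trans _ _ (e / 3 * h + e / 3 * h + e / 3 * h)); last first.
  by rewrite le_eqVlt; apply/orP; left; apply/eqP; field.
move: a1 a2 a3 a5 a6; rewrite -a4 !ler_norml.
move: (f (x + h)) (F n (x + h)) (f x) (F n x) (F1 n x * h) (f1 x * h) => A C D E G H.
move: (e / 3 * h) (B * h * h) => X Y.
by move=> /andP[? ?] /andP[? ?] /andP[? ?] /andP[? ?] ?; apply/andP; split; lra.
Unshelve. all: by end_near. Qed.

Lemma cvg_le_norm (u : nat -> R) (l B : R) :
  u @ \oo --> l -> (forall n, `|u n| <= B) -> `|l| <= B.
Proof.
by move=> ul uB; apply: (cvgr_to_le (cvg_norm ul)); exact: nearW.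
Qed.

(** The terms [k] and [-k] together are at most [4 / (n (n + 1))], which
    telescopes; the constant 5 is that of [wiener_proj_bound]. *)
Lemma sum_inv_sqr N : \sum_(k <- freqs N) (1 + (k%:~R : R) ^+ 2)^-1 <= 5 - 4 / N.+1%:R.
Proof.
elim: N => [|N ih]; first by rewrite sum_freqs0 expr0n addr0 invr1; lra.
rewrite sum_freqsS mulrNz sqrrN -[(N.+1%:Z)%:~R]/(N.+1%:R : R) addrA.
apply: le_trans (lerD (lexx _) ih) _.
rewrite -[N.+2%:R]natr1; have : 1 <= N.+1%:R :> R by rewrite ler1n.
move: (N.+1%:R : R) => n n1.
have h1 : 0 < 1 + n ^+ 2 by rewrite ltr_pwDl// sqr_ge0.
have h2 : 0 < n by lra. have h3 : 0 < n + 1 by lra.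
have e1 : 4 / n - 4 / (n + 1) = 4 / (n * (n + 1)) by field; rewrite !gt_eqF.
have e2 : (1 + n ^+ 2)^-1 + (1 + n ^+ 2)^-1 <= 4 / (n * (n + 1)).
  have -> : (1 + n ^+ 2)^-1 + (1 + n ^+ 2)^-1 = 2 / (1 + n ^+ 2) by ring.
  rewrite ler_pdivrMr// mulrAC ler_pdivlMr ?mulr_gt0//.
  nra.
lra.
Qed.

Lemma fourier_mod_derive1n N j (v : R -> R) (k : int) : in_S N v ->
  fourier_mod (derive1n j v) k = `|k%:~R| ^+ j * fourier_mod v k.
Proof.
move=> hv; elim: j => [|j ih]; first by rewrite expr0 mul1r.
by rewrite derive1nS (fourier_mod_derive1 k (in_S_derive1n j hv)) ih mulrA exprS.
Qed.

Lemma fcos_proj N f (k : int) : continuous f ->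
  fcos (proj N f) k = if k \in freqs N then fcos f k else 0.
Proof.
move=> cf; have ck := @continuous_cos_k R k%:~R.
have -> : fcos (proj N f) k = (2 * pi)^-1 * integ (fun x => proj N f x * cos (k%:~R * x)).
  by rewrite /fcos; congr (_ * _); apply: eq_integ => x; rewrite mulrC.
rewrite integ_projC//; case: ifP => kN.
  rewrite /fcos; congr (_ * _); apply: eq_integ => x.
  by rewrite proj_cos kN mulrC.
rewrite (@eq_integ _ _ (fun=> 0)) ?integ_cst ?mul0r ?mulr0// => x.
by rewrite proj_cos kN mulr0.
Qed.

Lemma fsin_proj N f (k : int) : continuous f ->
  fsin (proj N f) k = if k \in freqs N then fsin f k else 0.
Proof.
move=> cf; have ck := @continuous_sin_k R k%:~R.
have -> : fsin (proj N f) k = (2 * pi)^-1 * integ (fun x => proj N f x * sin (k%:~R * x)).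
  by rewrite /fsin; congr (_ * _); apply: eq_integ => x; rewrite mulrC.
rewrite integ_projC//; case: ifP => kN.
  rewrite /fsin; congr (_ * _); apply: eq_integ => x.
  by rewrite proj_sin kN mulrC.
rewrite (@eq_integ _ _ (fun=> 0)) ?integ_cst ?mul0r ?mulr0// => x.
by rewrite proj_sin kN mulr0.
Qed.

Lemma fourier_mod_proj N f (k : int) : continuous f -> k \in freqs N ->
  fourier_mod (proj N f) k = fourier_mod f k.
Proof. by move=> cf kN; rewrite /fourier_mod fcos_proj// fsin_proj// kN. Qed.

Section Smooth.
Variables (f f1 f2 f3 : R -> R) (K : R).
Hypothesis df : derives f f1.
Hypothesis df1 : derives f1 f2.
Hypothesis df2 : derives f2 f3.
Hypothesis pf : periodic f (2 * pi).
Hypothesis K0 : 0 <= K.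
Hypothesis decay : forall k : int, fourier_mod f k <= K / (1 + k%:~R ^+ 2) ^+ 3.

Let cf : continuous f. Proof. exact: derives_continuous df. Qed.
Let S_in N : in_S N (proj N f). Proof. exact: proj_in_S. Qed.

(** Decay of order 6 leaves room for four derivatives with a summable remainder:
    [|k|^4 <= (1 + k^2)^2].  Three derivatives occur in the equation, and the
    fourth controls the convergence of the third. *)
Lemma wiener_proj_bound N j : (j <= 4)%N ->
  \sum_(k <- freqs N) `|k%:~R| ^+ j * fourier_mod f k <= 5 * K.
Proof.
move=> j4; apply: (@le_trans _ _ (\sum_(k <- freqs N) K * (1 + (k%:~R : R) ^+ 2)^-1)).
  apply: ler_sum => k _; apply: le_trans (ler_wpM2l _ (decay k)) _.
    by rewrite exprn_ge0.
  rewrite mulrCA ler_wpM2l//.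
  have q0 : 0 < 1 + (k%:~R : R) ^+ 2 by rewrite ltr_pwDl// sqr_ge0.
  rewrite ler_pdivrMr ?exprn_gt0// [_ ^+ 3]exprS mulKf ?gt_eqF//.
  have [->|kN0] := eqVneq k 0.
    rewrite normr0; apply: (@le_trans _ _ 1).
      by rewrite expr0n; case: (j == 0)%N.
    by apply: exprn_ege1; rewrite lerDl sqr_ge0.
  have k1 : 1 <= `|k%:~R| :> R.
    by rewrite -intr_norm -[1]/(1%:~R) ler_int; move: kN0; rewrite -normr_gt0; lia.
  apply: (@le_trans _ _ (`|k%:~R| ^+ 4)); first by rewrite ler_weXn2l.
  have -> : `|k%:~R| ^+ 4 = (k%:~R ^+ 2) ^+ 2 :> R.
    by rewrite -exprM -[(2 * 2)%N]/4%N -normrX ger0_norm// (exprM _ 2 2) sqr_ge0.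
  by apply: lerXn2r; rewrite ?nnegrE ?lerDr ?ler01 ?sqr_ge0 ?(ltW q0).
rewrite -mulr_sumr mulrC ler_wpM2r//; apply: le_trans (sum_inv_sqr N) _.
by rewrite lerBlDr lerDl divr_ge0.
Qed.

Let D j N := derive1n j (proj N f).

Lemma proj_derivative_bound j N x : (j <= 4)%N -> `|D j N x| <= 5 * K.
Proof.
move=> j4; have hD : in_S N (D j N) by exact: in_S_derive1n.
apply: le_trans (sup_wiener x hD) _.
apply: le_trans (wiener_proj_bound N j4); rewrite /wiener.
rewrite big_seq [leRHS]big_seq; apply: ler_sum => k kN.
by rewrite mul1r /D (fourier_mod_derive1n j k (S_in N)) (fourier_mod_proj cf kN).
Qed.

Let dD j N : derives (D j N) (D j.+1 N).
Proof. by apply: derives_in_S; exact: in_S_derive1n. Qed.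

Lemma proj_cvg x : D 0 ^~ x @ \oo --> f x.
Proof. exact: fourier_pointwise. Qed.

Lemma proj_cvg1 x : D 1 ^~ x @ \oo --> f1 x.
Proof.
apply: (@cvg_derives (D 0) (D 1) (D 2) f f1 (5 * K)) => [n|n|n y|y|].
- exact: dD. - exact: dD. - exact: proj_derivative_bound. - exact: proj_cvg. - by [].
Qed.

Lemma proj_cvg2 x : D 2 ^~ x @ \oo --> f2 x.
Proof.
apply: (@cvg_derives (D 1) (D 2) (D 3) f1 f2 (5 * K)) => [n|n|n y|y|].
- exact: dD. - exact: dD. - exact: proj_derivative_bound. - exact: proj_cvg1. - by [].
Qed.

Lemma proj_cvg3 x : D 3 ^~ x @ \oo --> f3 x.
Proof.
apply: (@cvg_derives (D 2) (D 3) (D 4) f2 f3 (5 * K)) => [n|n|n y|y|].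
- exact: dD. - exact: dD. - exact: proj_derivative_bound. - exact: proj_cvg2. - by [].
Qed.

Lemma smooth_bound : forall x, [/\ `|f x| <= 5 * K, `|f1 x| <= 5 * K & `|f3 x| <= 5 * K].
Proof.
move=> x; split.
- by apply: cvg_le_norm (@proj_cvg x) _ => n; exact: proj_derivative_bound.
- by apply: cvg_le_norm (@proj_cvg1 x) _ => n; exact: proj_derivative_bound.
- by apply: cvg_le_norm (@proj_cvg3 x) _ => n; exact: proj_derivative_bound.
Qed.

(** The third derivatives of the partial sums are uniformly Lipschitz, and this
    passes to the pointwise limit. *)
Lemma smooth_continuous3 : continuous f3.
Proof.
have lip x y : `|f3 x - f3 y| <= 5 * K * `|x - y|.
  apply: (@cvg_le_norm (fun n => D 3 n x - D 3 n y)).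
    by apply: cvgB; exact: proj_cvg3.
  move=> n; apply: (derives_lipschitz (dD 3 n)) => z; exact: proj_derivative_bound.
move=> x; apply/cvgrPdist_le => e e0.
have K1 : 0 < 5 * K + 1 by rewrite ltr_wpDl// mulr_ge0.
have d0 : 0 < e / (5 * K + 1) by rewrite divr_gt0.
near=> y; apply: le_trans (lip x y) _.
have : `|x - y| < e / (5 * K + 1) by near: y; exact: cvgr_dist_lt.
rewrite ltr_pdivlMr// mulrDr mulr1 => h.
by apply: ltW; apply: le_lt_trans h; rewrite mulrC lerDl.
Unshelve. all: by end_near. Qed.

(** Periodicity of the derivatives is inherited from the partial sums. *)
Lemma smooth_endpoints : [/\ f (- pi) = f pi, f1 (- pi) = f1 pi & f2 (- pi) = f2 pi].
Proof.
have ends j : (fun n => D j n (- pi)) = (fun n => D j n pi).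
  by apply/funext => n; apply: (@in_S_endpoints _ n); exact: in_S_derive1n.
have uniq (u : nat -> R) (a c : R) : u @ \oo --> a -> u @ \oo --> c -> a = c.
  by move=> ua uc; apply: (cvg_unique _ ua uc).
split.
- by apply: (uniq (fun n => D 0 n pi)); [rewrite -ends|]; exact: proj_cvg.
- by apply: (uniq (fun n => D 1 n pi)); [rewrite -ends|]; exact: proj_cvg1.
- by apply: (uniq (fun n => D 2 n pi)); [rewrite -ends|]; exact: proj_cvg2.
Qed.

End Smooth.
End Regularity.

(** * Sobolev bounds and derivatives of integrals in time *)


Section Solution.
Context {R : realType}.
Implicit Types (f g : R -> R) (N n : nat).

Lemma is_derive_cvg (F : R -> R) (a l : R) :
  h^-1 * (F (h + a) - F a) @[h --> 0^'] --> l -> is_derive a 1 F l.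
Proof.
move=> H; have E : (fun h : R => h^-1 *: ((F \o shift a) (h *: 1) - F a)) =
    fun h => h^-1 * (F (h + a) - F a).
  by apply/funext => h; rewrite /= /GRing.scale /= mulr1.
apply: DeriveDef.
  by rewrite /derivable E; apply/cvg_ex; exists l.
by rewrite /derive E; apply/cvg_lim.
Qed.

(** At an interior point a small increment stays in the interval, so the relative
    derivative is the ordinary one. *)
Lemma is_derive_on_interior (T : R) (F : R -> R) (t l : R) : 0 < t < T ->
  is_derive_on `[0, T] F t l -> is_derive t 1 F l.
Proof.
move=> /andP[t0 tT] H; apply: is_derive_cvg.
apply: cvg_trans H.
have -> : (fun h => h^-1 * (F (h + t) - F t)) = (fun h => h^-1 * (F (t + h) - F t)).
  by apply/funext => h; rewrite [h + t]addrC.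
apply: cvg_app; rewrite /within => A /= HA.
have nbt : \forall h \near 0^', `[0, T]%classic (t + h).
  have d0 : 0 < Num.min t (T - t) by rewrite lt_min t0 subr_gt0.
  apply/nbhs_ballP; exists (Num.min t (T - t)) => //= h.
  rewrite /ball /= sub0r normrN lt_min => /andP[h1 h2] _.
  rewrite in_itv /=; move: h1 h2; rewrite !ltr_norml => /andP[? ?] /andP[? ?].
  by apply/andP; split; lra.
have HA' : \forall h \near 0^', t + h \in `[0, T] -> A h by exact: HA.
have : \forall h \near 0^', A h by near=> h; have := near HA' h; apply => //; near: h.
exact.
Unshelve. all: by end_near.
Qed.

Lemma integ_cvg (g : nat -> R -> R) (f : R -> R) (B : R) :
  (forall n, continuous (g n)) -> continuous f -> (forall n x, `|g n x| <= B) ->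
  (forall x, g ^~ x @ \oo --> f x) ->
  (fun n => integ (g n)) @ \oo --> integ f.
Proof.
move=> cg cf gB gf.
have m0 := @measurable_circle R.
have mf (h : R -> R) (ch : continuous h) :=
  measurable_int lebesgue_measure (integrable_circle ch).
have c x : (fun n => (g n x)%:E) @ \oo --> (f x)%:E.
  by apply: cvg_EFin; [exact: nearW | exact: gf].
have [|||||_ _ H] := @dominated_convergence _ _ R lebesgue_measure circle m0
  (fun n => EFin \o g n) (EFin \o f) (EFin \o cst B).
- by move=> n; exact: mf.
- exact: mf.
- by apply: aeW => x _; exact: c.
- by apply: integrable_circle; exact: continuous_const.
- by apply: aeW => x n _; rewrite /= lee_fin; exact: gB.
rewrite integ.unlock; apply: fine_cvg.
rewrite fineK; first exact: H.
by apply: integrable_fin_num => //; exact: integrable_circle.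
Qed.

(** Truncation of the square of [Hnorm mu g], real-valued so that it can be
    manipulated without finiteness conditions. *)
Definition sobolev_sum (mu : R) N g : R :=
  \sum_(k <- freqs N) (1 + k%:~R ^+ 2) `^ mu * fourier_mod g k ^+ 2.

Lemma sobolev_sum_le_Hnorm (mu a : R) N g : 0 <= a -> (Hnorm mu g <= a%:E)%E ->
  sobolev_sum mu N g <= a ^+ 2.
Proof.
move=> a0; rewrite /Hnorm.
have -> : a%:E = sqrte (a ^+ 2)%:E by rewrite /= sqrtr_sqr ger0_norm.
rewrite lee_sqrt ?lee_fin ?sqr_ge0// => H.
rewrite -lee_fin; apply: le_trans H; apply: esum_ge.
exists [set` freqs N]; first by split => //; exact: finite_seq.
rewrite -fsbig_seq ?freqs_uniq// /sobolev_sum -sumEFin.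
by apply: lee_sum => k _; rewrite lee_fin sqmod_fourier_mod.
Qed.

Lemma sobolev_sumD mu N f g : continuous f -> continuous g ->
  sobolev_sum mu N (fun x => f x + g x) <= 2 * sobolev_sum mu N f + 2 * sobolev_sum mu N g.
Proof.
move=> cf cg; rewrite /sobolev_sum !mulr_sumr -big_split /=; apply: ler_sum => k _.
rewrite !(mulrCA 2) -mulrDr ler_wpM2l ?powR_ge0//.
have := fourier_modD k cf cg; have := fourier_mod_ge0 (fun x => f x + g x) k.
have := fourier_mod_ge0 f k; have := fourier_mod_ge0 g k.
move: (fourier_mod _ k) (fourier_mod f k) (fourier_mod g k) => a c d *.
have : a ^+ 2 <= (c + d) ^+ 2 by rewrite ler_sqr ?nnegrE ?addr_ge0.
by have := sqr_ge0 (c - d); nra.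
Qed.

Lemma sobolev_sum_term mu N g k : k \in freqs N ->
  (1 + k%:~R ^+ 2) `^ mu * fourier_mod g k ^+ 2 <= sobolev_sum mu N g.
Proof.
move=> kN; rewrite /sobolev_sum (bigD1_seq k kN (freqs_uniq N)) /= lerDl.
by apply: sumr_ge0 => j _; rewrite mulr_ge0 ?powR_ge0 ?sqr_ge0.
Qed.

(** One term of the sum is at most the sum. *)
Lemma sobolev_decay mu g (K : R) (k : int) : 6 <= mu -> 0 <= K ->
  (forall N, sobolev_sum mu N g <= K ^+ 2) -> fourier_mod g k <= K / (1 + k%:~R ^+ 2) ^+ 3.
Proof.
move=> mu6 K0 hK; have kN : k \in freqs `|k|%N by rewrite mem_freqs; lia.
have h := le_trans (sobolev_sum_term mu g kN) (hK _).
have q1 : 1 <= 1 + (k%:~R : R) ^+ 2 by rewrite lerDl sqr_ge0.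
have q0 : 0 < 1 + (k%:~R : R) ^+ 2 by exact: lt_le_trans q1.
rewrite ler_pdivlMr ?exprn_gt0//.
rewrite -ler_sqr ?nnegrE ?mulr_ge0 ?fourier_mod_ge0 ?exprn_ge0 ?(ltW q0)//.
apply: le_trans h; rewrite exprMn mulrC ler_wpM2r ?sqr_ge0//.
by rewrite -exprM -powR_mulrn ?(ltW q0)// ler_powR.
Qed.

(** On the frequencies between [N] and [M] the weight is at least [N^(2 mu)]. *)
Lemma sobolev_tail mu g (K : R) N M : 0 <= mu -> (0 < N)%N -> (N <= M)%N -> continuous g ->
  sobolev_sum mu M g <= K ^+ 2 ->
  nrm (fun x => proj M g x - proj N g x) ^+ 2 <= 2 * pi * (K * N%:R `^ (- mu)) ^+ 2.
Proof.
move=> mu0 N0 NM cg hK.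
have hM := proj_in_S M g; have hN := in_SW NM (proj_in_S N g).
rewrite (parseval (in_SB hM hN)) ler_pM2l ?mulr_gt0 ?pi_gt0//.
have Np : 0 < N%:R :> R by rewrite ltr0n.
have Nm : 0 < N%:R `^ (- mu) :> R by rewrite powR_gt0.
rewrite exprMn; apply: le_trans (ler_wpM2r (sqr_ge0 _) hK).
rewrite /sobolev_sum mulr_suml big_seq [leRHS]big_seq; apply: ler_sum => k kM.
have w0 : 0 <= (1 + (k%:~R : R) ^+ 2) `^ mu by exact: powR_ge0.
have cM := in_S_continuous hM; have cN := in_S_continuous hN.
have fB : fourier_mod (fun x => proj M g x - proj N g x) k =
    if k \in freqs N then 0 else fourier_mod g k.
  have dc : fcos (fun x => proj M g x - proj N g x) k = fcos (proj M g) k - fcos (proj N g) k.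
    rewrite -[- fcos _ _]mulN1r -(fcosZ _ _ cN) -fcosD//; last by cont.
    by congr fcos; apply/funext => x; rewrite mulN1r.
  have ds : fsin (fun x => proj M g x - proj N g x) k = fsin (proj M g) k - fsin (proj N g) k.
    rewrite -[- fsin _ _]mulN1r -(fsinZ _ _ cN) -fsinD//; last by cont.
    by congr fsin; apply/funext => x; rewrite mulN1r.
  rewrite /fourier_mod dc ds !fcos_proj// !fsin_proj// kM.
  by case: ifP => _; rewrite ?subrr ?subr0// expr0n /= addr0 sqrtr0.
rewrite fB; case: ifPn => kN.
  by rewrite expr0n /= mulr_ge0 ?sqr_ge0// mulr_ge0 ?sqr_ge0.
rewrite mulrAC ler_peMl ?sqr_ge0//.
have Nk : N%:R <= `|k%:~R| :> R.
  rewrite -intr_norm -[N%:R]/((N%:Z)%:~R) ler_int.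
  by move: kN; rewrite mem_freqs; lia.
have -> : (N%:R `^ (- mu)) ^+ 2 = (N%:R ^+ 2) `^ (- mu) :> R.
  by rewrite -!powR_mulrn ?powR_ge0// -!powRrM mulrC.
rewrite powRN -ler_pdivrMr ?invr_gt0 ?powR_gt0 ?exprn_gt0// mul1r invrK.
apply: ge0_ler_powR; rewrite ?nnegrE ?addr_ge0 ?sqr_ge0//.
apply: (@le_trans _ _ (`|k%:~R| ^+ 2)); first by rewrite ler_sqr ?nnegrE.
by rewrite real_normK ?num_real// lerDr.
Qed.

(** [sobolev_tail] for [M] tending to infinity: the partial sums converge
    pointwise and boundedly. *)
Lemma tail_bound mu g (K : R) N g' : 0 <= mu -> (0 < N)%N -> 0 <= K -> derives g g' ->
  periodic g (2 * pi) -> (forall M, sobolev_sum mu M g <= K ^+ 2) ->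
  (forall M x, `|proj M g x| <= 5 * K) ->
  nrm (fun x => g x - proj N g x) <= Num.sqrt (2 * pi) * (K * N%:R `^ (- mu)).
Proof.
move=> mu0 N0 K0 dg pg hK bnd; have cg := derives_continuous dg.
have cP M : continuous (proj M g) by exact: in_S_continuous (proj_in_S M g).
have E0 : 0 <= K * N%:R `^ (- mu) by rewrite mulr_ge0 ?powR_ge0.
rewrite -ler_sqr ?nnegrE ?nrm_ge0 ?mulr_ge0 ?sqrtr_ge0//.
rewrite exprMn [Num.sqrt (2 * pi) ^+ 2]sqr_sqrtr ?mulr_ge0 ?pi_ge0//.
have cN := cP N.
have lim : (fun n => integ (fun x => (proj (n + N)%N g x - proj N g x) ^+ 2)) @ \oo -->
    integ (fun x => (g x - proj N g x) ^+ 2).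
  apply: (@integ_cvg _ _ ((10 * K) ^+ 2)) => [n||n x|x].
  - by have cn := cP (n + N)%N; cont.
  - by cont.
  - rewrite normrX ler_sqr ?nnegrE ?mulr_ge0//.
    by apply: le_trans (ler_normB _ _) _; have := bnd (n + N)%N x; have := bnd N x; lra.
  - have h : (fun n => proj (n + N)%N g x - proj N g x) @ \oo --> g x - proj N g x.
      apply: cvgB; last exact: cvg_cst.
      by rewrite (cvg_shiftn N (fun n => proj n g x)); exact: fourier_pointwise dg pg.
    by apply: (cvg_comp _ _ h (@exprn_continuous _ 2 _)).
rewrite nrm_sqr; apply: (cvgr_to_le lim); apply: nearW => n.
by rewrite -nrm_sqr; apply: sobolev_tail; rewrite ?leq_addl.
Qed.

Lemma integ_time_derive (T B t : R) (u ut : R -> R -> R) (phi : R -> R) :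
  0 < t < T -> (forall r, 0 < r < T -> continuous (u r)) ->
  (forall r x, 0 < r < T -> is_derive r 1 (u ^~ x) (ut r x)) ->
  (forall r x, 0 < r < T -> `|ut r x| <= B) -> continuous phi ->
  is_derive t 1 (fun r => integ (fun x => phi x * u r x)) (integ (fun x => phi x * ut t x)).
Proof.
move=> tT cu du utB cphi; apply: is_derive_cvg.
have inI r : `]0, T[%classic r -> 0 < r < T by rewrite /= in_itv.
have dphi r x : 0 < r < T -> is_derive r 1 (fun r => phi x * u r x) (phi x * ut r x).
  by move=> rT; have := du r x rT => dd; exact: is_deriveZ.
have dE r x : 0 < r < T -> partial1of2 (fun r x => phi x * u r x) r x = phi x * ut r x.
  by move=> rT; rewrite partial1of2E; have [_ ->] := dphi r x rT.
have tI : `]0, T[%classic t by rewrite /= in_itv.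
have H := @cvg_differentiation_under_integral R _ _ lebesgue_measure
  (fun r x => phi x * u r x) circle (@measurable_circle R) t 0 T tI
  (fun r rI => integrable_circle (continuous_mul cphi (cu r (inI r rI))))
  (fun r x rI _ => let: DeriveDef d _ := dphi r x (inI r rI) in d)
  (fun x => `|phi x| * B).
have B0 : 0 <= B by apply: le_trans (utB t 0 tT); exact: normr_ge0.
have {}H := H (fun x => mulr_ge0 (normr_ge0 _) B0).
have cG : continuous (fun x => `|phi x| * B) by cont.
have {}H := H (integrable_circle cG).
have {}H : h^-1 *: (integ (fun x => phi x * u (h + t) x) - integ (fun x => phi x * u t x))
  @[h --> 0^'] --> integ (fun x => phi x * ut t x).
  have -> : integ (fun x => phi x * ut t x) =
     integ (partial1of2 (fun r x => phi x * u r x) t).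
    by apply: eq_integ => x; rewrite dE.
  rewrite integ.unlock; apply: H => r x rI _; rewrite dE ?inI// normrM.
  by rewrite ler_wpM2l// utB// inI.
exact: H.
Qed.

(** Continuity in time bounds the norm near each time; compactness of the interval
    makes the bound uniform.  The bounds range over the natural numbers, so
    that they can grow along the filter at infinity. *)
Lemma sobolev_sum_bounded_in_time (T mu : R) (u0 : R -> R) (u : R -> R -> R) : kdv_solution T mu u0 u ->
  exists K : R, 0 <= K /\ forall t N, t \in `[0, T] -> sobolev_sum mu N (u t) <= K ^+ 2.
Proof.
move=> [[_ uH] ucont _ usol].
have cu t : t \in `[0, T] -> continuous (u t).
  move=> tT; have /(derivesP) := fun x => (usol t x tT).1 0%N isT.
  exact: derives_continuous.
pose P (n : nat) (t : R) := forall N, sobolev_sum mu N (u t) <= n%:R ^+ 2.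
have /compact_near_coveringP /near_covering_withinP cov := @segment_compact R 0 T.
have [//|n0 _ hn0] := cov nat \oo P _ _.
  move=> t tT; have tI : t \in `[0, T] by [].
  have [_ _ _ Hfin] := uH t tI.
  have [a a0 Ha] : exists2 a : R, 0 <= a & (Hnorm mu (u t) <= a%:E)%E.
    have H0 : (0 <= Hnorm mu (u t))%E by exact: sqrte_ge0.
    exists (fine (Hnorm mu (u t))); first exact: fine_ge0.
    by rewrite fineK// ge0_fin_numE.
  have near1 : \forall r \near t, `[0, T]%classic r -> (Hnorm mu (u r \- u t)%R <= 1%:E)%E.
    have h1 : \forall r \near within `[0, T] (nbhs t),
        (Hnorm mu (u r \- u t)%R < 1%:E)%E.
      exact: (ucont t tI _ (open_ereal_lt' lte01)).
    have h2 : \forall r \near t, `[0, T]%classic r -> (Hnorm mu (u r \- u t)%R < 1%:E)%E.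
      exact: h1.
    near=> r => rT; apply: ltW; have := near h2 r; apply => //; near: r.
  have near2 : \forall n \near \oo, (2 + 2 * a ^+ 2 <= n%:R ^+ 2 :> R).
    near=> n.
    have n1 : 2 + 2 * a ^+ 2 <= n%:R :> R by near: n; exact: nbhs_infty_ger.
    have := sqr_ge0 a; nra.
  exists ([set r | `[0, T]%classic r -> (Hnorm mu (u r \- u t)%R <= 1%:E)%E],
          [set n : nat | (2 + 2 * a ^+ 2 <= n%:R ^+ 2 :> R)]) => //.
  move=> [r n] /= [hr hn] rT N; apply: le_trans hn.
  have rI : r \in `[0, T] by [].
  have h1 := @sobolev_sum_le_Hnorm mu 1 N _ ler01 (hr rT).
  have h2 := @sobolev_sum_le_Hnorm mu a N _ a0 Ha.
  have cd : continuous (u r \- u t) by have c1 := cu r rI; have c2 := cu t tI; exact: continuous_sub.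
  have -> : u r = fun x => (u r \- u t) x + u t x by apply/funext => x; rewrite /= subrK.
  apply: le_trans (sobolev_sumD mu N cd (cu t tI)) _.
  by rewrite expr1n in h1; lra.
exists n0%:R; split=> // t N tT; exact: (hn0 n0 (leqnn n0) t tT N).
Unshelve. all: by end_near. Qed.

End Solution.

(** * Exact quadrature and Gronwall's inequality *)


Section Quadrature.
Context {R : realType}.

(** Multiplied by [2 sin (t / 2)] the sums telescope, and the two ends agree since
    [L t] is a multiple of the period. *)
Lemma sum_cos_sin (L : nat) (t : R) (m : int) : L%:R * t = m%:~R * (2 * pi) ->
  sin (t / 2) != 0 ->
  \sum_(p < L) cos (p%:R * t) = 0 /\ \sum_(p < L) sin (p%:R * t) = 0.
Proof.
move=> Lt st.
have c2 : cos (m%:~R * (2 * pi)) = 1 :> R.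
  by have := periodic_int m 0 (fun x => @cosD2pi R x); rewrite add0r mulr_natl cos0.
have s2 : sin (m%:~R * (2 * pi)) = 0 :> R.
  by have := periodic_int m 0 (fun x => @sinD2pi R x); rewrite add0r mulr_natl sin0.
have st2 : 2 * sin (t / 2) != 0 by rewrite mulf_neq0// pnatr_eq0.
have half p : p.+1%:R * t - t / 2 = p%:R * t + t / 2 by rewrite -natr1; field.
split; apply: (mulfI st2); rewrite mulr0 mulr_sumr.
  rewrite (eq_bigr (fun p : 'I_L => sin (p.+1%:R * t - t / 2) - sin (p%:R * t - t / 2))).
    rewrite -(big_mkord xpredT (fun p => sin (p.+1%:R * t - t / 2) - sin (p%:R * t - t / 2))).
    by rewrite telescope_sumr// Lt mul0r sub0r sinB s2 c2 sinN; ring.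
  by move=> p _; rewrite half sinD sinB; ring.
rewrite (eq_bigr (fun p : 'I_L => - (cos (p.+1%:R * t - t / 2) - cos (p%:R * t - t / 2)))).
  rewrite sumrN -(big_mkord xpredT (fun p => cos (p.+1%:R * t - t / 2) - cos (p%:R * t - t / 2))).
  by rewrite telescope_sumr// Lt mul0r sub0r cosB s2 c2 cosN; ring.
by move=> p _; rewrite half cosD cosB; ring.
Qed.

(** With more than [M] equispaced nodes no nonzero frequency of [S_M] is aliased
    to 0. *)
Lemma quadrature (M L : nat) (g : R -> R) : (M < L)%N -> in_S M g ->
  integ g = (2 * pi) / L%:R * \sum_(p < L) g (p%:R * (2 * pi / L%:R)).
Proof.
move=> ML hg.
have L0 : L%:R != 0 :> R by rewrite pnatr_eq0; lia.
suff [] : continuous g /\ integ g = (2 * pi) / L%:R * \sum_(p < L) g (p%:R * (2 * pi / L%:R)) by [].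
have trig k : k \in freqs M -> k != 0 ->
    \sum_(p < L) cos (k%:~R * (p%:R * (2 * pi / L%:R))) = 0 :> R /\
    \sum_(p < L) sin (k%:~R * (p%:R * (2 * pi / L%:R))) = 0 :> R.
  rewrite mem_freqs => kM k0.
  pose t : R := k%:~R * (2 * pi / L%:R).
  have Lt : L%:R * t = k%:~R * (2 * pi) by rewrite /t; field.
  have st : sin (t / 2) != 0.
    apply/eqP => /sin_eq0_int[m].
    have -> : t / 2 = k%:~R / L%:R * pi by rewrite /t; field.
    move=> /(mulIf pi_neq0) /(congr1 (fun z => z * L%:R)); rewrite divfK//.
    rewrite -[L%:R]/((L%:Z)%:~R) -intrM => /eqP; rewrite eqr_int => /eqP km.
    move: kM k0; rewrite km => kM k0.
    have m0 : m != 0 by apply: contraNneq k0 => ->; rewrite mul0r.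
    move: kM; rewrite normrM; have : (1 <= `|m|)%R by rewrite -gtz0_ge1 normr_gt0.
    by move: (`|m|) => a a1; have -> : `|L%:Z| = L%:Z by []; nia.
  have [h1 h2] := sum_cos_sin Lt st.
  by split; [rewrite -[RHS]h1|rewrite -[RHS]h2]; apply: eq_bigr => p _; rewrite /t mulrCA.
move: g hg; apply: (@in_S_ind _ M (fun g => continuous g /\
   integ g = (2 * pi) / L%:R * \sum_(p < L) g (p%:R * (2 * pi / L%:R))))
  => [|f g [cf hf] [cg hg]|a f [cf hf]|k kM|k kM].
- by split; [exact: continuous_const | rewrite integ_cst mul0r big1 ?mulr0].
- by split; [cont | rewrite integD// hf hg -mulrDr -big_split].
- by split; [cont | rewrite integZ// hf mulrCA -mulr_sumr].
- split; first exact: continuous_cos_k.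
  rewrite integ_cos; have [->|k0] := eqVneq k 0.
    rewrite (eq_bigr (fun=> 1)); last by move=> p _; rewrite mul0r cos0.
    by rewrite sumr_const card_ord mulr1 divfK.
  by rewrite (trig k kM k0).1 !mulr0.
- split; first exact: continuous_sin_k.
  rewrite integ_sin; have [->|k0] := eqVneq k 0.
    by rewrite big1 ?mulr0// => p _; rewrite mul0r sin0.
  by rewrite (trig k kM k0).2 !mulr0.
Qed.

(** The square of the norm on [S_N] ([node_sqnormE]) as a finite sum of point
    values, hence differentiable in time as soon as the function is so at each
    point. *)
Definition node_sqnorm N (e : R -> R) : R :=
  (2 * pi) / (N + N).+1%:R * \sum_(p < (N + N).+1) e (p%:R * (2 * pi / (N + N).+1%:R)) ^+ 2.

Lemma node_sqnormE N (e : R -> R) : in_S N e -> node_sqnorm N e = nrm e ^+ 2.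
Proof.
move=> he; rewrite nrm_sqr (@quadrature (N + N) (N + N).+1)//.
by apply: in_S_ext (in_SM he he) => x; rewrite expr2.
Qed.

(** Quadrature turns the derivative of the finite sum back into an integral. *)
Lemma is_derive_node_sqnorm N (e : R -> R -> R) (et : R -> R) (t : R) :
  in_S N (e t) -> in_S N et -> (forall x, is_derive t 1 (e ^~ x) (et x)) ->
  is_derive t 1 (fun r => node_sqnorm N (e r)) (2 * integ (fun x => e t x * et x)).
Proof.
move=> he het de; rewrite (@quadrature (N + N) (N + N).+1)//; last exact: in_SM.
rewrite mulrCA mulr_sumr.
set h : R := 2 * pi / (N + N).+1%:R.
have H (p : nat) : is_derive t 1 (fun r => e r (p%:R * h) ^+ 2)
    (2 * (e t (p%:R * h) * et (p%:R * h))).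
  have dp := de (p%:R * h).
  have E : 2 * (e t (p%:R * h) * et (p%:R * h)) =
     e t (p%:R * h) *: et (p%:R * h) + e t (p%:R * h) *: et (p%:R * h).
    by rewrite /GRing.scale /=; ring.
  rewrite E (_ : (fun r => e r (p%:R * h) ^+ 2) = (e ^~ (p%:R * h)) * (e ^~ (p%:R * h))).
    exact: is_deriveM.
  by apply/funext => r; rewrite expr2.
have := is_derive_sum_seq (index_enum 'I_(N + N).+1) (fun p => H p) => {}H.
exact: is_deriveZ.
Qed.

(** [E exp (- c t) - d t] is nonincreasing. *)
Lemma gronwall (E dE : R -> R) (T c d : R) : 0 <= c -> 0 <= d -> 
  (forall t, 0 < t < T -> is_derive t 1 E (dE t)) ->
  (forall t, 0 < t < T -> dE t <= c * E t + d) ->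
  {within `[0, T], continuous E} -> E 0 = 0 ->
  forall t, 0 <= t <= T -> E t <= d * T * expR (c * T).
Proof.
move=> c0 d0 derE dEle cE E0 t /andP[t0 tT].
pose F r := E r * expR (- c * r) - d * r.
have dexp (r : R) : is_derive r 1 (fun r => expR (- c * r)) (- c * expR (- c * r)).
  have dl := derives_lin (- c) r.
  by rewrite mulrC; exact: (is_derive1_comp (f := expR) (g := fun y => - c * y)).
have dF r : 0 < r < T -> is_derive r 1 F (dE r * expR (- c * r) - c * E r * expR (- c * r) - d).
  move=> rT; have d1 := derE r rT; have d2 := dexp r.
  have d3 : is_derive r 1 (fun r => d * r) d by exact: derives_lin.
  have d4 : is_derive r 1 (fun r => E r * expR (- c * r))
      (dE r * expR (- c * r) - c * E r * expR (- c * r)).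
    have -> : dE r * expR (- c * r) - c * E r * expR (- c * r) =
      E r *: (- c * expR (- c * r)) + expR (- c * r) *: dE r.
      by rewrite /GRing.scale /=; ring.
    exact: is_deriveM.
  exact: is_deriveB.
have cF : {within `[0, T], continuous F}.
  have cexp : continuous (fun r : R => expR (- c * r)).
    exact: derives_continuous dexp.
  have clin : continuous (fun r : R => d * r) by exact: derives_continuous (derives_lin d).
  move=> r; apply: cvgB; last exact: (continuous_subspaceT clin).
  by apply: cvgM; [exact: cE | exact: (continuous_subspaceT cexp)].
have Fdec := @ler0_derive1_le_cc R F 0 T _ _ cF t 0.
have {Fdec}: F t <= F 0.
  apply: Fdec => //.
  - by move=> r; rewrite in_itv /= => rT; have [] := dF r rT.
  - move=> r; rewrite in_itv /= => rT; rewrite derive1E; have [_ ->] := dF r rT.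
    have h := dEle r rT; have ex := expR_gt0 (- c * r).
    have : expR (- c * r) <= 1.
      rewrite -expR0 ler_expR mulNr oppr_le0 mulr_ge0//.
      by move: rT => /andP[/ltW].
    move: h ex; move: (expR _) (E r) (dE r) => x y z h ex ex1.
    have : z * x <= (c * y + d) * x by rewrite ler_wpM2r// ltW.
    have : d * x <= d by rewrite ler_piMr.
    by rewrite mulrDl; lra.
  - by rewrite in_itv /= t0 tT.
  - by rewrite in_itv /= lexx (le_trans t0 tT).
rewrite /F E0 mul0r mulr0 subrr subr_le0 => h.
have e1 : expR (- c * t) * expR (c * t) = 1 by rewrite -expRD mulNr addNr expR0.
have ep := expR_gt0 (c * t).
have -> : E t = E t * expR (- c * t) * expR (c * t) by rewrite -mulrA e1 mulr1.
apply: (@le_trans _ _ (d * t * expR (c * t))); first by rewrite ler_wpM2r// ltW.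
apply: ler_pM; rewrite ?mulr_ge0 ?(ltW ep)//; first by rewrite ler_wpM2l.
by rewrite ler_expR ler_wpM2l.
Qed.

Lemma is_derive_on_continuous (T : R) (F : R -> R) (t l : R) :
  is_derive_on `[0, T] F t l -> F r @[r --> within `[0, T] (nbhs t)] --> F t.
Proof.
move=> H; apply/cvgrPdist_le => e e0.
have /cvgrPdist_le /(_ _ ltr01) := H.
rewrite near_withinE => /nbhs_ballP[d /= d0 hd].
pose K := `|l| + 1; have K0 : 0 < K by rewrite ltr_wpDl.
rewrite near_withinE; apply/nbhs_ballP; exists (Num.min d (e / K)) => /=.
  by rewrite lt_min d0 divr_gt0.
move=> r; rewrite /ball /= lt_min => /andP[h1 h2] rT.
have [->|rt] := eqVneq r t; first by rewrite subrr normr0 ltW.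
have hh : r - t != 0 by rewrite subr_eq0.
have := hd (r - t); rewrite /ball /= sub0r normrN distrC h1 => /(_ isT hh).
rewrite [t + _]addrC subrK => /(_ rT) q.
have q2 : `|(r - t)^-1 * (F r - F t)| <= K.
  have -> : (r - t)^-1 * (F r - F t) = l - (l - (r - t)^-1 * (F r - F t)) by ring.
  by apply: le_trans (ler_normB _ _) _; rewrite lerD2l.
rewrite distrC.
have -> : F r - F t = (r - t)^-1 * (F r - F t) * (r - t) by rewrite mulrAC mulVf// mul1r.
rewrite normrM; apply: le_trans (ler_wpM2r (normr_ge0 _) q2) _.
by move: h2; rewrite distrC ltr_pdivlMr// mulrC => /ltW.
Qed.

End Quadrature.

(** * Energy estimate for the Galerkin error *)


Section Static.
Context {R : realType}.

Lemma nrm_le (a c : R -> R) (C : R) : 0 <= C -> continuous a -> continuous c ->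
  (forall x, `|a x| <= C * `|c x|) -> nrm a <= C * nrm c.
Proof.
move=> C0 ca cc ac; rewrite -ler_sqr ?nnegrE ?mulr_ge0 ?nrm_ge0// exprMn !nrm_sqr.
rewrite -integZ; last by cont.
apply: le_integ => [||x]; do ?by cont.
rewrite -[a x ^+ 2]real_normK ?num_real// -[c x ^+ 2]real_normK ?num_real// -exprMn.
by rewrite ler_sqr ?nnegrE ?mulr_ge0.
Qed.

(** All derivatives are moved onto the test function, which lies in [S_N]. *)
Lemma kdvF_weak N (w e e1 e2 e3 : R -> R) : in_S N w -> in_S N e ->
  derives e e1 -> derives e1 e2 -> derives e2 e3 ->
  integ (fun x => kdvF N w x * e x) =
  integ (fun x => w x * e3 x) + integ (fun x => w x ^+ 2 / 2 * e1 x).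
Proof.
move=> hw he de1 de2 de3.
have third := integ_third hw he.
have byp := in_S_by_parts (in_S_half_sqr hw) he.
have e3E : derive1n 3 e = e3.
  by rewrite /derive1n /= (derivesE de1) (derivesE de2) (derivesE de3).
rewrite e3E in third; rewrite (derivesE de1) in byp.
have hw3 := in_S_derive1n 3 hw.
have hq := in_S_derive1 (in_S_half_sqr hw).
have adj := proj_adj (in_S_continuous hq) he.
have split_F : integ (fun x => kdvF N w x * e x) =
   - integ (fun x => derive1n 3 w x * e x) -
   integ (fun x => proj N (derive1 (fun y => w y ^+ 2 / 2)) x * e x).
  have ce := in_S_continuous he; have cw3 := in_S_continuous hw3.
  have cp := in_S_continuous (proj_in_S N (derive1 (fun y => w y ^+ 2 / 2))).
  rewrite -integN; last exact: continuous_mul cw3 ce.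
  rewrite -integB; [|exact: continuous_opp (continuous_mul cw3 ce)|exact: continuous_mul cp ce].
  by apply: eq_integ => x; rewrite /kdvF mulrBl mulNr.
rewrite split_F adj third byp; move: (integ _) (integ _) => A C; ring.
Qed.

(** Add and subtract [F(w)].  The part [F(w + e) - F(w)] is [kdvF_energy].  In
    [F(w) - P_N f_t], tested with [e], the linear terms cancel because [w] is the
    projection of [f]; there remains the integral of [(w^2 - f^2)/2 * e_x], where
    the derivative of [e] costs a factor [N]. *)
Lemma energy_rate_gen N (f f1 f2 f3 w e : R -> R) (B : R) :
  derives f f1 -> derives f1 f2 -> derives f2 f3 -> continuous f3 ->
  f (- pi) = f pi -> f1 (- pi) = f1 pi -> f2 (- pi) = f2 pi ->
  (forall x, `|f x| <= B) -> (forall x, `|w x| <= B) ->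
  (forall x, `|derive1 w x| <= B) -> in_S N w -> in_S N e ->
  (forall e, in_S N e -> integ (fun x => w x * e x) = integ (fun x => f x * e x)) ->
  2 * integ (fun x => e x *
       (kdvF N (fun y => w y + e y) x - proj N (fun y => - (f y * f1 y) - f3 y) x)) <=
  B * nrm e ^+ 2 + 2 * (B * N%:R * nrm (fun x => f x - w x)) * nrm e.
Proof.
move=> df df1 df2 cf3 pf pf1 pf2 fB wB w1B hw he adj.
have B0 : 0 <= B by apply: le_trans (fB 0); exact: normr_ge0.
have cf := derives_continuous df; have cf1 := derives_continuous df1.
have cf2 := derives_continuous df2.
have cw := in_S_continuous hw.
have [e1 he1 de1] := in_S_derives he; have [e2 he2 de2] := in_S_derives he1.
have [e3 he3 de3] := in_S_derives he2.
have ce := in_S_continuous he; have ce1 := in_S_continuous he1.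
have ce2 := in_S_continuous he2; have ce3 := in_S_continuous he3.
have en := kdvF_energy hw he; have weak := kdvF_weak hw he de1 de2 de3.
have bern := bernstein he; rewrite (derivesE de1) in bern.
pose g y := - (f y * f1 y) - f3 y.
have cg : continuous g by rewrite /g; cont.
have gadj := proj_adj cg he.
have cFwe := in_S_continuous (kdvF_in_S (in_SD hw he)).
have cFw := in_S_continuous (kdvF_in_S hw).
have cpg := in_S_continuous (proj_in_S N g).
have hw1 := in_S_derive1 hw; have cw1 := in_S_continuous hw1.
rewrite -/g.
have split_I : integ (fun x => e x * (kdvF N (fun x => w x + e x) x - proj N g x)) =
   integ (fun x => (kdvF N (fun x => w x + e x) x - kdvF N w x) * e x) +
   integ (fun x => kdvF N w x * e x) - integ (fun x => proj N g x * e x).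
  move: (kdvF N (fun x => w x + e x)) (kdvF N w) (proj N g) cFwe cFw cpg => a b c ca cb cc.
  rewrite -integD; do ?by cont.
  by rewrite -integB; do ?(by cont); apply: eq_integ => x; ring.
have tot := etrans split_I (f_equal2 (fun p q => p - q) (f_equal2 +%R en weak) gadj).
refine (eq_ind_r (fun z => 2 * z <= _) _ tot); clear tot split_I en weak gadj.
move: (derive1 w) w1B cw1 => w1 w1B cw1.
have p3 : integ (fun x => f3 x * e x) = - integ (fun x => f x * e3 x).
  have q1 := integ_by_parts df2 de1 cf3 ce1 pf2 (in_S_endpoints he).
  have q2 := integ_by_parts df1 de2 cf2 ce2 pf1 (in_S_endpoints he1).
  have q3 := integ_by_parts df de3 cf1 ce3 pf (in_S_endpoints he2).
  by rewrite q1 q2 q3 opprK.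
have p1 : integ (fun x => f x * f1 x * e x) = - integ (fun x => f x ^+ 2 / 2 * e1 x).
  have dq : derives (fun x => f x ^+ 2 / 2) (fun x => f x * f1 x).
    apply: derives_ext (derivesZ 2^-1 (derivesM df df)) => x.
      by rewrite expr2 mulrC.
    by field.
  apply: (integ_by_parts dq de1); [by cont | by cont | by rewrite pf |].
  exact: in_S_endpoints he.
have ge : integ (fun x => g x * e x) =
   integ (fun x => f x ^+ 2 / 2 * e1 x) + integ (fun x => f x * e3 x).
  rewrite (@eq_integ _ _ (fun x => (- (f x * f1 x * e x)) - f3 x * e x)); last first.
    by move=> x; rewrite /g; ring.
  rewrite integB ?integN; do ?by cont.
  by rewrite p1 p3 !opprK.
rewrite ge (adj e3 he3).
have cw2 : continuous (fun x => w x ^+ 2 / 2).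
  by apply: continuous_mul; [cont | exact: continuous_const].
have cf22 : continuous (fun x => f x ^+ 2 / 2).
  by apply: continuous_mul; [cont | exact: continuous_const].
have diff : integ (fun x => w x ^+ 2 / 2 * e1 x) - integ (fun x => f x ^+ 2 / 2 * e1 x) =
   integ (fun x => (w x ^+ 2 / 2 - f x ^+ 2 / 2) * e1 x).
  rewrite -integB; [|exact: continuous_mul|exact: continuous_mul].
  by apply: eq_integ => x; rewrite mulrBl.
have cd : continuous (fun x => w x ^+ 2 / 2 - f x ^+ 2 / 2) by exact: continuous_sub.
have cfw : continuous (fun x => f x - w x) by cont.
have bd1 : nrm (fun x => w x ^+ 2 / 2 - f x ^+ 2 / 2) <= B * nrm (fun x => f x - w x).
  apply: nrm_le => // x.
  have -> : w x ^+ 2 / 2 - f x ^+ 2 / 2 = (w x + f x) / 2 * (w x - f x) by field.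
  rewrite normrM [`|w x - f x|]distrC ler_wpM2r//.
  rewrite normrM [`|2^-1|]ger0_norm// ler_pdivrMr//.
  by apply: le_trans (ler_normD _ _) _; have := wB x; have := fB x; lra.
have bd2 := le_trans (ler_norm _) (le_integ_nrm cd ce1).
have bd3 : `|integ (fun x => w1 x * e x ^+ 2)| <= B * nrm e ^+ 2.
  apply: le_trans (le_norm_integ _) _; first by cont.
  rewrite nrm_sqr -integZ; last by cont.
  apply: le_integ => [||x]; do ?by cont.
  by rewrite normrM [`|e x ^+ 2|]ger0_norm ?sqr_ge0// ler_wpM2r ?sqr_ge0.
have bd4 : nrm (fun x => w x ^+ 2 / 2 - f x ^+ 2 / 2) * nrm e1 <=
    (B * nrm (fun x => f x - w x)) * (N%:R * nrm e).
  by apply: ler_pM; rewrite ?nrm_ge0.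
have := le_trans bd2 bd4; rewrite -diff.
move: bd3; rewrite ler_norml => /andP[bd3 _].
move: bd3; move: (integ (fun x => w x ^+ 2 / 2 * e1 x)) (integ (fun x => f x ^+ 2 / 2 * e1 x))
  (integ (fun x => f x * e3 x)) (integ (fun x => w1 x * e x ^+ 2)) => I1 I2 I3 I4.
move: (nrm (fun x => f x - w x)) (nrm e) => n1 n2 h1 h2.
have -> : 2 * (B * N%:R * n1) * n2 = 2 * (B * n1 * (N%:R * n2)) by ring.
move: h1 h2; move: (B * n1 * _) (B * n2 ^+ 2) => X Y; lra.
Qed.

Lemma energy_rate N (f f1 f2 f3 v : R -> R) (B : R) :
  derives f f1 -> derives f1 f2 -> derives f2 f3 -> continuous f3 ->
  f (- pi) = f pi -> f1 (- pi) = f1 pi -> f2 (- pi) = f2 pi ->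
  (forall x, `|f x| <= B) -> (forall x, `|proj N f x| <= B) ->
  (forall x, `|derive1 (proj N f) x| <= B) -> in_S N v ->
  2 * integ (fun x => (v x - proj N f x) *
       (kdvF N v x - proj N (fun y => - (f y * f1 y) - f3 y) x)) <=
  B * nrm (fun x => v x - proj N f x) ^+ 2 +
  2 * (B * N%:R * nrm (fun x => f x - proj N f x)) * nrm (fun x => v x - proj N f x).
Proof.
move=> df df1 df2 cf3 pf pf1 pf2 fB wB w1B hv.
have hw := proj_in_S N f; have cf := derives_continuous df.
have main := energy_rate_gen df df1 df2 cf3 pf pf1 pf2 fB wB w1B hw (in_SB hv hw)
  (fun e he => proj_adj cf he).
have ev : (fun y => proj N f y + (v y - proj N f y)) = v.
  by apply/funext => x; rewrite addrC subrK.
by rewrite ev in main.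
Qed.

End Static.

(** * Error of the semidiscrete approximation *)


Section Semidiscrete.
Context {R : realType}.

Lemma cvg_sum_seq (I : Type) (s : seq I) (F : I -> R -> R) (l : I -> R)
    (G : set_system R) : Filter G ->
  (forall i, F i r @[r --> G] --> l i) ->
  (\sum_(i <- s) F i r) @[r --> G] --> \sum_(i <- s) l i.
Proof.
move=> FG H; elim: s => [|i s ih].
  rewrite big_nil (_ : (fun r => _) = fun=> 0); last by apply/funext => r; rewrite big_nil.
  exact: cvg_cst.
rewrite big_cons (_ : (fun r => \sum_(j <- i :: s) F j r) =
   fun r => F i r + \sum_(j <- s) F j r); last by apply/funext => r; rewrite big_cons.
by apply: cvgD.
Qed.

Section Error.
Variables (T mu : R) (u0 : R -> R) (u : R -> R -> R) (K : R).
Hypothesis T0 : 0 < T.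
Hypothesis mu6 : 6 <= mu.
Hypothesis sol : kdv_solution T mu u0 u.
Hypothesis K0 : 0 <= K.
Hypothesis hK : forall t N, t \in `[0, T] -> sobolev_sum mu N (u t) <= K ^+ 2.

Let B := 5 * K.
Let B0 : 0 <= B. Proof. by rewrite mulr_ge0. Qed.
Let mu0 : 0 <= mu. Proof. exact: le_trans mu6. Qed.

Lemma sol_derives t : t \in `[0, T] -> [/\ derives (u t) (derive1 (u t)),
  derives (derive1 (u t)) (derive1n 2 (u t)) &
  derives (derive1n 2 (u t)) (derive1n 3 (u t))].
Proof.
move=> tT; have [_ _ _ usol] := sol.
have H j : (j < 3)%N -> derives (derive1n j (u t)) (derive1n j.+1 (u t)).
  by move=> j3; apply: derivesP => x; have [h _] := usol t x tT; exact: h.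
by split; [exact: (H 0%N)|exact: (H 1%N)|exact: (H 2%N)].
Qed.

Lemma sol_periodic t : t \in `[0, T] -> periodic (u t) (2 * pi).
Proof. by move=> tT; have [[_ h] _ _ _] := sol; have [] := h t tT. Qed.

Lemma sol_decay t : t \in `[0, T] ->
  forall k : int, fourier_mod (u t) k <= K / (1 + k%:~R ^+ 2) ^+ 3.
Proof. by move=> tT k; apply: (sobolev_decay (mu := mu)) => // N; exact: hK. Qed.

Lemma sol_continuous t : t \in `[0, T] -> continuous (u t).
Proof. by move=> /sol_derives[d _ _]; exact: derives_continuous d. Qed.

(* The time derivative of [u] given by the equation. *)
Let ut t x := - (u t x * derive1 (u t) x) - derive1n 3 (u t) x.

Lemma sol_proj_bounds t N : t \in `[0, T] ->
  (forall x, `|proj N (u t) x| <= B) /\ (forall x, `|derive1 (proj N (u t)) x| <= B).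
Proof.
move=> tT; have [d1 d2 d3] := sol_derives tT; have dec := sol_decay tT.
have h := proj_derivative_bound d1 K0 dec.
by split => x; [exact: (h 0%N N x) | exact: (h 1%N N x)].
Qed.

Lemma sol_smooth t : t \in `[0, T] ->
  (forall x, [/\ `|u t x| <= B, `|derive1 (u t) x| <= B & `|derive1n 3 (u t) x| <= B]) /\
  continuous (derive1n 3 (u t)).
Proof.
move=> tT; have [d1 d2 d3] := sol_derives tT; have dec := sol_decay tT.
have pu := sol_periodic tT.
by split; [exact: (smooth_bound d1 d2 d3 pu K0 dec)
  | exact: (smooth_continuous3 d1 d2 d3 pu K0 dec)].
Qed.

Lemma sol_endpoints t : t \in `[0, T] ->
  [/\ u t (- pi) = u t pi, derive1 (u t) (- pi) = derive1 (u t) pi &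
      derive1n 2 (u t) (- pi) = derive1n 2 (u t) pi].
Proof.
move=> tT; have [d1 d2 d3] := sol_derives tT; have dec := sol_decay tT.
exact: (smooth_endpoints d1 d2 (sol_periodic tT) K0 dec).
Qed.

Let oo_cc t : 0 < t < T -> t \in `[0, T].
Proof. by move=> /andP[/ltW h1 /ltW h2]; rewrite in_itv /= h1 h2. Qed.

Lemma sol_time_derive t x : 0 < t < T -> is_derive t 1 (u ^~ x) (ut t x).
Proof.
move=> tT; have [_ _ _ usol] := sol; have [_ h] := usol t x (oo_cc tT).
exact: is_derive_on_interior tT h.
Qed.

(** The projection is a finite combination of integrals of [u], which are
    differentiated under the integral: the time derivative is bounded by
    [B * B + B], since [u], [u_x] and [u_xxx] are bounded by [B]. *)
Lemma proj_time_derive N t x : 0 < t < T ->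
  is_derive t 1 (fun r => proj N (u r) x) (proj N (ut t) x).
Proof.
move=> tT.
have coef (phi : R -> R) : continuous phi ->
    is_derive t 1 (fun r => integ (fun x => phi x * u r x)) (integ (fun x => phi x * ut t x)).
  apply: (@integ_time_derive _ T (B * B + B)) => // [r rT|r y rT|r y rT].
  - exact: sol_continuous (oo_cc rT).
  - exact: sol_time_derive.
  - have [h _] := sol_smooth (oo_cc rT); have [h0 h1 h3] := h y.
    apply: le_trans (ler_normB _ _) _; rewrite normrN normrM.
    by apply: lerD => //; apply: ler_pM.
rewrite projE (_ : (fun r => proj N (u r) x) = fun r => \sum_(k <- freqs N)
   (fcos (u r) k * cos (k%:~R * x) + fsin (u r) k * sin (k%:~R * x)));
  last by apply/funext => r; rewrite projE.
apply: is_derive_sum_seq => k.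
have hc := coef _ (@continuous_cos_k R k%:~R).
have hs := coef _ (@continuous_sin_k R k%:~R).
have dc : is_derive t 1 (fun r => fcos (u r) k * cos (k%:~R * x))
    (fcos (ut t) k * cos (k%:~R * x)).
  rewrite (_ : (fun r => _) = fun r => (cos (k%:~R * x) * (2 * pi)^-1) *
      integ (fun y => cos (k%:~R * y) * u r y)); last first.
    by apply/funext => r; rewrite /fcos mulrC mulrA.
  have -> : fcos (ut t) k * cos (k%:~R * x) = (cos (k%:~R * x) * (2 * pi)^-1) *
      integ (fun y => cos (k%:~R * y) * ut t y) by rewrite /fcos mulrC mulrA.
  exact: is_deriveZ.
have ds : is_derive t 1 (fun r => fsin (u r) k * sin (k%:~R * x))
    (fsin (ut t) k * sin (k%:~R * x)).
  rewrite (_ : (fun r => _) = fun r => (sin (k%:~R * x) * (2 * pi)^-1) *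
      integ (fun y => sin (k%:~R * y) * u r y)); last first.
    by apply/funext => r; rewrite /fsin mulrC mulrA.
  have -> : fsin (ut t) k * sin (k%:~R * x) = (sin (k%:~R * x) * (2 * pi)^-1) *
      integ (fun y => sin (k%:~R * y) * ut t y) by rewrite /fsin mulrC mulrA.
  exact: is_deriveZ.
exact: is_deriveD.
Qed.

(** One coefficient is dominated by the Sobolev norm, in which the solution is
    continuous by hypothesis. *)
Lemma fourier_mod_time_continuous k t (e : R) : t \in `[0, T] -> 0 < e ->
  \forall r \near within `[0, T] (nbhs t), fourier_mod (fun x => u t x - u r x) k <= e.
Proof.
move=> tT e0; have [_ ucont _ _] := sol.
have e0' : (0 < e%:E :> \bar R)%E by rewrite lte_fin.
have h : \forall r \near within `[0, T] (nbhs t), (Hnorm mu (u r \- u t)%R < e%:E)%E.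
  exact: (ucont t tT _ (open_ereal_lt' e0')).
have inT : \forall r \near within `[0, T] (nbhs t), `[0, T]%classic r.
  by rewrite near_withinE; apply: nearW => r.
near=> r.
have rT : r \in `[0, T] by have : `[0, T]%classic r by near: r.
have hr : (Hnorm mu (u r \- u t)%R < e%:E)%E by near: r.
have kN : k \in freqs `|k|%N by rewrite mem_freqs; lia.
have h1 := sobolev_sum_le_Hnorm `|k|%N (ltW e0) (ltW hr).
have h2 := le_trans (sobolev_sum_term mu (u r \- u t) kN) h1.
have -> : fourier_mod (fun x => u t x - u r x) k = fourier_mod (u r \- u t) k.
  have c1 : continuous (u r \- u t) by apply: continuous_sub; exact: sol_continuous.
  have -> : (fun x => u t x - u r x) = fun x => (-1) * (u r \- u t) x.
    by apply/funext => x; rewrite mulN1r /= opprB.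
  by rewrite fourier_modZ// normrN1 mul1r.
rewrite -ler_sqr ?nnegrE ?fourier_mod_ge0 ?(ltW e0)//; apply: le_trans h2.
rewrite ler_peMl ?sqr_ge0//.
have q1 : 1 <= 1 + (k%:~R : R) ^+ 2 by rewrite lerDl sqr_ge0.
by rewrite -[leLHS](powRr0 (1 + k%:~R ^+ 2)) ler_powR.
Unshelve. all: by end_near. Qed.

Lemma proj_time_continuous N t x : t \in `[0, T] ->
  proj N (u r) x @[r --> within `[0, T] (nbhs t)] --> proj N (u t) x.
Proof.
move=> tT.
have inT : \forall r \near within `[0, T] (nbhs t), `[0, T]%classic r.
  by rewrite near_withinE; apply: nearW => r.
have cc k : fcos (u r) k @[r --> within `[0, T] (nbhs t)] --> fcos (u t) k.
  apply/cvgrPdist_le => e e0; near=> r.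
  have rT : r \in `[0, T] by have : `[0, T]%classic r by near: r.
  have ct := sol_continuous tT; have cr := sol_continuous rT.
  have -> : fcos (u t) k - fcos (u r) k = fcos (fun x => u t x - u r x) k.
    rewrite -[- fcos _ _]mulN1r -(fcosZ _ _ cr) -fcosD//; last exact: continuous_scale.
    by congr fcos; apply/funext => y; rewrite mulN1r.
  apply: le_trans (fcos_le_fourier_mod _ _) _; near: r; exact: fourier_mod_time_continuous.
have cs k : fsin (u r) k @[r --> within `[0, T] (nbhs t)] --> fsin (u t) k.
  apply/cvgrPdist_le => e e0; near=> r.
  have rT : r \in `[0, T] by have : `[0, T]%classic r by near: r.
  have ct := sol_continuous tT; have cr := sol_continuous rT.
  have -> : fsin (u t) k - fsin (u r) k = fsin (fun x => u t x - u r x) k.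
    rewrite -[- fsin _ _]mulN1r -(fsinZ _ _ cr) -fsinD//; last exact: continuous_scale.
    by congr fsin; apply/funext => y; rewrite mulN1r.
  apply: le_trans (fsin_le_fourier_mod _ _) _; near: r; exact: fourier_mod_time_continuous.
rewrite projE (_ : (fun r => proj N (u r) x) = fun r => \sum_(k <- freqs N)
   (fcos (u r) k * cos (k%:~R * x) + fsin (u r) k * sin (k%:~R * x)));
  last by apply/funext => r; rewrite projE.
apply: cvg_sum_seq => k; apply: cvgD.
  by apply: cvgM; [exact: cc | exact: cvg_cst].
by apply: cvgM; [exact: cs | exact: cvg_cst].
Unshelve. all: by end_near. Qed.

Definition proj_gap := Num.sqrt (2 * pi) * K.
Definition energy_source := B * proj_gap.
Definition galerkin_const := energy_source * Num.sqrt (T * expR ((B + 1) * T)).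

Lemma sol_proj_gap N t : (0 < N)%N -> t \in `[0, T] ->
  nrm (fun x => u t x - proj N (u t) x) <= proj_gap * N%:R `^ (- mu).
Proof.
move=> N0 tT; have [d1 _ _] := sol_derives tT.
rewrite /proj_gap -mulrA; apply: (tail_bound mu0 N0 K0 d1 (sol_periodic tT)).
  by move=> M; exact: hK.
by move=> M x; have [h _] := sol_proj_bounds M tT; exact: h.
Qed.

(** Gronwall for the square of the norm of [e], the difference of [v] and the
    projection of [u]: its derivative is at most [B |e|^2 + 2 s |e|] with
    [s = energy_source * N^(1 - mu)], and [2 s |e| <= |e|^2 + s^2]. *)
Lemma galerkin_error N (v : R -> R -> R) : (0 < N)%N -> semidiscrete T N u0 v ->
  forall t, t \in `[0, T] ->
  nrm (fun x => v t x - proj N (u t) x) <= galerkin_const * N%:R `^ (1 - mu).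
Proof.
move=> N0 [hv dv v0] t tT.
have Np : 0 < N%:R :> R by rewrite ltr0n.
have Nm : 0 <= N%:R `^ (1 - mu) :> R by exact: powR_ge0.
pose e r x := v r x - proj N (u r) x.
have he r : r \in `[0, T] -> in_S N (e r).
  by move=> rT; apply: in_SB; [exact: hv | exact: proj_in_S].
pose et r x := kdvF N (v r) x - proj N (ut r) x.
have de r x : 0 < r < T -> is_derive r 1 (e ^~ x) (et r x).
  move=> rT; have d1 := proj_time_derive N x rT.
  have d2 : is_derive r 1 (v ^~ x) (kdvF N (v r) x).
    exact: is_derive_on_interior rT (dv r x (oo_cc rT)).
  exact: is_deriveB.
pose d := (energy_source * N%:R `^ (1 - mu)) ^+ 2.
have NN : N%:R * N%:R `^ (- mu) = N%:R `^ (1 - mu) :> R.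
  by rewrite powRD ?powRr1// ?ltW//; apply/implyP => _; rewrite gt_eqF.
have rate r : 0 < r < T -> 2 * integ (fun x => e r x * et r x) <= (B + 1) * node_sqnorm N (e r) + d.
  move=> rT; have rI := oo_cc rT.
  have [d1 d2 d3] := sol_derives rI; have [sb c3] := sol_smooth rI.
  have [p0 p1 p2] := sol_endpoints rI; have [wB w1B] := sol_proj_bounds N rI.
  have fB x : `|u r x| <= B by have [] := sb x.
  rewrite (node_sqnormE (he r rI)).
  apply: le_trans (energy_rate d1 d2 d3 c3 p0 p1 p2 fB wB w1B (hv r rI)) _.
  have gap := sol_proj_gap N0 rI.
  have n0 := nrm_ge0 (e r).
  have gap2 : B * N%:R * nrm (fun x => u r x - proj N (u r) x) <=
      energy_source * N%:R `^ (1 - mu).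
    rewrite /energy_source -NN.
    have -> : B * proj_gap * (N%:R * N%:R `^ (- mu)) =
       B * N%:R * (proj_gap * N%:R `^ (- mu)) by ring.
    by rewrite ler_wpM2l// mulr_ge0.
  rewrite -/(e r) /d; move: n0 gap2.
  move: (nrm (fun x => v r x - _)) (B * N%:R * nrm _) (energy_source * _) => n g s n0 gs.
  have h1 : g * n <= s * n by rewrite ler_wpM2r.
  have := sqr_ge0 (n - s); nra.
have cont_sq : {within `[0, T], continuous (fun r => node_sqnorm N (e r))}.
  apply/subspace_continuousP => r rT.
  have rI : r \in `[0, T] by exact: rT.
  apply: cvgM; first exact: cvg_cst.
  rewrite (_ : (fun r => _) = fun r => \sum_(p <- index_enum 'I_((N + N).+1))
     e r (p%:R * (2 * pi / (N + N).+1%:R)) ^+ 2) //.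
  apply: cvg_sum_seq => p.
  set x := p%:R * _.
  have cx : e s x @[s --> within `[0, T] (nbhs r)] --> e r x.
    apply: cvgB; last exact: proj_time_continuous.
    exact: is_derive_on_continuous (dv r x rI).
  by apply: (cvg_comp _ _ cx (@exprn_continuous _ 2 _)).
have zero : node_sqnorm N (e 0) = 0.
  have I0 : (0 : R) \in `[0, T] by rewrite in_itv /= lexx ltW.
  rewrite (node_sqnormE (he 0 I0)) /nrm (@eq_integ _ _ (fun=> 0)) ?integ_cst ?mul0r ?sqrtr0 ?expr0n//.
  have [_ _ u00 _] := sol.
  have -> : e 0 = fun=> 0.
    apply/funext => x; rewrite /e v0.
    by have -> : u 0 = u0 by [apply/funext => y]; rewrite subrr.
  by move=> x; rewrite expr0n.
have dE r : 0 < r < T -> is_derive r 1 (fun r => node_sqnorm N (e r)) (2 * integ (fun x => e r x * et r x)).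
  move=> rT; apply: (is_derive_node_sqnorm (he r (oo_cc rT))).
    by apply: in_SB; [apply: kdvF_in_S; exact: hv (oo_cc rT) | exact: proj_in_S].
  by move=> x; exact: de.
have B1 : 0 <= B + 1 by rewrite addr_ge0.
have tI : 0 <= t <= T by move: tT; rewrite in_itv.
have := gronwall B1 (sqr_ge0 _) dE rate cont_sq zero tI.
rewrite (node_sqnormE (he t tT)) -/(e t) => h.
have gc0 : 0 <= energy_source.
  by rewrite /energy_source mulr_ge0// /proj_gap mulr_ge0 ?sqrtr_ge0.
rewrite -ler_sqr ?nnegrE ?nrm_ge0 ?mulr_ge0 ?sqrtr_ge0//.
apply: le_trans h _; rewrite /d /galerkin_const.
have T1 : 0 <= T * expR ((B + 1) * T) by rewrite mulr_ge0 ?expR_ge0// ltW.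
rewrite le_eqVlt; apply/orP; left; apply/eqP.
rewrite !exprMn (sqr_sqrtr T1); move: (expR _) => E; ring.
Qed.

End Error.
End Semidiscrete.

(** * The error estimate *)


(** The projection of [u] is bounded by decay of the coefficients.  For the error
    the weight is at most [2 N] and the inverse inequality costs another [2 N];
    both are absorbed by [N^(1 - mu)]. *)
Lemma galerkin_wiener (R : realType) (T mu : R) (u0 : R -> R) (u : R -> R -> R) (K : R) :
  0 < T -> 6 <= mu -> kdv_solution T mu u0 u -> 0 <= K ->
  (forall t N, t \in `[0, T] -> sobolev_sum mu N (u t) <= K ^+ 2) ->
  forall N (v : R -> R -> R), (0 < N)%N -> semidiscrete T N u0 v ->
  forall t, t \in `[0, T] ->
  wiener deriv_weight N (v t) <= 4 * galerkin_const T K + 10 * K.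
Proof.
move=> T0 mu6 sol K0 hK N v N0 hv t tT.
have err := galerkin_error T0 mu6 sol K0 hK N0 hv tT.
have [hvS _ _] := hv; have hw := proj_in_S N (u t).
have he := in_SB (hvS t tT) hw.
have cw := in_S_continuous hw; have ce := in_S_continuous he.
have -> : v t = fun x => proj N (u t) x + (v t x - proj N (u t) x).
  by apply/funext => x; rewrite addrC subrK.
have wt0 k : 0 <= deriv_weight k :> R by exact: le_trans ler01 (deriv_weight_ge1 k).
apply: le_trans (wienerD N wt0 cw ce) _; rewrite addrC; apply: lerD.
  apply: (@le_trans _ _ (wiener (fun k => (2 * N%:R) * 1) N (fun x => v t x - proj N (u t) x))).
    apply: le_wiener => k kN; rewrite mulr1 /deriv_weight.
    have := freqs_normr (R := R) kN; have : 1 <= N%:R :> R by rewrite ler1n.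
    by move: `|k%:~R| (N%:R) => a c; lra.
  rewrite wienerZl.
  apply: (@le_trans _ _ (2 * N%:R * (Num.sqrt (3 * N%:R) * (galerkin_const T K * N%:R `^ (1 - mu))))).
    rewrite ler_wpM2l ?mulr_ge0//; apply: le_trans (wiener1_nrm N0 he) _.
    by rewrite ler_wpM2l ?sqrtr_ge0.
  have G0 : 0 <= galerkin_const T K.
    rewrite /galerkin_const /energy_source /proj_gap.
    by rewrite !mulr_ge0 ?sqrtr_ge0.
  have N1 : 1 <= N%:R :> R by rewrite ler1n.
  have sN := @sqrt_3N_le R N N0.
  have small : N%:R * N%:R * N%:R `^ (1 - mu) <= 1 :> R.
    apply: (@le_trans _ _ (N%:R ^+ 2 * N%:R `^ (- 2))).
      rewrite expr2 ler_wpM2l ?mulr_ge0//; apply: ler_powR => //; lra.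
    by rewrite powRN -powR_mulrn// mulfV// powR_eq0 negb_and pnatr_eq0 -lt0n N0.
  apply: (@le_trans _ _ (2 * N%:R * (2 * N%:R * (galerkin_const T K * N%:R `^ (1 - mu))))).
    by rewrite ler_wpM2l ?mulr_ge0// ler_wpM2r// mulr_ge0 ?powR_ge0.
  have -> : 2 * N%:R * (2 * N%:R * (galerkin_const T K * N%:R `^ (1 - mu))) =
     (4 * galerkin_const T K) * (N%:R * N%:R * N%:R `^ (1 - mu)) by ring.
  by rewrite ler_piMr// mulr_ge0.
have [d1 _ _] := sol_derives sol tT; have cu := derives_continuous d1.
have dec := sol_decay mu6 K0 hK tT.
have b0 := wiener_proj_bound K0 dec N (isT : (0 <= 4)%N).
have b1 := wiener_proj_bound K0 dec N (isT : (1 <= 4)%N).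
have -> : wiener deriv_weight N (proj N (u t)) =
   \sum_(k <- freqs N) `|k%:~R| ^+ 0 * fourier_mod (u t) k +
   \sum_(k <- freqs N) `|k%:~R| ^+ 1 * fourier_mod (u t) k.
  rewrite -big_split /wiener big_seq [RHS]big_seq; apply: eq_bigr => k kN /=.
  by rewrite (fourier_mod_proj cu kN) /deriv_weight expr0 expr1 mulrDl.
by apply: le_trans (lerD b0 b1) _; lra.
Qed.

Theorem theorem5p3 (R : realType) (T : R) (s : nat) (b : nat -> R)
    (alpha : nat) :
  0 < T -> (1 <= s)%N -> (forall i, (1 <= i <= s)%N -> b i != 0) ->
  (1 <= alpha)%N ->
  exists mu0 : R, forall mu : R, mu0 <= mu ->
  forall (u0 : R -> R) (u : R -> R -> R), kdv_solution T mu u0 u ->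
  forall uN : nat -> R -> R -> R,
    (forall N, (1 <= N)%N -> semidiscrete T N u0 (uN N)) ->
  forall (D : nat -> nat -> Prop) (V : nat -> nat -> nat -> nat -> R -> R)
    (C0 : R),
    (forall N M, D N M -> (1 <= N)%N /\ (1 <= M)%N) ->
    (forall N M n, D N M -> (n < M)%N ->
       time_step N s b (T / M%:R) (uN N (n%:R * (T / M%:R))) (V N M n)) ->
    (forall N M n, D N M -> (n < M)%N ->
       (L2norm (uN N (n.+1%:R * (T / M%:R)) \- V N M n s)%R
          <= (C0 * (T / M%:R) ^+ alpha.+1)%:E)%E) ->
  exists c C : R, 0 < c /\
    forall N M, D N M -> T / M%:R * N%:R <= c ->
    exists (U : nat -> R -> R) (Y : nat -> nat -> R -> R),
      [/\ fully_discrete N s b (T / M%:R) u0 M U Y,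
          forall m U' Y', (m <= M)%N ->
            fully_discrete N s b (T / M%:R) u0 m U' Y' ->
            (forall n x, (n <= m)%N -> U' n x = U n x) /\
            (forall n i x, (n < m)%N -> (i <= s)%N -> Y' n i x = Y n i x)
        & forall n, (n <= M)%N ->
            (L2norm (U n \- u (n%:R * (T / M%:R)))%R
               <= (C * ((T / M%:R) ^+ alpha + N%:R `^ (1 - mu)))%:E)%E].
Proof.
(* [mu >= 6] serves [sobolev_decay]: four derivatives of the partial sums are
   summable. *)
move=> T0 s1 _ alpha1; exists 6 => mu mu6 u0 u sol uN hN D V C0 DNM hV hloc.
have [K [K0 hK]] := sobolev_sum_bounded_in_time sol.
set G : R := galerkin_const T K; set P : R := proj_gap K.
have P0 : 0 <= P by rewrite mulr_ge0 ?sqrtr_ge0.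
have G0 : 0 <= G.
  by rewrite /G /galerkin_const /energy_source -/P !mulr_ge0 ?sqrtr_ge0.
pose r := 4 * G + 10 * K; have r0 : 0 <= r by rewrite addr_ge0 ?mulr_ge0.
pose beta : R := \sum_(i < s.+1) `|b i|.
have beta0 : 0 <= beta by exact: sumr_ge0.
have bbeta i : (i <= s)%N -> `|b i| <= beta.
  move=> iS; have iS' : (i < s.+1)%N by [].
  by rewrite /beta (bigD1 (Ordinal iS')) //= lerDl sumr_ge0.
have [C0' C00 C0C0'] : exists2 C0', 0 <= C0' & C0 <= C0'.
  by exists `|C0|; [exact: normr_ge0 | exact: ler_norm].
pose E := stability_const s T beta r C0'.
pose Q := beta * 5 ^+ s * wiener_radius s alpha T beta r C0'.
have E0 : 0 <= E by rewrite /E /stability_const !mulr_ge0 ?expR_ge0// ltW.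
have Q0 : 0 <= Q.
  have R0 : 0 <= wiener_radius s alpha T beta r C0'.
    by rewrite /wiener_radius -/E addr_ge0// mulr_ge0 ?exprn_ge0 ?(ltW T0)// mulr_ge0.
  by rewrite /Q mulr_ge0// mulr_ge0// exprn_ge0.
(* The two conditions of [discrete_error]: [k N <= 1] and [k N Q <= 1/2]. *)
pose c := Num.min 1 (2 * (Q + 1))^-1.
have Q1 : 0 < 2 * (Q + 1) by rewrite mulr_gt0// ltr_wpDl.
exists c, (E + G + P); split; first by rewrite /c lt_min ltr01 invr_gt0.
move=> N M DN kNc; have [N0 M0] := DNM N M DN.
have Mp : 0 < M%:R :> R by rewrite ltr0n.
set k := T / M%:R in kNc *.
have k0 : 0 <= k by rewrite divr_ge0// ltW.
have kn n : (n <= M)%N -> n%:R * k \in `[0, T].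
  move=> nM; rewrite in_itv /= mulr_ge0//= /k mulrCA ler_piMr ?(ltW T0)//.
  by rewrite ler_pdivrMr// mul1r ler_nat.
have kN1 : k * N%:R <= 1 by apply: le_trans kNc _; rewrite /c ge_min lexx.
have small : k * N%:R * Q <= 2^-1.
  have h : k * N%:R <= (2 * (Q + 1))^-1.
    by apply: le_trans kNc _; rewrite /c ge_min lexx orbT.
  apply: le_trans (ler_wpM2r Q0 h) _.
  by rewrite mulrC ler_pdivrMr//; lra.
have [hS _ h0] := hN N N0.
pose w n := uN N (n%:R * k).
have hw n : (n <= M)%N -> in_S N (w n) by move=> nM; apply: hS; exact: kn.
have wr n : (n <= M)%N -> wiener deriv_weight N (w n) <= r.
  by move=> nM; exact: (galerkin_wiener T0 mu6 sol K0 hK N0 (hN N N0) (kn n nM)).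
have w0 : w 0%N = proj N u0 by apply/funext => x; rewrite /w mul0r h0.
have hVn n : (n < M)%N -> time_step N s b k (w n) (V N M n) by exact: hV.
have loc n : (n < M)%N -> nrm (fun x => w n.+1 x - V N M n s x) <= C0' * k ^+ alpha.+1.
  move=> nM; have [hVS _ _] := hVn n nM.
  have cd := in_S_continuous (in_SB (hw n.+1 nM) (hVS s (leqnn s))).
  have := hloc N M n DN nM; rewrite -/k -/(w n.+1) (L2norm_nrm cd) lee_fin => h.
  by apply: le_trans h _; rewrite ler_wpM2r ?exprn_ge0.
have [U [Y [hUY uniq close]]] := discrete_error N0 M0 alpha1 T0 beta0 bbeta r0 C00
  hw wr w0 hVn loc kN1 small.
exists U, Y; split=> // n nM.
have tn := kn n nM; have [hU _ _] := hUY.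
have cU := in_S_continuous (hU n nM); have cw := in_S_continuous (hw n nM).
have cu := sol_continuous sol tn.
have cp := in_S_continuous (proj_in_S N (u (n%:R * k))).
have gal := galerkin_error T0 mu6 sol K0 hK N0 (hN N N0) tn; rewrite -/(w n) in gal.
have gap := sol_proj_gap mu6 sol K0 hK N0 tn.
have cUu : continuous (U n \- u (n%:R * k)) by exact: continuous_sub.
rewrite (L2norm_nrm cUu) lee_fin.
have {close} := close n nM; rewrite -/(stability_const _ _ _ _ _) -/E => close.
move: (u (n%:R * k)) (proj N (u (n%:R * k))) (w n) (U n) cU cu cp cw gal gap close cUu
  => f p v y cy cf cp cv gal gap close _.
have c1 : continuous (fun x => y x - v x) by cont.
have c2 : continuous (fun x => v x - p x) by cont.
have c3 : continuous (fun x => f x - p x) by cont.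
have c4 : continuous (fun x => - (f x - p x)) by cont.
have -> : nrm (y \- f) = nrm (fun x => (y x - v x) + ((v x - p x) + (- (f x - p x)))).
  by apply: eq_nrm => x /=; ring.
apply: le_trans (ler_nrmD c1 (continuous_add c2 c4)) _.
apply: le_trans (lerD (lexx _) (ler_nrmD c2 c4)) _; rewrite nrmN.
have NmN : N%:R `^ (- mu) <= N%:R `^ (1 - mu) :> R.
  by apply: ler_powR; [rewrite ler1n | lra].
have gap2 := le_trans gap (ler_wpM2l P0 NmN).
have ka0 : 0 <= k ^+ alpha by exact: exprn_ge0.
have Nm0 : 0 <= N%:R `^ (1 - mu) :> R by exact: powR_ge0.
move: close gal gap2; rewrite -/G -/P.
move: (k ^+ alpha) (N%:R `^ (1 - mu)) ka0 Nm0 => X Z X0 Z0 h1 h2 h3.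
apply: le_trans (lerD h1 (lerD h2 h3)) _.
have := mulr_ge0 E0 Z0; have := mulr_ge0 G0 X0; have := mulr_ge0 P0 X0.
by rewrite !mulrDl !mulrDr; lra.
Qed.
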